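(* Let $d\ge 2$ and $U=U(S_{\rm std},\mathcal{P}_{\rm std},G_{2d})$ acting on $\ell^2(\mathbb{Z}^d,\mathbb{C}^{2d})$. Then both $1$ and $-1$ are eigenvalues of $U$ and $U$ has no other eigenvalues. Let $\Pi_\pm$ be the orthogonal projections onto the eigenspaces of $U$ for the eigenvalues $\pm1$. Then for every $\phi\in\mathbb{C}^{2d}$ and $x\in\mathbb{Z}^d$, $$\lim_{N\to\infty}\frac1N\sum_{n=1}^N p_n(\phi;x)=\|\Pi_+(\delta_0\otimes\phi)(x)\|^2_{\mathbb{C}^{2d}}+\|\Pi_-(\delta_0\otimes\phi)(x)\|^2_{\mathbb{C}^{2d}}.$$ In particular there exist $\phi_o\in\mathbb{C}^{2d}$ and $x_o\in\mathbb{Z}^d$ with $\limsup_{n\to\infty}p_n(\phi_o;x_o)>0$.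
   Context: Let $u_1,\dots,u_d$ be the standard basis of $\mathbb{Z}^d$ and $\mathbf{e}_1,\dots,\mathbf{e}_{2d}$ the standard basis of $\mathbb{C}^{2d}$; $P_j$ is the orthogonal projection onto $\mathbb{C}\mathbf{e}_j$. $S_{\rm std}=\{\pm u_1,\dots,\pm u_d\}$, $\mathcal{P}_{\rm std}=\{P_\alpha\}_{\alpha\in S_{\rm std}}$ with $P_{u_j}=P_{2j-1}$, $P_{-u_j}=P_{2j}$. For $\alpha\in\mathbb{Z}^d$, $(\tau^\alpha f)(x)=f(x-\alpha)$ on $\ell^2(\mathbb{Z}^d,\mathbb{C}^{2d})$. For a unitary $2d\times2d$ matrix $C$ acting pointwise, $U(S_{\rm std},\mathcal{P}_{\rm std},C)=\big(\sum_{\alpha\in S_{\rm std}}\tau^\alpha P_\alpha\big)C$. The Grover matrix is $G_D=\frac2D J-I$, where $J$ is the $D\times D$ all-ones matrix. For $\phi\in\mathbb{C}^{2d}$, $\delta_0\otimes\phi$ equals $\phi$ at $0$ and $0$ elsewhere, and $p_n(\phi;x)=\|U^n(\delta_0\otimes\phi)(x)\|^2$. Eigenvalue means element of the point spectrum. *)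

(* Defs.v *)
From Stdlib Require Import Reals Lra Lia ZArith Arith List.
Import ListNotations.
Open Scope R_scope.

Record Cx := mkCx { re : R ; im : R }.
Definition Czero : Cx := mkCx 0 0.
Definition Cone : Cx := mkCx 1 0.
Definition Cmone : Cx := mkCx (-1) 0.
Definition CR (a : R) : Cx := mkCx a 0.
Definition Cadd (a b : Cx) : Cx := mkCx (re a + re b) (im a + im b).
Definition Csub (a b : Cx) : Cx := mkCx (re a - re b) (im a - im b).
Definition Cmul (a b : Cx) : Cx :=
  mkCx (re a * re b - im a * im b) (re a * im b + im a * re b).
Definition Cconj (a : Cx) : Cx := mkCx (re a) (- im a).
Definition Cnorm2 (a : Cx) : R := re a * re a + im a * im a.

Definition Rlsum (l : list R) : R := fold_right Rplus 0 l.
Definition Clsum (l : list Cx) : Cx := fold_right Cadd Czero l.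

(** * The lattice Z^d and states in l^2(Z^d, C^{2d})
    A point of Z^d is a list of integers of length d.
    A (candidate) state is a function [list Z -> nat -> Cx]; the value
    [f x k] is the k-th coordinate (0-indexed, k < 2d) of f(x) in C^{2d}.
    Genuine elements of l^2(Z^d,C^{2d}) are those supported on
    {length x = d} x {k < 2d} with finite l^2 norm (predicate [in_H]). *)
Definition state := list Z -> nat -> Cx.

Fixpoint Zl_add (x y : list Z) : list Z :=
  match x, y with
  | a :: x', b :: y' => (a + b)%Z :: Zl_add x' y'
  | _, _ => []
  end.
Definition Zl_opp (x : list Z) : list Z := map Z.opp x.
Definition Zl_sub (x y : list Z) : list Z := Zl_add x (Zl_opp y).

Definition unit_vec (d j : nat) : list Z :=
  map (fun i => if Nat.eqb i j then 1%Z else 0%Z) (seq 0 d).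
Definition zero_pt (d : nat) : list Z := repeat 0%Z d.

Definition zrange (r : nat) : list Z :=
  map (fun n => (Z.of_nat n - Z.of_nat r)%Z) (seq 0 (2 * r + 1)).
Fixpoint box (d r : nat) : list (list Z) :=
  match d with
  | O => [ [] ]
  | S d' => flat_map (fun z => map (cons z) (box d' r)) (zrange r)
  end.

Definition box_norm2 (d r : nat) (f : state) : R :=
  Rlsum (map (fun x => Rlsum (map (fun k => Cnorm2 (f x k)) (seq 0 (2 * d)))) (box d r)).

Definition in_H (d : nat) (f : state) : Prop :=
  (forall x k, (length x <> d \/ (2 * d <= k)%nat) -> f x k = Czero) /\
  (exists M, forall r, box_norm2 d r f <= M).

Definition inner_partial (d r : nat) (g h : state) : Cx :=
  Clsum (map (fun x => Clsum (map (fun k => Cmul (Cconj (g x k)) (h x k)) (seq 0 (2 * d))))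
             (box d r)).

Definition ortho (d : nat) (g h : state) : Prop :=
  Un_cv (fun r => re (inner_partial d r g h)) 0 /\
  Un_cv (fun r => im (inner_partial d r g h)) 0.

(** * The quantum walk U(S_std, P_std, C)
    S_std = {±u_1,...,±u_d}; P_{u_j} = P_{2j-1}, P_{-u_j} = P_{2j} (1-indexed),
    i.e. with 0-indexed j and 0-indexed coordinates, +u_j projects onto
    coordinate 2j and -u_j onto coordinate 2j+1. *)
Definition S_std (d : nat) : list (list Z * nat) :=
  flat_map (fun j => [ (unit_vec d j, (2 * j)%nat) ; (Zl_opp (unit_vec d j), (2 * j + 1)%nat) ])
           (seq 0 d).

Definition mat_apply (d : nat) (C : nat -> nat -> Cx) (v : nat -> Cx) : nat -> Cx :=
  fun k => Clsum (map (fun m => Cmul (C k m) (v m)) (seq 0 (2 * d))).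

(** (U f)(x) = sum_{alpha in S_std} P_alpha ((C f)(x - alpha)) *)
Definition U_walk (d : nat) (C : nat -> nat -> Cx) (f : state) : state :=
  fun x k =>
    if andb (Nat.eqb (length x) d) (Nat.ltb k (2 * d)) then
      Clsum (map (fun ai : list Z * nat =>
                    if Nat.eqb k (snd ai)
                    then mat_apply d C (f (Zl_sub x (fst ai))) k
                    else Czero) (S_std d))
    else Czero.

Definition Grover (D : nat) : nat -> nat -> Cx :=
  fun k m => CR (2 / INR D - (if Nat.eqb k m then 1 else 0)).

Definition U_grover (d : nat) : state -> state := U_walk d (Grover (2 * d)).

Definition eigenvalue (d : nat) (U : state -> state) (lam : Cx) : Prop :=
  exists f, in_H d f /\ (exists x k, f x k <> Czero) /\
            (forall x k, U f x k = Cmul lam (f x k)).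

Definition is_eig_proj (d : nat) (U : state -> state) (lam : Cx) (g h : state) : Prop :=
  in_H d h /\ (forall x k, U h x k = Cmul lam (h x k)) /\
  (forall e, in_H d e -> (forall x k, U e x k = Cmul lam (e x k)) ->
             ortho d (fun x k => Csub (g x k) (h x k)) e).

Definition delta0_tensor (d : nat) (phi : nat -> Cx) : state :=
  fun x k => if andb (if list_eq_dec Z.eq_dec x (zero_pt d) then true else false)
                     (Nat.ltb k (2 * d))
             then phi k else Czero.

Definition vnorm2 (d : nat) (v : nat -> Cx) : R :=
  Rlsum (map (fun k => Cnorm2 (v k)) (seq 0 (2 * d))).

Definition p_n (d : nat) (U : state -> state) (n : nat) (phi : nat -> Cx) (x : list Z) : R :=
  vnorm2 d (Nat.iter n U (delta0_tensor d phi) x).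

(** Cesàro mean (1/N) sum_{n=1}^N p_n, indexed by N-1 (i.e. term N = 1, 2, ...) *)
Definition cesaro (d : nat) (U : state -> state) (phi : nat -> Cx) (x : list Z) (N : nat) : R :=
  / INR (S N) * Rlsum (map (fun n => p_n d U n phi x) (seq 1 (S N))).

(* Main.v *)
Require Import Defs.
From Stdlib Require Import Reals ZArith List.
From Stdlib Require Import Lra Lia Classical ClassicalEpsilon FunctionalExtensionality FinFun.
From mathcomp Require filter.
Open Scope R_scope.

(** The Grover walk is a real operator, so real and imaginary parts evolve separately and it is
    enough to study the real walk [W] on square-summable functions.

    The key fact is that a square-summable kernel [F] invariant under [W (x) W] satisfies
    [W^2 F = F] in each variable. Put [V = W^-1] acting on the second variable, so that
    [W F = V F] with [W] acting on the first, and [A = V + V^-1], [T_j = tau_j + tau_j^-1]. With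
    [s] twice the average of the [2d] components [F_k], the functions
    [g_j = F_(2j) + F_(2j+1) - s] satisfy [sum_j g_j = 0] and [(A + T_j) g_j = (V^-1 - V) s] for
    every [j]. Eliminating the [g_j] gives [sum_j prod_(i <> j) (A + T_i) ((V^-1 - V) s) = 0], and
    this operator is injective because [T_m b + c = 0] forces [b = 0] when [c] is obtained from [b]
    by commuting symmetric operators (a conserved Casoratian). Hence [(V^-1 - V) s = 0], and then
    [(V^-1 - V) F = 0].

    An eigenfunction [g + i h] yields the invariant kernel [g (x) g + h (x) h], which forces the
    eigenvalue to be [1] or [-1]. For the time averages, Banach limits of [W^n f] and
    [(-1)^n W^n f] are the two spectral projections of [f]; if [f] is orthogonal to both
    eigenspaces, any Banach limit of [W^n f (x) W^n f] is an invariant kernel whose slices are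
    orthogonal to the kernel of [W^2 - 1] and also lie in it, hence vanish. A bounded sequence on
    which all Banach limits agree has convergent averages. *)

(** Kernels stand in for spectral theory. On a Fourier mode with eigenvalue [lam] and momentum
    [theta] the component equations give [g_j = (1/lam - lam) s / (lam + 1/lam + 2 cos theta_j)],
    and the condition [sum_j g_j = 0] is the dispersion relation of the Grover walk. Here [lam] is
    replaced by the operator [V] on the second variable, so that one argument covers eigenfunctions
    and the rest of the spectrum alike; the denominators become the operators [A + T_j], which are
    cleared and only shown to be injective, never inverted. Square-summability of the kernel is what
    excludes other solutions: pairings of hyperplane slices tend to zero at infinity, so a conserved
    pairing must vanish. Such kernels are available for time averages because [W^n f (x) W^n f] has
    constant norm: a Banach limit of it is again square-summable and exactly invariant, whereas a
    finite average is invariant only up to a boundary term. *)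

Definition lsum {J : Type} (f : J -> R) (l : list J) : R := Rlsum (map f l).

Lemma lsum_cons {J} (f : J -> R) a l : lsum f (a :: l) = f a + lsum f l.
Proof. reflexivity. Qed.

Lemma lsum_app {J} (f : J -> R) l l' : lsum f (l ++ l') = lsum f l + lsum f l'.
Proof.
  induction l as [|a l IH]; simpl; [unfold lsum; simpl; ring|].
  rewrite !lsum_cons, IH; ring.
Qed.

Lemma lsum_lin {J} (a b : R) (f g : J -> R) l :
  lsum (fun j => a * f j + b * g j) l = a * lsum f l + b * lsum g l.
Proof.
  induction l as [|x l IH]; [unfold lsum; simpl; ring|].
  rewrite !lsum_cons, IH; ring.
Qed.

Lemma lsum_ext_in {J} (f g : J -> R) l :
  (forall j, In j l -> f j = g j) -> lsum f l = lsum g l.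
Proof.
  induction l as [|x l IH]; intros H; [reflexivity|].
  rewrite !lsum_cons, IH, (H x); auto with datatypes.
Qed.

Lemma lsum_zero {J} (f : J -> R) l : (forall j, In j l -> f j = 0) -> lsum f l = 0.
Proof.
  intros H; induction l as [|x l IH]; [reflexivity|].
  rewrite lsum_cons, IH, (H x); auto with datatypes; ring.
Qed.

Lemma lsum_map {I J} (b : I -> J) (f : J -> R) l : lsum f (map b l) = lsum (fun i => f (b i)) l.
Proof. unfold lsum; now rewrite map_map. Qed.

Lemma lsum_le {J} (f g : J -> R) l : (forall j, In j l -> f j <= g j) -> lsum f l <= lsum g l.
Proof.
  intros H; induction l as [|x l IH]; [unfold lsum; simpl; lra|].
  rewrite !lsum_cons; pose proof (H x (or_introl eq_refl)).
  assert (lsum f l <= lsum g l) by (apply IH; intros; apply H; now right); lra.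
Qed.

Lemma lsum_nonneg {J} (f : J -> R) l : (forall j, 0 <= f j) -> 0 <= lsum f l.
Proof.
  intros H; induction l as [|x l IH]; [unfold lsum; simpl; lra|].
  rewrite lsum_cons; pose proof (H x); lra.
Qed.

Lemma lsum_incl {J} (f : J -> R) l l' :
  (forall j, 0 <= f j) -> NoDup l -> incl l l' -> lsum f l <= lsum f l'.
Proof.
  intros Hf; revert l'; induction l as [|a l IH]; intros l' Hn Hi.
  - now apply lsum_nonneg.
  - inversion Hn as [|? ? Ha Hl]; subst.
    destruct (in_split a l' (Hi a (or_introl eq_refl))) as [l1 [l2 E]]; subst l'.
    assert (incl l (l1 ++ l2)).
    { intros y Hy. assert (Hy' := Hi y (or_intror Hy)).
      apply in_app_or in Hy'. apply in_or_app. destruct Hy' as [Hy'|[Hy'|Hy']]; auto.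
      subst; contradiction. }
    pose proof (IH (l1 ++ l2) Hl H) as H1.
    rewrite lsum_app in *; rewrite !lsum_cons; lra.
Qed.

Definition cdec {J : Type} (x y : J) : {x = y} + {x <> y} := excluded_middle_informative (x = y).

Definition union {J : Type} (l l' : list J) : list J := nodup cdec (l ++ l').

Lemma union_nodup {J} (l l' : list J) : NoDup (union l l').
Proof. apply NoDup_nodup. Qed.

Lemma union_l {J} (l l' : list J) : incl l (union l l').
Proof. intros x Hx; apply nodup_In, in_or_app; auto. Qed.

Lemma union_r {J} (l l' : list J) : incl l' (union l l').
Proof. intros x Hx; apply nodup_In, in_or_app; auto. Qed.

(** * Unordered sums *)

(** Convergence along the net of finite sets, represented by duplicate-free lists: no enumeration of
    the index type is chosen, so sums can be reindexed by any bijection. *)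
Definition has_sum {J : Type} (f : J -> R) (s : R) : Prop :=
  forall eps, 0 < eps -> exists l0 : list J,
    forall l, NoDup l -> incl l0 l -> Rabs (lsum f l - s) < eps.

Definition summ {J : Type} (f : J -> R) : Prop :=
  exists M, forall l : list J, NoDup l -> lsum (fun j => Rabs (f j)) l <= M.

Definition sm {J : Type} (f : J -> R) : R := epsilon (inhabits 0) (has_sum f).

Lemma has_sum_unique {J} (f : J -> R) s s' : has_sum f s -> has_sum f s' -> s = s'.
Proof.
  intros H H'. destruct (Req_dec s s') as [|Hn]; auto.
  assert (He : 0 < Rabs (s - s') / 2) by (pose proof (Rabs_pos_lt (s - s')); lra).
  destruct (H _ He) as [l Hl], (H' _ He) as [l' Hl'].
  specialize (Hl _ (union_nodup l l') (union_l l l')).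
  specialize (Hl' _ (union_nodup l l') (union_r l l')).
  revert He Hl Hl'; unfold Rabs; repeat destruct Rcase_abs; lra.
Qed.

Lemma sm_eq {J} (f : J -> R) s : has_sum f s -> sm f = s.
Proof.
  intros H. apply (has_sum_unique f); auto.
  unfold sm; apply epsilon_spec; now exists s.
Qed.

Lemma has_sum_lin {J} (a b : R) (f g : J -> R) s t :
  has_sum f s -> has_sum g t -> has_sum (fun j => a * f j + b * g j) (a * s + b * t).
Proof.
  intros Hf Hg eps He.
  (* The summand [1] keeps [K] positive when [a = b = 0]. *)
  set (K := Rabs a + Rabs b + 1).
  assert (HK : 0 < K) by (unfold K; pose proof (Rabs_pos a); pose proof (Rabs_pos b); lra).
  assert (He' : 0 < eps / K) by now apply Rdiv_lt_0_compat.
  destruct (Hf _ He') as [l Hl], (Hg _ He') as [l' Hl'].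
  exists (l ++ l'); intros m Hm Hi.
  specialize (Hl m Hm (fun x h => Hi x (in_or_app _ _ _ (or_introl h)))).
  specialize (Hl' m Hm (fun x h => Hi x (in_or_app _ _ _ (or_intror h)))).
  rewrite lsum_lin.
  replace (a * lsum f m + b * lsum g m - (a * s + b * t))
    with (a * (lsum f m - s) + b * (lsum g m - t)) by ring.
  eapply Rle_lt_trans; [apply Rabs_triang|]; rewrite !Rabs_mult.
  assert (E : eps = K * (eps / K)) by (field; lra).
  pose proof (Rabs_pos a); pose proof (Rabs_pos b).
  assert (Rabs a * Rabs (lsum f m - s) <= Rabs a * (eps / K)) by (apply Rmult_le_compat_l; lra).
  assert (Rabs b * Rabs (lsum g m - t) <= Rabs b * (eps / K)) by (apply Rmult_le_compat_l; lra).
  unfold K in E at 1; lra.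
Qed.

Lemma has_sum_nonneg_ex {J} (f : J -> R) M :
  (forall j, 0 <= f j) -> (forall l, NoDup l -> lsum f l <= M) ->
  exists s, has_sum f s /\ s <= M /\ forall l, NoDup l -> lsum f l <= s.
Proof.
  intros Hf HM.
  destruct (completeness (fun r => exists l, NoDup l /\ r = lsum f l)) as [s [Hub Hlub]].
  - exists M; intros r [l [Hl ->]]; auto.
  - exists 0, nil; split; [constructor|reflexivity].
  - exists s; repeat split.
    + intros eps He.
      destruct (classic (exists l, NoDup l /\ s - eps < lsum f l)) as [[l [Hl Hs]]|Hn].
      * exists l; intros m Hm Hi.
        pose proof (lsum_incl f l m Hf Hl Hi).
        assert (lsum f m <= s) by (apply Hub; now exists m).
        rewrite Rabs_left1; lra.
      * assert (s <= s - eps); [|lra].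
        apply Hlub; intros r [l [Hl ->]].
        destruct (Rle_dec (lsum f l) (s - eps)); auto.
        exfalso; apply Hn; exists l; split; auto; lra.
    + apply Hlub; intros r [l [Hl ->]]; auto.
    + intros l Hl; apply Hub; now exists l.
Qed.

Lemma summ_le {J} (f g : J -> R) : (forall j, Rabs (f j) <= g j) -> summ g -> summ f.
Proof.
  intros H [M HM]; exists M; intros l Hl.
  eapply Rle_trans; [|apply (HM l Hl)].
  apply lsum_le; intros j _; pose proof (H j).
  eapply Rle_trans; [apply H|]; apply Rle_abs.
Qed.

(** Positive and negative parts have bounded finite sums, hence sums given by suprema; [f] is their
    difference. *)
Lemma summ_has_sum {J} (f : J -> R) : summ f -> has_sum f (sm f).
Proof.
  intros [M HM].
  assert (H1 : forall j, 0 <= (Rabs (f j) + f j) / 2).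
  { intros j; unfold Rabs; destruct Rcase_abs; lra. }
  assert (H2 : forall j, 0 <= (Rabs (f j) - f j) / 2).
  { intros j; unfold Rabs; destruct Rcase_abs; lra. }
  assert (B1 : forall l, NoDup l -> lsum (fun j => (Rabs (f j) + f j) / 2) l <= M).
  { intros l Hl; eapply Rle_trans; [|apply (HM l Hl)].
    apply lsum_le; intros j _; unfold Rabs; destruct Rcase_abs; lra. }
  assert (B2 : forall l, NoDup l -> lsum (fun j => (Rabs (f j) - f j) / 2) l <= M).
  { intros l Hl; eapply Rle_trans; [|apply (HM l Hl)].
    apply lsum_le; intros j _; unfold Rabs; destruct Rcase_abs; lra. }
  destruct (has_sum_nonneg_ex _ _ H1 B1) as [s [Hs _]].
  destruct (has_sum_nonneg_ex _ _ H2 B2) as [t [Ht _]].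
  pose proof (has_sum_lin 1 (-1) _ _ _ _ Hs Ht) as H.
  replace f with (fun j => 1 * ((Rabs (f j) + f j) / 2) + -1 * ((Rabs (f j) - f j) / 2)).
  2: { extensionality j; field. }
  now rewrite (sm_eq _ _ H).
Qed.

Lemma summ_lin {J} (a b : R) (f g : J -> R) :
  summ f -> summ g -> summ (fun j => a * f j + b * g j).
Proof.
  intros [M HM] [N HN]; exists (Rabs a * M + Rabs b * N); intros l Hl.
  apply Rle_trans with (lsum (fun j => Rabs a * Rabs (f j) + Rabs b * Rabs (g j)) l).
  - apply lsum_le; intros j _; rewrite <- !Rabs_mult; apply Rabs_triang.
  - rewrite lsum_lin; specialize (HM l Hl); specialize (HN l Hl).
    pose proof (Rabs_pos a); pose proof (Rabs_pos b); nra.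
Qed.

Lemma sm_lin {J} (a b : R) (f g : J -> R) :
  summ f -> summ g -> sm (fun j => a * f j + b * g j) = a * sm f + b * sm g.
Proof. intros; apply sm_eq, has_sum_lin; now apply summ_has_sum. Qed.

Lemma sm_zero {J} : sm (fun _ : J => 0) = 0.
Proof.
  apply sm_eq; intros eps He; exists nil; intros l _ _.
  rewrite lsum_zero by auto; rewrite Rminus_0_r, Rabs_R0; lra.
Qed.

Lemma sm_ge_lsum {J} (f : J -> R) l : (forall j, 0 <= f j) -> summ f -> NoDup l -> lsum f l <= sm f.
Proof.
  intros Hf [M HM] Hl.
  assert (HM' : forall l, NoDup l -> lsum f l <= M).
  { intros m Hm; eapply Rle_trans; [|apply (HM m Hm)]; apply lsum_le; intros; apply Rle_abs. }
  destruct (has_sum_nonneg_ex _ _ Hf HM') as [s [Hs [_ H]]].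
  rewrite (sm_eq _ _ Hs); auto.
Qed.

Lemma sm_le_bound {J} (f : J -> R) M :
  (forall j, 0 <= f j) -> (forall l, NoDup l -> lsum f l <= M) -> sm f <= M.
Proof.
  intros Hf HM; destruct (has_sum_nonneg_ex _ _ Hf HM) as [s [Hs [H _]]].
  now rewrite (sm_eq _ _ Hs).
Qed.

Lemma sm_nonneg {J} (f : J -> R) : (forall j, 0 <= f j) -> summ f -> 0 <= sm f.
Proof. intros Hf H; apply (sm_ge_lsum f nil); auto; constructor. Qed.

Lemma sm_null {J} (f : J -> R) j : (forall j, 0 <= f j) -> summ f -> sm f = 0 -> f j = 0.
Proof.
  intros Hf H E. pose proof (sm_ge_lsum f (j :: nil) Hf H) as H'.
  rewrite lsum_cons in H'; unfold lsum in H'; simpl in H'.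
  assert (f j + 0 <= sm f) by (apply H'; constructor; [auto|constructor]).
  pose proof (Hf j); lra.
Qed.

Lemma preimage_list {I J} (b : I -> J) (l : list J) :
  (forall i i', b i = b i' -> i = i') -> exists l', forall i, In (b i) l -> In i l'.
Proof.
  intros Hb; induction l as [|j l [l' IH]].
  - exists nil; auto.
  - destruct (classic (exists i, b i = j)) as [[i <-]|Hn].
    + exists (i :: l'); intros i' [E|Hi]; [left; auto|right; auto].
    + exists l'; intros i' [E|Hi]; [exfalso; apply Hn; now exists i'|auto].
Qed.

Lemma NoDup_map_inj {I J} (b : I -> J) l :
  (forall i i', b i = b i' -> i = i') -> NoDup l -> NoDup (map b l).
Proof. intros Hb; apply Injective_map_NoDup; intros i i'; apply Hb. Qed.

Lemma has_sum_inj {I J} (b : I -> J) (f : J -> R) s :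
  (forall i i', b i = b i' -> i = i') -> (forall j, (forall i, b i <> j) -> f j = 0) ->
  has_sum f s -> has_sum (fun i => f (b i)) s.
Proof.
  intros Hb Hz H eps He. destruct (H eps He) as [l0 Hl0].
  destruct (preimage_list b l0 Hb) as [l0' Hl0'].
  exists l0'; intros l Hl Hi.
  set (out := fun j => if excluded_middle_informative (exists i, b i = j) then false else true).
  (* The image of [l] need not contain [l0]; the missing points lie outside the range of [b], where
     [f] vanishes, so adding them does not change the sum. *)
  set (m := map b l ++ filter out (nodup cdec l0)).
  assert (Hout : forall j, out j = true -> forall i, b i <> j).
  { intros j; unfold out; destruct excluded_middle_informative as [|n]; [discriminate|].
    intros _ i E; apply n; now exists i. }
  replace (lsum (fun i => f (b i)) l) with (lsum f m).
  - apply Hl0; unfold m.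
    + apply NoDup_app; [now apply NoDup_map_inj|apply NoDup_filter, NoDup_nodup|].
      intros j Hj Hj'; apply filter_In in Hj'; apply in_map_iff in Hj.
      destruct Hj as [i [E _]]; exact (Hout j (proj2 Hj') i E).
    + intros j Hj; apply in_or_app.
      destruct (excluded_middle_informative (exists i, b i = j)) as [[i <-]|n] eqn:E.
      * left; apply in_map; auto.
      * right; apply filter_In; split; [now apply nodup_In|unfold out; now rewrite E].
  - unfold m; rewrite lsum_app, lsum_map, (lsum_zero f (filter _ _)); [ring|].
    intros j Hj; apply filter_In in Hj; apply Hz, Hout; tauto.
Qed.

Lemma summ_inj {I J} (b : I -> J) (f : J -> R) :
  (forall i i', b i = b i' -> i = i') -> summ f -> summ (fun i => f (b i)).
Proof.
  intros Hb [M HM]; exists M; intros l Hl.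
  rewrite <- (lsum_map b (fun j => Rabs (f j))); apply HM; now apply NoDup_map_inj.
Qed.

Lemma sm_inj {I J} (b : I -> J) (f : J -> R) :
  (forall i i', b i = b i' -> i = i') -> (forall j, (forall i, b i <> j) -> f j = 0) ->
  summ f -> sm (fun i => f (b i)) = sm f.
Proof. intros; apply sm_eq, has_sum_inj; auto; now apply summ_has_sum. Qed.

Lemma sm_reindex {J} (b b' : J -> J) (f : J -> R) :
  (forall j, b' (b j) = j) -> (forall j, b (b' j) = j) ->
  summ f -> sm (fun j => f (b j)) = sm f.
Proof.
  intros H1 H2 Hf; apply sm_inj; auto.
  - intros i i' E; rewrite <- (H1 i), <- (H1 i'); now f_equal.
  - intros j Hj; exfalso; apply (Hj (b' j)); auto.
Qed.

(** A list whose sum of absolute values comes within [eps] of the supremum leaves at most [eps] for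
    any disjoint list. *)
Lemma summ_tail {J} (f : J -> R) eps : summ f -> 0 < eps ->
  exists l0, NoDup l0 /\ forall l, NoDup l -> (forall j, In j l -> ~ In j l0) ->
    lsum (fun j => Rabs (f j)) l <= eps.
Proof.
  intros [M HM] He.
  destruct (has_sum_nonneg_ex (fun j => Rabs (f j)) M (fun j => Rabs_pos _) HM) as [s [Hs [_ Hb]]].
  destruct (Hs eps He) as [l0 H].
  exists (nodup cdec l0); split; [apply NoDup_nodup|]; intros l Hl Hd.
  assert (Hn : NoDup (l ++ nodup cdec l0)).
  { apply NoDup_app; auto; apply NoDup_nodup. }
  pose proof (Hb _ Hn) as H1; rewrite lsum_app in H1.
  specialize (H (nodup cdec l0) (NoDup_nodup _ _) (fun x h => proj2 (nodup_In _ _ _) h)).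
  apply Rabs_def2 in H; lra.
Qed.

(** * Square-summable functions *)

Definition l2 {J : Type} (f : J -> R) : Prop := summ (fun j => f j * f j).
Definition ip {J : Type} (f g : J -> R) : R := sm (fun j => f j * g j).

Lemma l2_mul {J} (f g : J -> R) : l2 f -> l2 g -> summ (fun j => f j * g j).
Proof.
  intros Hf Hg. apply summ_le with (fun j => /2 * (f j * f j) + /2 * (g j * g j)).
  - intros j; pose proof (Rle_0_sqr (f j - g j)) as H1; pose proof (Rle_0_sqr (f j + g j)) as H2.
    unfold Rsqr in H1, H2; unfold Rabs; destruct Rcase_abs; lra.
  - now apply summ_lin.
Qed.

Lemma l2_lin {J} (a b : R) (f g : J -> R) : l2 f -> l2 g -> l2 (fun j => a * f j + b * g j).
Proof.
  intros Hf Hg.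
  apply summ_le with (fun j => (2 * (a * a)) * (f j * f j) + (2 * (b * b)) * (g j * g j)).
  - intros j; rewrite Rabs_pos_eq by apply Rle_0_sqr.
    pose proof (Rle_0_sqr (a * f j - b * g j)) as H; unfold Rsqr in H; lra.
  - now apply summ_lin.
Qed.

Lemma l2_bound {J} (f : J -> R) M :
  (forall l, NoDup l -> lsum (fun j => f j * f j) l <= M) -> l2 f.
Proof.
  intros H; exists M; intros l Hl; eapply Rle_trans; [|apply (H l Hl)].
  apply lsum_le; intros j _; rewrite Rabs_pos_eq; nra.
Qed.

Lemma l2_zero {J} : l2 (fun _ : J => 0).
Proof. apply l2_bound with 0; intros; rewrite lsum_zero; [lra|intros; ring]. Qed.

Lemma l2_inj {I J} (b : I -> J) (f : J -> R) :
  (forall i i', b i = b i' -> i = i') -> l2 f -> l2 (fun i => f (b i)).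
Proof. intros Hb; apply (summ_inj b (fun j => f j * f j) Hb). Qed.

Lemma l2_dom {J} (f g : J -> R) : (forall j, f j = 0 \/ f j = g j) -> l2 g -> l2 f.
Proof.
  intros H Hg; apply summ_le with (2 := Hg); intros j.
  rewrite Rabs_pos_eq by nra; destruct (H j) as [-> | ->]; nra.
Qed.

Lemma ip_sym {J} (f g : J -> R) : ip f g = ip g f.
Proof. unfold ip; f_equal; extensionality j; ring. Qed.

Lemma ip_lin_l {J} (a b : R) (f g h : J -> R) : l2 f -> l2 g -> l2 h ->
  ip (fun j => a * f j + b * g j) h = a * ip f h + b * ip g h.
Proof.
  intros Hf Hg Hh; unfold ip.
  rewrite <- sm_lin by now apply l2_mul.
  f_equal; extensionality j; ring.
Qed.

Lemma ip_lin_r {J} (a b : R) (f g h : J -> R) : l2 f -> l2 g -> l2 h ->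
  ip h (fun j => a * f j + b * g j) = a * ip h f + b * ip h g.
Proof. intros; rewrite ip_sym, ip_lin_l, (ip_sym f), (ip_sym g); auto. Qed.

Lemma ip_pos {J} (f : J -> R) : l2 f -> 0 <= ip f f.
Proof. intros; apply sm_nonneg; auto; intros; nra. Qed.

Lemma ip_def {J} (f : J -> R) j : l2 f -> ip f f = 0 -> f j = 0.
Proof.
  intros H E. assert (f j * f j = 0); [|nra].
  apply (sm_null (fun j => f j * f j)); auto; intros; nra.
Qed.

(** A form of Cauchy-Schwarz without square roots: expand the norm of [f + t g] at [t = 1/c] and
    [t = -1/c] and multiply by [c]. The free weight [c] lets a small [g] compensate a merely bounded
    [f]. *)
Lemma ip_amgm {J} (c : R) (f g : J -> R) : 0 < c -> l2 f -> l2 g ->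
  Rabs (ip f g) <= (c * ip f f + / c * ip g g) / 2.
Proof.
  intros Hc Hf Hg.
  assert (Hq : forall t, 0 <= ip f f + 2 * t * ip f g + t * t * ip g g).
  { intros t. pose proof (ip_pos _ (l2_lin 1 t f g Hf Hg)) as H.
    rewrite ip_lin_l in H by auto using l2_lin.
    rewrite !ip_lin_r in H by auto.
    rewrite (ip_sym g f) in H; lra. }
  assert (Hi : 0 < / c) by now apply Rinv_0_lt_compat.
  assert (E : c * / c = 1) by (field; lra).
  pose proof (Hq (/ c)); pose proof (Hq (- / c)).
  assert (H1 : 0 <= c * (ip f f + 2 * / c * ip f g + / c * / c * ip g g)) by nra.
  assert (H2 : 0 <= c * (ip f f + 2 * - / c * ip f g + - / c * - / c * ip g g)) by nra.
  replace (c * (ip f f + 2 * / c * ip f g + / c * / c * ip g g))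
    with (c * ip f f + 2 * (c * / c) * ip f g + (c * / c) * (/ c * ip g g)) in H1 by ring.
  replace (c * (ip f f + 2 * - / c * ip f g + - / c * - / c * ip g g))
    with (c * ip f f - 2 * (c * / c) * ip f g + (c * / c) * (/ c * ip g g)) in H2 by ring.
  rewrite E in H1, H2.
  unfold Rabs; destruct Rcase_abs; lra.
Qed.

Lemma ip_reindex {J} (b b' : J -> J) (f g : J -> R) :
  (forall j, b' (b j) = j) -> (forall j, b (b' j) = j) -> l2 f -> l2 g ->
  ip (fun j => f (b j)) g = ip f (fun j => g (b' j)).
Proof.
  intros H1 H2 Hf Hg; unfold ip.
  rewrite <- (sm_reindex b b' (fun j => f j * g (b' j))); auto.
  - f_equal; extensionality j; now rewrite H1.
  - apply l2_mul; auto. apply (l2_inj b'); auto.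
    intros i i' E; rewrite <- (H2 i), <- (H2 i'); now f_equal.
Qed.

(** * Banach limits *)

Definition bdd (u : nat -> R) : Prop := exists K, forall n, Rabs (u n) <= K.

Record banach_limit (M : (nat -> R) -> R) : Prop := {
  bl_lin : forall a b u v, bdd u -> bdd v -> M (fun n => a * u n + b * v n) = a * M u + b * M v;
  bl_pos : forall u, bdd u -> (forall n, 0 <= u n) -> 0 <= M u;
  bl_one : M (fun _ => 1) = 1;
  bl_shift : forall u, bdd u -> M (fun n => u (S n)) = M u }.

(** The mean of [u 1, ..., u (N + 1)]: the offset is that of [cesaro], and it keeps the denominator
    positive. *)
Definition av (u : nat -> R) (N : nat) : R := / INR (S N) * lsum u (seq 1 (S N)).

Lemma Rabs_le_bounds x K : Rabs x <= K -> - K <= x <= K.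
Proof. unfold Rabs; destruct Rcase_abs; lra. Qed.

Lemma bdd_lin a b u v : bdd u -> bdd v -> bdd (fun n => a * u n + b * v n).
Proof.
  intros [K HK] [K' HK']; exists (Rabs a * K + Rabs b * K'); intros n.
  eapply Rle_trans; [apply Rabs_triang|]; rewrite !Rabs_mult.
  apply Rplus_le_compat; apply Rmult_le_compat_l; auto using Rabs_pos.
Qed.

Lemma bdd_const c : bdd (fun _ => c).
Proof. exists (Rabs c); intros; lra. Qed.

Lemma bdd_mul u v : bdd u -> bdd v -> bdd (fun n => u n * v n).
Proof.
  intros [K HK] [K' HK']; exists (K * K'); intros n; rewrite Rabs_mult.
  apply Rmult_le_compat; auto using Rabs_pos.
Qed.

Lemma bdd_comp u (phi : nat -> nat) : bdd u -> bdd (fun n => u (phi n)).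
Proof. intros [K HK]; exists K; auto. Qed.

Lemma av_lin a b u v N : av (fun n => a * u n + b * v n) N = a * av u N + b * av v N.
Proof. unfold av; rewrite lsum_lin; ring. Qed.

Lemma INR_S_pos N : 0 < INR (S N).
Proof. apply lt_0_INR; lia. Qed.

Lemma lsum_const {J} c (l : list J) : lsum (fun _ => c) l = INR (length l) * c.
Proof.
  induction l as [|a l IH]; [unfold lsum; simpl; ring|].
  rewrite lsum_cons, IH; cbn [length]; rewrite S_INR; ring.
Qed.

Lemma av_const c N : av (fun _ => c) N = c.
Proof. unfold av; rewrite lsum_const, length_seq; field; pose proof (INR_S_pos N); lra. Qed.

Lemma av_le u v N : (forall n, u n <= v n) -> av u N <= av v N.
Proof.
  intros H; apply Rmult_le_compat_l; [left; apply Rinv_0_lt_compat, INR_S_pos|].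
  now apply lsum_le.
Qed.

Lemma bdd_av u : bdd u -> bdd (av u).
Proof.
  intros [K HK]; exists K; intros N; apply Rabs_le; split.
  - rewrite <- (av_const (- K) N); apply av_le; intros n.
    specialize (HK n); apply Rabs_le_bounds in HK; lra.
  - rewrite <- (av_const K N); apply av_le; intros n.
    specialize (HK n); apply Rabs_le_bounds in HK; lra.
Qed.

Lemma av_shift u N : av (fun n => u (S n)) N - av u N = / INR (S N) * (u (S (S N)) - u 1%nat).
Proof.
  unfold av.
  assert (E : forall k, lsum (fun n => u (S n)) (seq 1 k) + u 1%nat = lsum u (seq 1 (S k))).
  { intros k; cbn [seq]; rewrite lsum_cons, <- (seq_shift k 1), lsum_map; ring. }
  specialize (E (S N)); rewrite (seq_S (S N) 1), lsum_app in E.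
  unfold lsum at 3 in E; simpl Rlsum in E.
  replace (lsum (fun n : nat => u (S n)) (seq 1 (S N))) with
    (lsum u (seq 1 (S N)) + u (S (S N)) - u 1%nat) by (simpl in *; lra).
  ring.
Qed.

Lemma cv_inv_S : Un_cv (fun N => / INR (S N)) 0.
Proof.
  intros eps He; destruct (archimed_cor1 eps He) as [N [HN HN0]].
  exists N; intros n Hn; unfold Rdist; rewrite Rminus_0_r.
  rewrite Rabs_pos_eq by (left; apply Rinv_0_lt_compat, INR_S_pos).
  eapply Rle_lt_trans; [|exact HN].
  apply Rinv_le_contravar; [apply lt_0_INR; lia|apply le_INR; lia].
Qed.

(** * Limits along a free ultrafilter *)

Section Ultrafilter.

Variable G : (nat -> Prop) -> Prop.
Hypothesis Gtrue : G (fun _ => True).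
Hypothesis Gfalse : ~ G (fun _ => False).
Hypothesis Gand : forall A B, G A -> G B -> G (fun n => A n /\ B n).
Hypothesis Gimp : forall A B : nat -> Prop, (forall n, A n -> B n) -> G A -> G B.
Hypothesis Gultra : forall A : nat -> Prop, G A \/ G (fun n => ~ A n).
Hypothesis Gcofin : forall N, G (fun n => (N <= n)%nat).

Definition ulim_rel (u : nat -> R) (c : R) : Prop :=
  forall eps, 0 < eps -> G (fun n => Rabs (u n - c) < eps).
Definition ulim (u : nat -> R) : R := epsilon (inhabits 0) (ulim_rel u).

Lemma G_ex A : G A -> exists n, A n.
Proof.
  intros H; apply NNPP; intros Hn; apply Gfalse; apply Gimp with (2 := H).
  intros n HA; apply Hn; now exists n.
Qed.

(** The limit is the supremum of the levels [c] with [c <= u n] on a set of [G]. Just below it such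
    a set exists; just above it the ultrafilter must contain the complement. *)
Lemma ulim_rel_ex u : bdd u -> exists c, ulim_rel u c.
Proof.
  intros [K HK].
  destruct (completeness (fun c => G (fun n => c <= u n))) as [s [Hub Hlub]].
  - exists K; intros c Hc; destruct (G_ex _ Hc) as [n Hn].
    specialize (HK n); apply Rabs_le_bounds in HK; lra.
  - exists (- K); apply Gimp with (2 := Gtrue); intros n _.
    specialize (HK n); apply Rabs_le_bounds in HK; lra.
  - exists s; intros eps He.
    destruct (classic (exists c, s - eps < c /\ G (fun n => c <= u n))) as [[c [Hc Gc]]|Hn].
    2: { assert (s <= s - eps); [|lra]. apply Hlub; intros c Hc.
         destruct (Rle_dec c (s - eps)); auto; exfalso; apply Hn; exists c; split; [lra|auto]. }
    destruct (Gultra (fun n => s + eps / 2 <= u n)) as [H|H].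
    + specialize (Hub _ H); simpl in Hub; lra.
    + apply Gimp with (2 := Gand _ _ Gc H); intros n [H1 H2]; apply Rabs_def1; lra.
Qed.

Lemma ulim_spec u : bdd u -> ulim_rel u (ulim u).
Proof. intros H; unfold ulim; apply epsilon_spec; now apply ulim_rel_ex. Qed.

Lemma ulim_unique u c : ulim_rel u c -> ulim u = c.
Proof.
  intros H. assert (H' : ulim_rel u (ulim u)) by (unfold ulim; apply epsilon_spec; now exists c).
  destruct (Req_dec (ulim u) c) as [|Hn]; auto.
  assert (He : 0 < Rabs (ulim u - c) / 2) by (pose proof (Rabs_pos_lt (ulim u - c)); lra).
  destruct (G_ex _ (Gand _ _ (H _ He) (H' _ He))) as [n [H1 H2]].
  revert He H1 H2; unfold Rabs; repeat destruct Rcase_abs; lra.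
Qed.

Lemma ulim_lin a b u v : bdd u -> bdd v ->
  ulim (fun n => a * u n + b * v n) = a * ulim u + b * ulim v.
Proof.
  intros Hu Hv; apply ulim_unique; intros eps He.
  set (K := Rabs a + Rabs b + 1).
  assert (HK : 0 < K) by (unfold K; pose proof (Rabs_pos a); pose proof (Rabs_pos b); lra).
  assert (He' : 0 < eps / K) by now apply Rdiv_lt_0_compat.
  apply Gimp with (2 := Gand _ _ (ulim_spec _ Hu _ He') (ulim_spec _ Hv _ He')).
  intros n [H1 H2].
  replace (a * u n + b * v n - (a * ulim u + b * ulim v))
    with (a * (u n - ulim u) + b * (v n - ulim v)) by ring.
  eapply Rle_lt_trans; [apply Rabs_triang|]; rewrite !Rabs_mult.
  assert (E : eps = K * (eps / K)) by (field; lra).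
  pose proof (Rabs_pos a); pose proof (Rabs_pos b).
  assert (Rabs a * Rabs (u n - ulim u) <= Rabs a * (eps / K)) by (apply Rmult_le_compat_l; lra).
  assert (Rabs b * Rabs (v n - ulim v) <= Rabs b * (eps / K)) by (apply Rmult_le_compat_l; lra).
  unfold K in E at 1; lra.
Qed.

Lemma ulim_ge u c : bdd u -> (forall n, c <= u n) -> c <= ulim u.
Proof.
  intros Hu H; apply Rnot_lt_le; intros Hlt.
  destruct (G_ex _ (ulim_spec _ Hu (c - ulim u) ltac:(lra))) as [n Hn].
  specialize (H n); apply Rabs_def2 in Hn; lra.
Qed.

Lemma ulim_le u c : bdd u -> (forall n, u n <= c) -> ulim u <= c.
Proof.
  intros Hu H; apply Rnot_lt_le; intros Hlt.
  destruct (G_ex _ (ulim_spec _ Hu (ulim u - c) ltac:(lra))) as [n Hn].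
  specialize (H n); apply Rabs_def2 in Hn; lra.
Qed.

Lemma ulim_cv u c : Un_cv u c -> ulim u = c.
Proof.
  intros H; apply ulim_unique; intros eps He; destruct (H eps He) as [N HN].
  apply Gimp with (2 := Gcofin N); intros n Hn; apply (HN n Hn).
Qed.

(** An ultrafilter limit alone is not shift invariant. A shift changes the averages by at most
    [2 K / (N + 1)], which tends to zero along [phi]. The map [phi] selects the subsequence of
    averages that the limit observes. *)
Lemma ulim_av_banach (phi : nat -> nat) : (forall N, (N <= phi N)%nat) ->
  banach_limit (fun u => ulim (fun N => av u (phi N))).
Proof.
  intros Hphi; split.
  - intros a b u v Hu Hv.
    rewrite <- ulim_lin by (apply bdd_comp, bdd_av; auto).
    f_equal; extensionality N; apply av_lin.
  - intros u Hu H; apply ulim_ge; [now apply bdd_comp, bdd_av|].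
    intros N; rewrite <- (av_const 0 (phi N)); now apply av_le.
  - apply ulim_cv; intros eps He; exists 0%nat; intros n _.
    rewrite av_const; unfold Rdist; rewrite Rminus_diag, Rabs_R0; lra.
  - intros u Hu.
    assert (Hu' := bdd_comp _ S Hu).
    assert (E : ulim (fun N => 1 * av (fun n => u (S n)) (phi N) + (-1) * av u (phi N)) = 0).
    { apply ulim_cv. destruct Hu as [K HK].
      assert (HK0 : 0 <= K) by (eapply Rle_trans; [apply Rabs_pos|apply (HK 0%nat)]).
      intros eps He.
      (* The denominator is [2 K + 1] rather than [2 K], to allow [K = 0]. *)
      destruct (cv_inv_S (eps / (2 * K + 1)) ltac:(apply Rdiv_lt_0_compat; lra)) as [N HN].
      exists N; intros n Hn.
      specialize (HN (phi n) ltac:(specialize (Hphi n); lia)).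
      unfold Rdist in *; rewrite Rminus_0_r in *.
      replace (1 * av (fun n0 => u (S n0)) (phi n) + -1 * av u (phi n))
        with (av (fun n0 => u (S n0)) (phi n) - av u (phi n)) by ring.
      rewrite av_shift, Rabs_mult.
      assert (H2 : Rabs (u (S (S (phi n))) - u 1%nat) <= 2 * K).
      { pose proof (HK (S (S (phi n)))) as H1; pose proof (HK 1%nat) as H2.
        apply Rabs_le_bounds in H1; apply Rabs_le_bounds in H2; apply Rabs_le; lra. }
      assert (E : eps = eps / (2 * K + 1) * (2 * K + 1)) by (field; lra).
      set (x := Rabs (/ INR (S (phi n)))) in *.
      assert (0 <= x) by apply Rabs_pos.
      pose proof (Rabs_pos (u (S (S (phi n))) - u 1%nat)).
      assert (x * Rabs (u (S (S (phi n))) - u 1%nat) <= x * (2 * K + 1))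
        by (apply Rmult_le_compat_l; lra).
      assert (x * (2 * K + 1) < eps / (2 * K + 1) * (2 * K + 1))
        by (apply Rmult_lt_compat_r; lra).
      lra. }
    rewrite ulim_lin in E by (apply bdd_comp, bdd_av; auto). lra.
Qed.

End Ultrafilter.

(** Extends the filter of cofinite sets, which makes the ultrafilter free. *)
Lemma ultrafilter_nat_ex : exists G : (nat -> Prop) -> Prop,
  G (fun _ => True) /\ ~ G (fun _ => False) /\
  (forall A B, G A -> G B -> G (fun n => A n /\ B n)) /\
  (forall A B : nat -> Prop, (forall n, A n -> B n) -> G A -> G B) /\
  (forall A : nat -> Prop, G A \/ G (fun n => ~ A n)) /\
  (forall N, G (fun n => (N <= n)%nat)).
Proof.
  pose (E := fun A : nat -> Prop => exists N, forall n, (N <= n)%nat -> A n).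
  assert (HE : filter.ProperFilter E).
  { constructor.
    - intros [N HN]; exact (HN N (le_n _)).
    - constructor.
      + now exists 0%nat.
      + intros A B [N HN] [N' HN']; exists (Nat.max N N'); intros n Hn.
        split; [apply HN|apply HN']; lia.
      + intros A B HAB [N HN]; exists N; intros n Hn; apply HAB; auto. }
  destruct (filter.ultraFilterLemma HE) as [G [HG HEG]].
  pose proof (filter.ultra_proper (UltraFilter := HG)) as HP.
  pose proof (filter.filter_filter (ProperFilter := HP)) as HF.
  exists G; repeat split.
  - apply (filter.filterT (Filter := HF)).
  - apply (filter.filter_not_empty G (ProperFilter := HP)).
  - intros A B; apply (filter.filterI (Filter := HF)).
  - intros A B HAB; apply (filter.filterS (Filter := HF)); exact HAB.
  - intros A; apply (filter.in_ultra_setVsetC A HG).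
  - intros N; apply HEG; now exists N.
Qed.

(** The second clause ties [M] to the averages along [phi]: one-sided bounds on these pass to
    [M]. *)
Lemma banach_limit_ex (phi : nat -> nat) : (forall N, (N <= phi N)%nat) ->
  exists M, banach_limit M /\ forall u c, bdd u ->
    ((forall N, c <= av u (phi N)) -> c <= M u) /\ ((forall N, av u (phi N) <= c) -> M u <= c).
Proof.
  intros Hphi; destruct ultrafilter_nat_ex as [G [H1 [H2 [H3 [H4 [H5 H6]]]]]].
  exists (fun u => ulim G (fun N => av u (phi N))); split.
  - now apply ulim_av_banach.
  - intros u c Hu; split; intros; [apply ulim_ge|apply ulim_le]; auto; now apply bdd_comp, bdd_av.
Qed.

(** If the averages did not converge to [c], they would stay above [c + eps] or below [c - eps]
    along some [phi], and the Banach limit built along that [phi] would differ from [c]. *)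
Lemma av_cv_of_banach u c : bdd u -> (forall M, banach_limit M -> M u = c) -> Un_cv (av u) c.
Proof.
  intros Hu H eps He. apply NNPP; intros Hn.
  assert (Hup : ~ forall N, exists n, (N <= n)%nat /\ c + eps <= av u n).
  { intros Hs; apply choice in Hs; destruct Hs as [phi Hphi].
    destruct (banach_limit_ex phi (fun N => proj1 (Hphi N))) as [M [HM HM']].
    pose proof (proj1 (HM' u (c + eps) Hu) (fun N => proj2 (Hphi N))) as Hc.
    rewrite (H M HM) in Hc; lra. }
  assert (Hdn : ~ forall N, exists n, (N <= n)%nat /\ av u n <= c - eps).
  { intros Hs; apply choice in Hs; destruct Hs as [phi Hphi].
    destruct (banach_limit_ex phi (fun N => proj1 (Hphi N))) as [M [HM HM']].
    pose proof (proj2 (HM' u (c - eps) Hu) (fun N => proj2 (Hphi N))) as Hc.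
    rewrite (H M HM) in Hc; lra. }
  apply not_all_ex_not in Hup; destruct Hup as [N1 HN1].
  apply not_all_ex_not in Hdn; destruct Hdn as [N2 HN2].
  apply Hn; exists (Nat.max N1 N2); intros n Hm; apply Rabs_def1.
  - apply Rnot_le_lt; intros Hle; apply HN1; exists n; split; [lia|lra].
  - apply Rnot_le_lt; intros Hle; apply HN2; exists n; split; [lia|lra].
Qed.

(** * Banach limits of bounded families of square-summable functions *)

Section BanachLimit.

Variable M : (nat -> R) -> R.
Hypothesis HM : banach_limit M.

Lemma bl_const c : M (fun _ => c) = c.
Proof.
  replace (fun _ : nat => c) with (fun _ : nat => c * 1 + 0 * 1) by (extensionality n; ring).
  rewrite (bl_lin M HM c 0 (fun _ => 1) (fun _ => 1)), (bl_one M HM); [ring| |]; apply bdd_const.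
Qed.

Lemma bl_add u v : bdd u -> bdd v -> M (fun n => u n + v n) = M u + M v.
Proof.
  intros; replace (fun n => u n + v n) with (fun n => 1 * u n + 1 * v n) by (extensionality n; ring).
  rewrite (bl_lin M HM); auto; ring.
Qed.

Lemma bl_scal a u : bdd u -> M (fun n => a * u n) = a * M u.
Proof.
  intros; replace (fun n => a * u n) with (fun n => a * u n + 0 * u n) by (extensionality n; ring).
  rewrite (bl_lin M HM); auto; ring.
Qed.

Lemma bl_le u v : bdd u -> bdd v -> (forall n, u n <= v n) -> M u <= M v.
Proof.
  intros Hu Hv H. pose proof (bl_pos M HM (fun n => 1 * v n + -1 * u n)) as H1.
  rewrite (bl_lin M HM) in H1 by auto.
  assert (0 <= 1 * M v + -1 * M u); [|lra].
  apply H1; [now apply bdd_lin|intros n; specialize (H n); lra].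
Qed.

(** Jensen's inequality, from [2 c u - c^2 <= u^2] with [c = M u]. *)
Lemma bl_sqr_le u : bdd u -> M u * M u <= M (fun n => u n * u n).
Proof.
  intros Hu. set (c := M u).
  assert (H1 : M (fun n => 2 * c * u n + - (c * c) * 1) <= M (fun n => u n * u n)).
  { apply bl_le; [apply bdd_lin; auto; apply bdd_const|now apply bdd_mul|].
    intros n; pose proof (Rle_0_sqr (u n - c)) as H; unfold Rsqr in H; lra. }
  rewrite (bl_lin M HM _ _ u (fun _ => 1)), (bl_one M HM) in H1; auto using bdd_const.
  fold c in H1; lra.
Qed.

Lemma bdd_lsum {J} (v : nat -> J -> R) l :
  (forall j, bdd (fun n => v n j)) -> bdd (fun n => lsum (v n) l).
Proof.
  intros H; induction l as [|a l IH]; [apply (bdd_const 0)|].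
  destruct (bdd_lin 1 1 _ _ (H a) IH) as [K HK]; exists K; intros n.
  rewrite lsum_cons; specialize (HK n); cbv beta in HK; rewrite !Rmult_1_l in HK; exact HK.
Qed.

Lemma bl_lsum {J} (v : nat -> J -> R) l : (forall j, bdd (fun n => v n j)) ->
  M (fun n => lsum (v n) l) = lsum (fun j => M (fun n => v n j)) l.
Proof.
  intros H; induction l as [|a l IH]; [apply (bl_const 0)|].
  rewrite lsum_cons, <- IH; apply (bl_add (fun n => v n a)); auto using bdd_lsum.
Qed.

Lemma l2_unif_bdd {J} (v : nat -> J -> R) K :
  (forall n, l2 (v n)) -> (forall n, ip (v n) (v n) <= K) -> forall j, bdd (fun n => v n j).
Proof.
  (* From [t^2 <= K] follows [|t| <= 1 + K], which avoids a square root. *)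
  intros Hv HK j; exists (1 + K); intros n.
  pose proof (sm_ge_lsum (fun j => v n j * v n j) (j :: nil)) as H.
  unfold lsum in H; simpl in H. rewrite Rplus_0_r in H.
  assert (v n j * v n j <= K).
  { eapply Rle_trans; [apply H; auto|apply HK].
    - intros; nra.
    - apply Hv.
    - constructor; [auto|constructor]. }
  unfold Rabs; destruct Rcase_abs; nra.
Qed.

(** A Fatou-type bound: Jensen in each coordinate, then the exchange of [M] with a finite sum. *)
Lemma bl_l2_bound {J} (v : nat -> J -> R) K :
  (forall n, l2 (v n)) -> (forall n, ip (v n) (v n) <= K) ->
  forall l, NoDup l -> lsum (fun j => M (fun n => v n j) * M (fun n => v n j)) l <= K.
Proof.
  intros Hv HK l Hl. pose proof (l2_unif_bdd v K Hv HK) as Hb.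
  apply Rle_trans with (lsum (fun j => M (fun n => v n j * v n j)) l).
  - apply lsum_le; intros j _; now apply bl_sqr_le.
  - rewrite <- (bl_lsum (fun n j => v n j * v n j)) by (intros; now apply bdd_mul).
    rewrite <- (bl_const K); apply bl_le; [|apply bdd_const|].
    + apply (bdd_lsum (fun n j => v n j * v n j)); intros; now apply bdd_mul.
    + intros n; eapply Rle_trans; [|apply (HK n)]; apply sm_ge_lsum; auto; [intros; nra|apply Hv].
Qed.

Lemma bl_l2 {J} (v : nat -> J -> R) K :
  (forall n, l2 (v n)) -> (forall n, ip (v n) (v n) <= K) -> l2 (fun j => M (fun n => v n j)).
Proof. intros; apply l2_bound with K; now apply bl_l2_bound. Qed.

Lemma ip_trunc {J} (f e : J -> R) l : NoDup l ->
  ip f (fun j => if in_dec cdec j l then e j else 0) = lsum (fun j => f j * e j) l.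
Proof.
  intros Hl; apply sm_eq; intros eps He; exists l; intros m Hm Hi.
  replace (lsum (fun j => f j * (if in_dec cdec j l then e j else 0)) m)
    with (lsum (fun j => f j * e j) l); [rewrite Rminus_diag, Rabs_R0; lra|].
  clear He eps; revert m Hm Hi; induction l as [|a l IH]; intros m Hm Hi.
  - symmetry; apply lsum_zero; intros j _; destruct in_dec as [[]|]; ring.
  - inversion Hl as [|? ? Ha Hl']; subst.
    destruct (in_split a m (Hi a (or_introl eq_refl))) as [l1 [l2 ->]].
    assert (Hm' := NoDup_remove_1 _ _ _ Hm); assert (Hm2 := NoDup_remove_2 _ _ _ Hm).
    rewrite lsum_app, !lsum_cons, (IH Hl' (l1 ++ l2) Hm').
    + rewrite lsum_app.
      destruct (in_dec cdec a (a :: l)) as [_|n]; [|exfalso; apply n; now left].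
      assert (Haux : forall k, (forall j, In j k -> In j (l1 ++ l2)) ->
        lsum (fun j => f j * (if in_dec cdec j (a :: l) then e j else 0)) k =
        lsum (fun j => f j * (if in_dec cdec j l then e j else 0)) k).
      { intros k Hk; apply lsum_ext_in; intros j Hj.
        destruct (in_dec cdec j (a :: l)) as [[->|h]|h], (in_dec cdec j l) as [h'|h'];
          try reflexivity; exfalso; auto.
        - apply h; now right. }
      rewrite !Haux; [ring| |]; intros j Hj; apply in_or_app; auto.
    + intros j Hj; assert (Hj' := Hi j (or_intror Hj)).
      apply in_app_or in Hj'; apply in_or_app; destruct Hj' as [|[<-|]]; auto; contradiction.
Qed.

(** Exchange of [M] with an infinite sum against a fixed [e]. Linearity handles a finite truncation
    of [e]; the norm bound [K], uniform in [n], controls the rest. *)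
Lemma bl_ip {J} (v : nat -> J -> R) (e : J -> R) K :
  (forall n, l2 (v n)) -> (forall n, ip (v n) (v n) <= K) -> l2 e ->
  ip (fun j => M (fun n => v n j)) e = M (fun n => ip (v n) e).
Proof.
  intros Hv HK He.
  pose proof (l2_unif_bdd v K Hv HK) as Hb.
  pose proof (bl_l2 v K Hv HK) as Hh.
  assert (HKh : ip (fun j => M (fun n => v n j)) (fun j => M (fun n => v n j)) <= K).
  { apply sm_le_bound; [intros; nra|now apply bl_l2_bound]. }
  set (h := fun j => M (fun n => v n j)) in *.
  assert (HK0 : 0 <= K) by (eapply Rle_trans; [apply (ip_pos (v 0%nat)); auto|auto]).
  assert (Hbi : forall e', l2 e' -> bdd (fun n => ip (v n) e')).
  { intros e' He'; exists ((1 * K + / 1 * ip e' e') / 2); intros n.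
    eapply Rle_trans; [apply (ip_amgm 1); auto; lra|]; specialize (HK n); lra. }
  apply cond_eq; intros eps Heps.
  (* With this weight the tail contributes at most [(c K + eps/2) / 2], which is below [eps/2] since
     [c (K + 1) = eps/2]. *)
  set (c := eps / (2 * (K + 1))).
  assert (Hc : 0 < c) by (apply Rdiv_lt_0_compat; lra).
  destruct (summ_tail _ (c * eps / 2) He) as [l0 [Hl0 Htail]]; [nra|].
  set (e0 := fun j => if in_dec cdec j l0 then e j else 0).
  set (e1 := fun j => if in_dec cdec j l0 then 0 else e j).
  assert (H0 : l2 e0).
  { apply l2_dom with e; auto; intros j; unfold e0; destruct in_dec; auto. }
  assert (H1 : l2 e1).
  { apply l2_dom with e; auto; intros j; unfold e1; destruct in_dec; auto. }
  assert (Hsmall : ip e1 e1 <= c * eps / 2).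
  { apply sm_le_bound; [intros; nra|]; intros l Hl.
    pose (m := filter (fun j => if in_dec cdec j l0 then false else true) l).
    apply Rle_trans with (lsum (fun j => Rabs (e j * e j)) m).
    - unfold m; clear Hl; induction l as [|a l IH]; [unfold lsum; simpl; lra|].
      cbn [filter]; rewrite lsum_cons; unfold e1 at 1 2; destruct in_dec.
      + lra.
      + rewrite lsum_cons; pose proof (Rle_abs (e a * e a)); lra.
    - apply Htail; [now apply NoDup_filter|].
      intros j Hj; apply filter_In in Hj; destruct Hj as [_ Hj], in_dec; [discriminate|auto]. }
  assert (Esplit : e = fun j => 1 * e0 j + 1 * e1 j).
  { extensionality j; unfold e0, e1; destruct in_dec; ring. }
  assert (Emain : ip h e0 = M (fun n => ip (v n) e0)).
  { unfold e0 at 1; rewrite ip_trunc by auto.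
    replace (fun n => ip (v n) e0) with (fun n => lsum (fun j => v n j * e j) l0).
    2: { extensionality n; unfold e0; now rewrite ip_trunc. }
    rewrite (bl_lsum (fun n j => v n j * e j)).
    2: { intros j; apply bdd_mul; auto; apply bdd_const. }
    apply lsum_ext_in; intros j _; unfold h.
    rewrite Rmult_comm, <- bl_scal; auto; f_equal; extensionality n; ring. }
  assert (Best : forall f, l2 f -> ip f f <= K -> Rabs (ip f e1) < eps / 2).
  { intros f Hf HfK; eapply Rle_lt_trans; [apply (ip_amgm c); auto|].
    assert (Ec : c * (K + 1) = eps / 2) by (unfold c; field; lra).
    assert (/ c * ip e1 e1 <= / c * (c * eps / 2)).
    { apply Rmult_le_compat_l; auto; left; now apply Rinv_0_lt_compat. }
    replace (/ c * (c * eps / 2)) with (eps / 2) in * by (field; lra).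
    assert (c * ip f f <= c * K) by (apply Rmult_le_compat_l; lra).
    lra. }
  assert (Em1 : Rabs (M (fun n => ip (v n) e1)) <= eps / 2).
  { apply Rabs_le; split.
    - rewrite <- (bl_const (- (eps / 2))); apply bl_le; auto using bdd_const.
      intros n; pose proof (Best (v n) (Hv n) (HK n)) as H; apply Rabs_def2 in H; lra.
    - rewrite <- (bl_const (eps / 2)); apply bl_le; auto using bdd_const.
      intros n; pose proof (Best (v n) (Hv n) (HK n)) as H; apply Rabs_def2 in H; lra. }
  pose proof (Best h Hh HKh) as Eh1.
  rewrite Esplit, ip_lin_r by auto.
  replace (fun n => ip (v n) (fun j => 1 * e0 j + 1 * e1 j))
    with (fun n => 1 * ip (v n) e0 + 1 * ip (v n) e1).
  2: { extensionality n; now rewrite ip_lin_r. }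
  rewrite (bl_lin M HM) by auto. rewrite <- Emain.
  apply Rabs_le_bounds in Em1; apply Rabs_def2 in Eh1; apply Rabs_def1; lra.
Qed.

End BanachLimit.

(** * Lattice shifts *)

(** Defined on lists of any length, and trivial past the end, so that shifts are bijections of the
    whole type [list Z] and no subtype of points of length [d] is required. *)
Fixpoint upd (j : nat) (n : Z) (x : list Z) : list Z :=
  match x with
  | nil => nil
  | a :: x' => match j with O => (a + n)%Z :: x' | S j' => a :: upd j' n x' end
  end.

Definition coord (j : nat) (x : list Z) : Z := nth j x 0%Z.

Lemma upd_upd j n m x : upd j n (upd j m x) = upd j (n + m) x.
Proof.
  revert x; induction j as [|j IH]; intros [|a x]; simpl; auto.
  - f_equal; lia.
  - now rewrite IH.
Qed.

Lemma upd_0 j x : upd j 0 x = x.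
Proof.
  revert x; induction j as [|j IH]; intros [|a x]; simpl; auto.
  - f_equal; lia.
  - now rewrite IH.
Qed.

Lemma upd_comm i j n m x : upd i n (upd j m x) = upd j m (upd i n x).
Proof.
  revert j x; induction i as [|i IH]; intros [|j] [|a x]; simpl; auto.
  - f_equal; lia.
  - now rewrite IH.
Qed.

Lemma upd_length j n x : length (upd j n x) = length x.
Proof. revert x; induction j as [|j IH]; intros [|a x]; simpl; auto. Qed.

Lemma coord_upd j n x : (j < length x)%nat -> coord j (upd j n x) = (coord j x + n)%Z.
Proof.
  unfold coord; revert x; induction j as [|j IH]; intros [|a x] H; simpl in *; auto; try lia.
  apply IH; lia.
Qed.

Lemma coord_upd_neq i j n x : i <> j -> coord i (upd j n x) = coord i x.
Proof.
  unfold coord; revert j x; induction i as [|i IH]; intros [|j] [|a x] H; simpl in *; auto; try lia.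
Qed.

Lemma upd_inv j n x : upd j (- n) (upd j n x) = x.
Proof. rewrite upd_upd, Z.add_opp_diag_l; apply upd_0. Qed.

Lemma upd_inv' j n x : upd j n (upd j (- n) x) = x.
Proof. rewrite upd_upd, Z.add_opp_diag_r; apply upd_0. Qed.

(** * Hyperplane slices *)

Section Slices.

Context {I : Type} (d : nat).

(* [slice j n f] is the restriction of [f] to the hyperplane [x_j = n],
   carried to the hyperplane [x_j = 0]. *)
Definition slice (j : nat) (n : Z) (f : list Z * I -> R) : list Z * I -> R :=
  fun p => if Z.eqb (coord j (fst p)) 0 then f (upd j n (fst p), snd p) else 0.

(** Confines [f] to genuine lattice points: on shorter lists a shift along a missing coordinate is
    trivial, and slices would not decay. *)
Definition supp (f : list Z * I -> R) : Prop := forall x r, length x <> d -> f (x, r) = 0.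

Definition shift (j : nat) (n : Z) (f : list Z * I -> R) : list Z * I -> R :=
  fun p => f (upd j n (fst p), snd p).

Lemma l2_shift j n f : l2 f -> l2 (shift j n f).
Proof.
  apply (l2_inj (fun p : list Z * I => (upd j n (fst p), snd p))).
  intros [x r] [y t]; simpl; intros E; injection E as E1 E2; subst; f_equal.
  rewrite <- (upd_inv j n x), <- (upd_inv j n y); now f_equal.
Qed.

Lemma l2_slice j n f : l2 f -> l2 (slice j n f).
Proof.
  intros H; apply l2_dom with (shift j n f); [|now apply l2_shift].
  intros p; unfold slice, shift; destruct Z.eqb; auto.
Qed.

Lemma ip_shift j n f g : l2 f -> l2 g -> ip (shift j n f) g = ip f (shift j (- n) g).
Proof.
  intros Hf Hg; unfold shift.
  apply (ip_reindex (fun p : list Z * I => (upd j n (fst p), snd p))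
                    (fun p => (upd j (- n) (fst p), snd p))); auto; intros [x r]; simpl.
  - now rewrite upd_inv.
  - now rewrite upd_inv'.
Qed.

Lemma slice_shift_neq i j n m f : i <> j -> slice j n (shift i m f) = shift i m (slice j n f).
Proof.
  intros H; extensionality p; unfold slice, shift; simpl.
  rewrite coord_upd_neq by auto; now rewrite upd_comm.
Qed.

(* Slices of a square-summable function far from the origin have small norm,
   since they avoid any given finite set. *)
Lemma slice_decay j f eps : (j < d)%nat -> supp f -> l2 f -> 0 < eps ->
  exists K : Z, forall n, (K < Z.abs n)%Z -> ip (slice j n f) (slice j n f) <= eps.
Proof.
  intros Hj Hs Hf He.
  destruct (summ_tail _ eps Hf He) as [l0 [_ Ht]].
  assert (HK : exists K, forall p, In p l0 -> (Z.abs (coord j (fst p)) <= K)%Z).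
  { clear Ht; induction l0 as [|a l0 [K IH]]; [exists 0%Z; intros p []|].
    exists (Z.max K (Z.abs (coord j (fst a)))); intros p [<-|Hp]; [lia|specialize (IH p Hp); lia]. }
  destruct HK as [K HK]; exists K; intros n Hn.
  apply sm_le_bound; [intros; nra|]; intros l Hl.
  pose (ok := fun p : list Z * I => andb (Nat.eqb (length (fst p)) d) (Z.eqb (coord j (fst p)) 0)).
  pose (b := fun p : list Z * I => (upd j n (fst p), snd p)).
  apply Rle_trans with (lsum (fun p => Rabs (f p * f p)) (map b (filter ok l))).
  - rewrite lsum_map; clear Hl; induction l as [|p l IH]; [unfold lsum; simpl; lra|].
    rewrite lsum_cons; cbn [filter].
    unfold ok at 1, slice at 1 2; destruct (Nat.eqb_spec (length (fst p)) d) as [E|E]; simpl.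
    + destruct Z.eqb; [rewrite lsum_cons|lra].
      fold (b p); pose proof (Rle_abs (f (b p) * f (b p))); lra.
    + rewrite (Hs (upd j n (fst p))) by now rewrite upd_length.
      destruct Z.eqb; lra.
  - apply Ht.
    + apply NoDup_map_inj; [|now apply NoDup_filter].
      intros [x r] [y t]; unfold b; simpl; intros E; injection E as E1 E2; subst; f_equal.
      rewrite <- (upd_inv j n x), <- (upd_inv j n y); now f_equal.
    + intros q Hq Hq0; apply in_map_iff in Hq; destruct Hq as [p [<- Hp]].
      apply filter_In in Hp; destruct Hp as [_ Hp]; unfold ok in Hp.
      apply andb_prop in Hp; destruct Hp as [Hp1 Hp2].
      apply Nat.eqb_eq in Hp1; apply Z.eqb_eq in Hp2.
      specialize (HK _ Hq0); unfold b in HK; simpl in HK.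
      rewrite coord_upd in HK by lia; lia.
Qed.

Lemma slices_zero j f : (j < d)%nat -> supp f -> (forall n p, slice j n f p = 0) -> forall p, f p = 0.
Proof.
  intros Hj Hs H [x r]. destruct (Nat.eq_dec (length x) d) as [E|E]; [|now apply Hs].
  specialize (H (coord j x) (upd j (- coord j x) x, r)); unfold slice in H; simpl in H.
  rewrite coord_upd, Z.add_opp_diag_r, upd_inv' in H by lia; exact H.
Qed.

(* On slices the hypothesis is a three-term recurrence. Its Casoratian
   [<b_n, b_(k+1)> - <b_(n+1), b_k>] is constant along diagonals and tends to [0], so
   [<b_n, b_k>] depends on [n + k] only; hence [<b_n, b_n> = <b_(n+i), b_(n-i)>], which tends to [0]. *)
Lemma recurrence_zero j (b c : list Z * I -> R) : (j < d)%nat -> supp b -> l2 b -> l2 c ->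
  (forall p, shift j 1 b p + shift j (-1) b p + c p = 0) ->
  (forall n k, ip (slice j n b) (slice j k c) = ip (slice j n c) (slice j k b)) ->
  forall p, b p = 0.
Proof.
  intros Hj Hs Hb Hc Hrec Hsym.
  assert (Hrec' : forall n, slice j n c =
    fun p => -1 * slice j (n + 1) b p + -1 * slice j (n - 1) b p).
  { intros n; extensionality p; unfold slice; destruct Z.eqb; [|ring].
    specialize (Hrec (upd j n (fst p), snd p)); unfold shift in Hrec; simpl in Hrec.
    rewrite !upd_upd in Hrec.
    replace (n + 1)%Z with (1 + n)%Z by ring; replace (n - 1)%Z with (-1 + n)%Z by ring; lra. }
  set (B := fun n => slice j n b) in *.
  assert (HB : forall n, l2 (B n)) by (intros; now apply l2_slice).
  set (W := fun n k => ip (B n) (B (k + 1)%Z) - ip (B (n + 1)%Z) (B k)).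
  (* After [b_(k+1) + b_(k-1) = -c_k] is inserted, the two sides differ by
     [<b_n, c_k> - <c_n, b_k>], which vanishes by [Hsym]. *)
  assert (HW1 : forall n k, W (n - 1)%Z (k - 1)%Z = W n k).
  { intros n k; unfold W; specialize (Hsym n k); rewrite !Hrec' in Hsym.
    rewrite ip_lin_r, ip_lin_l in Hsym by apply HB.
    fold (B n) (B k) (B (k + 1)%Z) (B (k - 1)%Z) (B (n + 1)%Z) (B (n - 1)%Z) in Hsym.
    replace (k - 1 + 1)%Z with k by ring; replace (n - 1 + 1)%Z with n by ring; lra. }
  assert (HW2 : forall (m : nat) n k, W (n + Z.of_nat m)%Z (k + Z.of_nat m)%Z = W n k).
  { induction m as [|m IH]; intros n k; [now rewrite !Z.add_0_r|].
    rewrite <- HW1, <- (IH n k); f_equal; lia. }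
  assert (Hsmall : forall eps, 0 < eps -> exists K, forall n k, (K < Z.abs n)%Z -> (K < Z.abs k)%Z ->
     Rabs (ip (B n) (B k)) <= eps).
  { intros eps He; destruct (slice_decay j b eps Hj Hs Hb He) as [K HK]; exists K; intros n k Hn Hk.
    eapply Rle_trans; [apply (ip_amgm 1); auto; lra|].
    pose proof (HK n Hn); pose proof (HK k Hk); unfold B; lra. }
  assert (HW : forall n k, W n k = 0).
  { intros n k; apply cond_eq; intros eps He; rewrite Rminus_0_r.
    destruct (Hsmall (eps / 3) ltac:(lra)) as [K HK].
    set (m := Z.to_nat (Z.abs K + Z.abs n + Z.abs k + 2)).
    rewrite <- (HW2 m); unfold W.
    pose proof (HK (n + Z.of_nat m)%Z (k + Z.of_nat m + 1)%Z ltac:(lia) ltac:(lia)) as H1.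
    pose proof (HK (n + Z.of_nat m + 1)%Z (k + Z.of_nat m)%Z ltac:(lia) ltac:(lia)) as H2.
    apply Rabs_le_bounds in H1; apply Rabs_le_bounds in H2; apply Rabs_def1; lra. }
  assert (Hdiag : forall n (m : nat), ip (B n) (B n) = ip (B (n + Z.of_nat m)%Z) (B (n - Z.of_nat m)%Z)).
  { intros n; induction m as [|m IH]; [now rewrite Z.add_0_r, Z.sub_0_r|].
    rewrite IH; pose proof (HW (n + Z.of_nat m)%Z (n - Z.of_nat (S m))%Z) as H; unfold W in H.
    replace (n - Z.of_nat (S m) + 1)%Z with (n - Z.of_nat m)%Z in H by lia.
    replace (n + Z.of_nat m + 1)%Z with (n + Z.of_nat (S m))%Z in H by lia; lra. }
  apply (slices_zero j); auto; intros n p; apply ip_def; [now apply l2_slice|].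
  fold (B n); apply cond_eq; intros eps He; rewrite Rminus_0_r.
  destruct (Hsmall (eps / 2) ltac:(lra)) as [K HK].
  set (m := Z.to_nat (Z.abs K + Z.abs n + 1)).
  rewrite (Hdiag n m); eapply Rle_lt_trans; [apply HK; lia|lra].
Qed.

End Slices.

Fixpoint nsum (f : nat -> R) (n : nat) : R :=
  match n with O => 0 | S n' => nsum f n' + f n' end.

(** * Elimination with commuting symmetric operators *)

Section Elimination.

Context {I : Type} (d : nat).
Local Notation E := (list Z * I -> R).
Context (A : E -> E).
Hypothesis A_lin : forall a b f g, A (fun p => a * f p + b * g p) = fun p => a * A f p + b * A g p.
Hypothesis A_l2 : forall f, l2 f -> l2 (A f).
Hypothesis A_sym : forall f g, l2 f -> l2 g -> ip (A f) g = ip f (A g).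
Hypothesis A_shift : forall j n f, A (shift j n f) = shift j n (A f).
Hypothesis A_slice : forall j n f, A (slice j n f) = slice j n (A f).
Hypothesis A_supp : forall f, supp d f -> supp d (A f).

(** The operator [A + T_j]; in Fourier variables of the lattice it is [A + 2 cos theta_j]. *)
Definition hop (j : nat) (f : E) : E := fun p => A f p + shift j 1 f p + shift j (-1) f p.

Fixpoint hop_prod (m : nat) (f : E) : E :=
  match m with O => f | S m' => hop m' (hop_prod m' f) end.

(* [hop_prod m] is the product of [hop 0, ..., hop (m-1)] and [hop_deriv m] is its formal derivative
   [sum_(j < m) prod_(i < m, i <> j) hop i]. *)
Fixpoint hop_deriv (m : nat) (f : E) : E :=
  match m with O => fun _ => 0 | S m' => fun p => hop m' (hop_deriv m' f) p + hop_prod m' f p end.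

Lemma hop_lin j a b f g : hop j (fun p => a * f p + b * g p) = fun p => a * hop j f p + b * hop j g p.
Proof. unfold hop; rewrite A_lin; extensionality p; unfold shift; ring. Qed.

Lemma hop_add j f g : hop j (fun p => f p + g p) = fun p => hop j f p + hop j g p.
Proof.
  replace (fun p => f p + g p) with (fun p => 1 * f p + 1 * g p) by (extensionality p; ring).
  rewrite hop_lin; extensionality p; ring.
Qed.

Lemma hop_zero j : hop j (fun _ => 0) = fun _ => 0.
Proof.
  replace (fun _ : list Z * I => 0) with (fun p : list Z * I => 0 * 0 + 0 * 0) at 1
    by (extensionality p; ring).
  rewrite (hop_lin j 0 0 (fun _ => 0) (fun _ => 0)); extensionality p; ring.
Qed.

Lemma l2_add {J} (f g : J -> R) : l2 f -> l2 g -> l2 (fun p => f p + g p).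
Proof.
  intros Hf Hg; replace (fun p => f p + g p) with (fun p => 1 * f p + 1 * g p)
    by (extensionality p; ring).
  now apply l2_lin.
Qed.

Lemma ip_add_l {J} (f g h : J -> R) : l2 f -> l2 g -> l2 h ->
  ip (fun p => f p + g p) h = ip f h + ip g h.
Proof.
  intros; replace (fun p => f p + g p) with (fun p => 1 * f p + 1 * g p)
    by (extensionality p; ring).
  rewrite ip_lin_l; auto; ring.
Qed.

Lemma ip_add_r {J} (f g h : J -> R) : l2 f -> l2 g -> l2 h ->
  ip h (fun p => f p + g p) = ip h f + ip h g.
Proof. intros; rewrite ip_sym, ip_add_l, (ip_sym f), (ip_sym g); auto. Qed.

Lemma hop_l2 j f : l2 f -> l2 (hop j f).
Proof. intros; unfold hop; repeat apply l2_add; auto using l2_shift. Qed.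

Lemma hop_sym j f g : l2 f -> l2 g -> ip (hop j f) g = ip f (hop j g).
Proof.
  intros Hf Hg; unfold hop.
  rewrite !ip_add_l, !ip_add_r by (repeat apply l2_add; auto using l2_shift).
  rewrite A_sym, !ip_shift by auto; simpl Z.opp; ring.
Qed.

Lemma hop_shift j i n f : hop j (shift i n f) = shift i n (hop j f).
Proof.
  unfold hop; rewrite A_shift; extensionality p; unfold shift; simpl.
  rewrite (upd_comm i j n 1), (upd_comm i j n (-1)); ring.
Qed.

Lemma A_D j f : A (hop j f) = hop j (A f).
Proof.
  assert (H : hop j f = fun p => 1 * A f p + 1 * (fun p => 1 * shift j 1 f p + 1 * shift j (-1) f p) p).
  { extensionality p; unfold hop; ring. }
  rewrite H, A_lin, A_lin, !A_shift; extensionality p; unfold hop; ring.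
Qed.

Lemma hop_comm i j f : hop i (hop j f) = hop j (hop i f).
Proof.
  change (hop j (hop i f)) with (hop j (fun p => (A f p + shift i 1 f p) + shift i (-1) f p)).
  rewrite (hop_add j (fun p => A f p + shift i 1 f p) (shift i (-1) f)), (hop_add j (A f)).
  rewrite <- A_D, !hop_shift; reflexivity.
Qed.

Lemma slice_add j n (f g : E) : slice j n (fun p => f p + g p) = fun p => slice j n f p + slice j n g p.
Proof. extensionality p; unfold slice; destruct Z.eqb; ring. Qed.

Lemma hop_slice i j n f : i <> j -> slice j n (hop i f) = hop i (slice j n f).
Proof. intros H; unfold hop; rewrite !slice_add, A_slice, !slice_shift_neq by auto; reflexivity. Qed.

Lemma hop_supp j f : supp d f -> supp d (hop j f).
Proof.
  intros H x r Hx; unfold hop, shift; simpl.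
  rewrite (A_supp f H x r Hx), !H by (rewrite upd_length; auto); ring.
Qed.

Lemma hop_prod_add m f g : hop_prod m (fun p => f p + g p) = fun p => hop_prod m f p + hop_prod m g p.
Proof. induction m as [|m IH]; simpl; [reflexivity|now rewrite IH, hop_add]. Qed.

Lemma hop_prod_zero m : hop_prod m (fun _ => 0) = fun _ => 0.
Proof. induction m as [|m IH]; simpl; [reflexivity|now rewrite IH, hop_zero]. Qed.

Lemma hop_prod_D m j f : hop_prod m (hop j f) = hop j (hop_prod m f).
Proof. induction m as [|m IH]; simpl; [reflexivity|now rewrite IH, hop_comm]. Qed.

Lemma hop_deriv_D m j f : hop_deriv m (hop j f) = hop j (hop_deriv m f).
Proof.
  induction m as [|m IH]; simpl; [now rewrite hop_zero|].
  now rewrite IH, hop_prod_D, hop_add, hop_comm.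
Qed.

Lemma hop_prod_l2 m f : l2 f -> l2 (hop_prod m f).
Proof. intros; induction m; simpl; auto using hop_l2. Qed.

Lemma hop_deriv_l2 m f : l2 f -> l2 (hop_deriv m f).
Proof.
  intros; induction m; simpl; [apply l2_zero|].
  apply l2_add; auto using hop_l2, hop_prod_l2.
Qed.

Lemma hop_prod_supp m f : supp d f -> supp d (hop_prod m f).
Proof. intros; induction m; simpl; auto using hop_supp. Qed.

Lemma hop_deriv_supp m f : supp d f -> supp d (hop_deriv m f).
Proof.
  intros H; induction m as [|m IH]; simpl; intros x r Hx; [reflexivity|].
  rewrite (hop_supp _ _ IH x r Hx), (hop_prod_supp m f H x r Hx); ring.
Qed.

Lemma hop_prod_slice m j n f : (m <= j)%nat -> slice j n (hop_prod m f) = hop_prod m (slice j n f).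
Proof.
  induction m as [|m IH]; simpl; intros H; [reflexivity|].
  rewrite hop_slice, IH by lia; reflexivity.
Qed.

Lemma hop_deriv_slice m j n f : (m <= j)%nat -> slice j n (hop_deriv m f) = hop_deriv m (slice j n f).
Proof.
  induction m as [|m IH]; simpl; intros H.
  - extensionality p; unfold slice; now destruct Z.eqb.
  - rewrite slice_add, hop_slice, IH, hop_prod_slice by lia; reflexivity.
Qed.

(** Both operators are polynomials in the commuting symmetric operators [hop i], so each can be
    moved across the pairing. This supplies the symmetry hypothesis of [recurrence_zero] in
    [hop_deriv_step]. *)
Lemma hop_prod_deriv_sym m f g : l2 f -> l2 g -> ip (hop_deriv m f) (hop_prod m g) = ip (hop_prod m f) (hop_deriv m g).
Proof.
  revert f g; induction m as [|m IH]; intros f g Hf Hg; simpl.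
  - rewrite ip_sym; unfold ip; f_equal; extensionality p; ring.
  - rewrite ip_add_l, ip_add_r by auto using hop_l2, hop_prod_l2, hop_deriv_l2.
    rewrite (hop_sym m (hop_prod m f) (hop_prod m g)) by auto using hop_prod_l2.
    f_equal; rewrite <- hop_sym, <- (hop_deriv_D m m f), <- hop_deriv_D by auto using hop_l2, hop_prod_l2, hop_deriv_l2.
    rewrite IH, !hop_prod_D, hop_sym by auto using hop_l2, hop_prod_l2, hop_deriv_l2; reflexivity.
Qed.

(** With [b = hop_deriv m f] the equation reads [T_m b + (A b + hop_prod m f) = 0]. Only shifts in
    directions below [m] occur in [hop_deriv m] and [hop_prod m], so both commute with slicing in
    direction [m]. *)
Lemma hop_deriv_step m f : (m < d)%nat -> supp d f -> l2 f ->
  (forall p, hop_deriv (S m) f p = 0) -> forall p, hop_deriv m f p = 0.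
Proof.
  intros Hm Hs Hf H.
  apply (recurrence_zero d m (hop_deriv m f) (fun p => A (hop_deriv m f) p + hop_prod m f p)); auto.
  - now apply hop_deriv_supp.
  - now apply hop_deriv_l2.
  - apply l2_add; auto using hop_deriv_l2, hop_prod_l2.
  - intros p; specialize (H p); simpl in H; unfold hop in H; lra.
  - intros n k; rewrite !slice_add, <- !A_slice, !hop_deriv_slice, !hop_prod_slice by lia.
    rewrite ip_add_l, ip_add_r by auto using l2_slice, hop_deriv_l2, hop_prod_l2.
    rewrite A_sym, hop_prod_deriv_sym by auto using l2_slice, hop_deriv_l2, hop_prod_l2; reflexivity.
Qed.

Lemma hop_deriv_inj m f : (m < d)%nat -> supp d f -> l2 f ->
  (forall p, hop_deriv (S m) f p = 0) -> forall p, f p = 0.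
Proof.
  induction m as [|m IH]; intros Hm Hs Hf H p.
  (* [hop_deriv 1 f] is [f], because [hop 0] sends zero to zero. *)
  - specialize (H p); simpl in H; rewrite hop_zero in H; lra.
  - apply IH; auto; [lia|]. apply hop_deriv_step; auto.
Qed.

Lemma hop_inj j f : (j < d)%nat -> supp d f -> l2 f ->
  (forall p, hop j f p = 0) -> forall p, f p = 0.
Proof.
  intros Hj Hs Hf H; apply (recurrence_zero d j f (A f)); auto.
  - intros p; specialize (H p); unfold hop in H; lra.
  - intros n k; rewrite <- !A_slice; symmetry; apply A_sym; now apply l2_slice.
Qed.

(** Formally [g j = s / hop j], so the hypothesis says that [sum_j 1 / hop j] kills [s]. Multiplying
    by [hop_prod d] clears the denominators and leaves [hop_deriv d s = 0]. *)
Lemma common_image_zero (g : nat -> E) (s : E) : (0 < d)%nat -> supp d s -> l2 s ->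
  (forall j, (j < d)%nat -> hop j (g j) = s) ->
  (forall p, nsum (fun j => g j p) d = 0) -> forall p, s p = 0.
Proof.
  intros Hd Hs Hs2 Hg Hsum.
  assert (HQ : forall m, (m <= d)%nat -> hop_deriv m s = hop_prod m (fun p => nsum (fun j => g j p) m)).
  { induction m as [|m IH]; intros Hm; simpl; [reflexivity|].
    rewrite IH by lia; rewrite hop_prod_add, hop_add, <- (hop_prod_D m m (g m)), (Hg m) by lia; reflexivity. }
  apply (hop_deriv_inj (pred d)); auto; [lia|]; intros p.
  replace (S (pred d)) with d by lia; rewrite HQ by lia.
  replace (fun p => nsum (fun j => g j p) d) with (fun _ : list Z * I => 0).
  - now rewrite hop_prod_zero.
  - extensionality q; now rewrite Hsum.
Qed.

End Elimination.

Lemma nsum_ext f g n : (forall k, (k < n)%nat -> f k = g k) -> nsum f n = nsum g n.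
Proof. intros H; induction n as [|n IH]; simpl; auto; rewrite IH, H; auto. Qed.

Lemma nsum_lin a b f g n : nsum (fun k => a * f k + b * g k) n = a * nsum f n + b * nsum g n.
Proof. induction n as [|n IH]; simpl; [|rewrite IH]; ring. Qed.

Lemma nsum_const c n : nsum (fun _ => c) n = INR n * c.
Proof. induction n as [|n IH]; cbn [nsum]; [simpl|rewrite IH, S_INR]; ring. Qed.

Lemma nsum_split f n m : nsum f (n + m) = nsum f n + nsum (fun i => f (n + i)%nat) m.
Proof.
  induction m as [|m IH]; [rewrite Nat.add_0_r; simpl; ring|].
  rewrite Nat.add_succ_r; simpl; rewrite IH; ring.
Qed.

Lemma nsum_pair f n : nsum (fun j => f (2 * j)%nat + f (2 * j + 1)%nat) n = nsum f (2 * n).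
Proof.
  induction n as [|n IH]; [reflexivity|].
  replace (2 * S n)%nat with (S (S (2 * n))) by lia; cbn [nsum].
  rewrite IH, Nat.add_1_r; ring.
Qed.

(** * Symmetric operators *)

Definition symop {J : Type} (L : (J -> R) -> J -> R) : Prop :=
  (forall f, l2 f -> l2 (L f)) /\ (forall f g, l2 f -> l2 g -> ip (L f) g = ip f (L g)).

Lemma symop_lin {J} a b (L L' : (J -> R) -> J -> R) :
  symop L -> symop L' -> symop (fun f j => a * L f j + b * L' f j).
Proof.
  intros [H1 H2] [H1' H2']; split.
  - intros; apply l2_lin; auto.
  - intros; rewrite ip_lin_l, ip_lin_r, H2, H2' by auto; reflexivity.
Qed.

Lemma symop_zero {J} : symop (fun (f : J -> R) j => 0).
Proof.
  split; [intros; apply l2_zero|intros; unfold ip; f_equal; extensionality j; ring].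
Qed.

Lemma symop_nsum {J} (L : nat -> (J -> R) -> J -> R) n :
  (forall c, symop (L c)) -> symop (fun f j => nsum (fun c => L c f j) n).
Proof.
  intros H; induction n as [|n IH]; simpl; [apply symop_zero|].
  pose proof (symop_lin 1 1 _ _ IH (H n)) as H'.
  replace (fun f j => nsum (fun c => L c f j) n + L n f j)
    with (fun f j => 1 * nsum (fun c => L c f j) n + 1 * L n f j); auto.
  extensionality f; extensionality j; ring.
Qed.

(** The adjoint of composition with [b] is composition with its inverse, again [b], and the
    invariance of [w] makes the weights agree. The coin is built from such operators. *)
Lemma symop_weighted_involution {J} (w : J -> R) (b : J -> J) :
  (forall j, b (b j) = j) -> (forall j, w (b j) = w j) -> (forall j, w j * w j <= 1) ->
  symop (fun f j => w j * f (b j)).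
Proof.
  intros Hb Hw Hw1.
  assert (Hinj : forall i j, b i = b j -> i = j).
  { intros i j Hij; rewrite <- (Hb i), <- (Hb j); now f_equal. }
  assert (Hl : forall f, l2 f -> l2 (fun j => w j * f j)).
  { intros f Hf; apply summ_le with (2 := Hf); intros j.
    rewrite Rabs_pos_eq by apply Rle_0_sqr.
    pose proof (Hw1 j); pose proof (Rle_0_sqr (f j)) as H1; unfold Rsqr in H1; nra. }
  split.
  - intros f Hf; apply (Hl (fun j => f (b j))); now apply l2_inj.
  - intros f g Hf Hg.
    transitivity (ip (fun j => f (b j)) (fun j => w j * g j)).
    + unfold ip; f_equal; extensionality j; ring.
    + rewrite (ip_reindex b b f) by auto.
      unfold ip; f_equal; extensionality j; rewrite Hw; ring.
Qed.

(** * The Grover walk on real functions *)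

Section Walk.

Context (d : nat).
Hypothesis hd : (0 < d)%nat.

Let n := (2 * d)%nat.

(** The reflection [c - k] modulo [n], extended by the identity past [n]. For fixed [k < n] it takes
    every value below [n] exactly once as [c] runs over [0, ..., n - 1], so the all-ones matrix is
    the sum of these [n] involutions. *)
Definition reflect_index (c k : nat) : nat :=
  if Nat.ltb k n then if Nat.ltb c k then (c + n - k)%nat else (c - k)%nat else k.

Lemma reflect_lt c k : (c < n)%nat -> Nat.ltb (reflect_index c k) n = Nat.ltb k n.
Proof.
  intros Hc; unfold reflect_index; destruct (Nat.ltb_spec k n); [|apply Nat.ltb_ge; lia].
  destruct (Nat.ltb_spec c k); apply Nat.ltb_lt; lia.
Qed.

Lemma reflect_involutive c k : (c < n)%nat -> reflect_index c (reflect_index c k) = k.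
Proof.
  intros Hc; unfold reflect_index at 1; rewrite reflect_lt by auto; unfold reflect_index.
  destruct (Nat.ltb_spec k n); auto; destruct (Nat.ltb_spec c k).
  - destruct (Nat.ltb_spec c (c + n - k)); lia.
  - destruct (Nat.ltb_spec c (c - k)); lia.
Qed.

Lemma nsum_reflect f k : (k < n)%nat -> nsum (fun c => f (reflect_index c k)) n = nsum f n.
Proof.
  intros Hk.
  transitivity (nsum (fun c => f (reflect_index c k)) (k + (n - k))); [f_equal; lia|].
  transitivity (nsum f ((n - k) + k)); [|f_equal; lia].
  rewrite !nsum_split, Rplus_comm; f_equal; apply nsum_ext; intros i Hi; f_equal; unfold reflect_index;
    destruct (Nat.ltb_spec k n); try lia.
  - destruct (Nat.ltb_spec (k + i) k); lia.
  - destruct (Nat.ltb_spec i k); lia.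
Qed.

Local Notation X := (list Z * nat)%type.

(** An even component moves by [+u_j], so its value at [x] is fetched from [x - u_j]; hence the sign
    [-1]. *)
Definition dir (k : nat) : Z := if Nat.even k then (-1)%Z else 1%Z.

(** The factor [1/d] is the entry [2 / (2 d)] of the Grover matrix. Past [2 d] the coin is the
    identity, which keeps it an involution on all functions of [X]. *)
Definition coin (f : X -> R) : X -> R := fun p =>
  if Nat.ltb (snd p) n then / INR d * nsum (fun m => f (fst p, m)) n - f p else f p.
Definition trans (f : X -> R) : X -> R := fun p =>
  f (upd (Nat.div2 (snd p)) (dir (snd p)) (fst p), snd p).
Definition trans_inv (f : X -> R) : X -> R := fun p =>
  f (upd (Nat.div2 (snd p)) (- dir (snd p)) (fst p), snd p).
Definition walk (f : X -> R) : X -> R := trans (coin f).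
Definition walk_inv (f : X -> R) : X -> R := coin (trans_inv f).

Lemma INRd_pos : 0 < INR d.
Proof. apply lt_0_INR; exact hd. Qed.

Lemma coin_coin f : coin (coin f) = f.
Proof.
  extensionality p; destruct p as [x k]; unfold coin; simpl fst; simpl snd.
  destruct (Nat.ltb_spec k n) as [Hk|]; auto.
  rewrite (nsum_ext _ (fun m => 1 * (/ INR d * nsum (fun m => f (x, m)) n) + -1 * f (x, m))).
  2: { intros m Hm; destruct (Nat.ltb_spec m n); [ring|lia]. }
  rewrite nsum_lin, nsum_const.
  replace (INR n) with (2 * INR d) by (unfold n; rewrite mult_INR; simpl; ring).
  field; pose proof INRd_pos; lra.
Qed.

Lemma trans_trans_inv f : trans (trans_inv f) = f.
Proof. extensionality p; destruct p as [x k]; unfold trans, trans_inv; simpl; now rewrite upd_inv. Qed.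

Lemma trans_inv_trans f : trans_inv (trans f) = f.
Proof. extensionality p; destruct p as [x k]; unfold trans, trans_inv; simpl; now rewrite upd_inv'. Qed.

Lemma walk_inv_r f : walk (walk_inv f) = f.
Proof. unfold walk, walk_inv; now rewrite coin_coin, trans_trans_inv. Qed.

Lemma walk_inv_l f : walk_inv (walk f) = f.
Proof. unfold walk, walk_inv; now rewrite trans_inv_trans, coin_coin. Qed.

Lemma coin_lin a b f g : coin (fun p => a * f p + b * g p) = fun p => a * coin f p + b * coin g p.
Proof.
  extensionality p; unfold coin; destruct Nat.ltb; [|ring].
  rewrite nsum_lin; ring.
Qed.

Lemma walk_lin a b f g : walk (fun p => a * f p + b * g p) = fun p => a * walk f p + b * walk g p.
Proof. unfold walk; rewrite coin_lin; reflexivity. Qed.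

Lemma walk_inv_lin a b f g : walk_inv (fun p => a * f p + b * g p) = fun p => a * walk_inv f p + b * walk_inv g p.
Proof. unfold walk_inv; rewrite <- coin_lin; reflexivity. Qed.

Lemma walk_zero : walk (fun _ => 0) = fun _ => 0.
Proof.
  replace (fun _ : X => 0) with (fun p : X => 0 * 0 + 0 * 0) at 1 by (extensionality p; ring).
  rewrite (walk_lin 0 0 (fun _ => 0) (fun _ => 0)); extensionality p; ring.
Qed.

Lemma walk_inv_zero : walk_inv (fun _ => 0) = fun _ => 0.
Proof. rewrite <- walk_zero at 1; apply walk_inv_l. Qed.

(** [Y = list Z] serves the kernels and [Y = unit] recovers plain functions, so that unitarity is
    proved once for both. *)
Definition lift {Y : Type} (L : (X -> R) -> X -> R) (F : Y * X -> R) : Y * X -> R :=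
  fun q => L (fun r => F (fst q, r)) (snd q).

(** The all-ones block is a sum of reflections with weight [0] or [1], and the diagonal part is
    multiplication by [-1] or [1]; all of these are weighted involutions. *)
Lemma symop_coin {Y} : symop (lift (Y := Y) coin).
Proof.
  assert (H1 : forall c, (c < n)%nat -> symop (fun (F : Y * X -> R) q =>
     (if Nat.ltb (snd (snd q)) n then 1 else 0) * F (fst q, (fst (snd q), reflect_index c (snd (snd q)))))).
  { intros c Hc; apply symop_weighted_involution; intros [y [x k]]; simpl.
    - now rewrite reflect_involutive.
    - now rewrite reflect_lt.
    - destruct Nat.ltb; lra. }
  assert (H2 : symop (fun (F : Y * X -> R) q => (if Nat.ltb (snd (snd q)) n then -1 else 1) * F q)).
  { apply (symop_weighted_involution (fun q : Y * X => if Nat.ltb (snd (snd q)) n then -1 else 1) (fun q => q));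
      auto; intros [y [x k]]; simpl; destruct Nat.ltb; lra. }
  (* Extended by zero for [c >= n], as [symop_nsum] asks for every index. *)
  set (L := fun c => if Nat.ltb c n then
     (fun (F : Y * X -> R) q =>
     (if Nat.ltb (snd (snd q)) n then 1 else 0) * F (fst q, (fst (snd q), reflect_index c (snd (snd q)))))
     else fun F q => 0).
  assert (H3 : forall c, symop (L c)).
  { intros c; unfold L; destruct (Nat.ltb_spec c n); [now apply H1|apply symop_zero]. }
  pose proof (symop_lin (/ INR d) 1 _ _ (symop_nsum L n H3) H2) as H.
  replace (lift coin) with
    (fun (F : Y * X -> R) j => / INR d * nsum (fun c => L c F j) n
        + 1 * ((if Nat.ltb (snd (snd j)) n then -1 else 1) * F j)); auto.
  extensionality F; extensionality q; destruct q as [y [x k]]; unfold lift, coin; simpl fst; simpl snd.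
  destruct (Nat.ltb_spec k n) as [Hk|Hk].
  - rewrite <- (nsum_reflect (fun m => F (y, (x, m))) k Hk).
    rewrite (nsum_ext _ (fun c => F (y, (x, reflect_index c k)))); [ring|].
    intros c Hc; unfold L; destruct (Nat.ltb_spec c n); [|lia]; simpl.
    destruct (Nat.ltb_spec k n); [ring|lia].
  - rewrite (nsum_ext _ (fun c => 0)), nsum_const; [ring|].
    intros c Hc; unfold L; destruct (Nat.ltb_spec c n); [|lia]; simpl.
    destruct (Nat.ltb_spec k n); [lia|ring].
Qed.

Lemma upd_inj j m x y : upd j m x = upd j m y -> x = y.
Proof. intros E; rewrite <- (upd_inv j m x), <- (upd_inv j m y); now f_equal. Qed.

Lemma l2_lift_trans {Y} (F : Y * X -> R) : l2 F -> l2 (lift trans F).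
Proof.
  apply (l2_inj (fun q : Y * X => (fst q, (upd (Nat.div2 (snd (snd q))) (dir (snd (snd q))) (fst (snd q)), snd (snd q))))).
  intros [y [x k]] [y' [x' k']]; simpl; intros E; injection E as E1 E2 E3; subst.
  apply upd_inj in E2; now subst.
Qed.

Lemma l2_lift_trans_inv {Y} (F : Y * X -> R) : l2 F -> l2 (lift trans_inv F).
Proof.
  apply (l2_inj (fun q : Y * X => (fst q, (upd (Nat.div2 (snd (snd q))) (- dir (snd (snd q))) (fst (snd q)), snd (snd q))))).
  intros [y [x k]] [y' [x' k']]; simpl; intros E; injection E as E1 E2 E3; subst.
  apply upd_inj in E2; now subst.
Qed.

Lemma ip_lift_trans {Y} (F H : Y * X -> R) : l2 F -> l2 H ->
  ip (lift trans F) H = ip F (lift trans_inv H).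
Proof.
  intros HF HH.
  apply (ip_reindex
    (fun q : Y * X => (fst q, (upd (Nat.div2 (snd (snd q))) (dir (snd (snd q))) (fst (snd q)), snd (snd q))))
    (fun q : Y * X => (fst q, (upd (Nat.div2 (snd (snd q))) (- dir (snd (snd q))) (fst (snd q)), snd (snd q))))); auto;
  intros [y [x k]]; simpl.
  - now rewrite upd_inv.
  - now rewrite upd_inv'.
Qed.

Lemma l2_lift_walk {Y} (F : Y * X -> R) : l2 F -> l2 (lift walk F).
Proof. intros H; apply (l2_lift_trans (lift coin F)), symop_coin, H. Qed.

Lemma l2_lift_walk_inv {Y} (F : Y * X -> R) : l2 F -> l2 (lift walk_inv F).
Proof. intros H; apply (proj1 symop_coin (lift trans_inv F)), l2_lift_trans_inv, H. Qed.

Lemma ip_lift_walk {Y} (F H : Y * X -> R) : l2 F -> l2 H -> ip (lift walk F) H = ip F (lift walk_inv H).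
Proof.
  intros HF HH.
  change (lift walk F) with (lift trans (lift coin F)).
  change (lift walk_inv H) with (lift coin (lift trans_inv H)).
  rewrite ip_lift_trans by (auto; now apply symop_coin).
  now rewrite (proj2 symop_coin) by auto using l2_lift_trans_inv.
Qed.

Lemma l2_unit (f : X -> R) : l2 f -> l2 (fun q : unit * X => f (snd q)).
Proof. apply (l2_inj (@snd unit X)); intros [[] r] [[] t]; simpl; congruence. Qed.

Lemma l2_of_unit (F : unit * X -> R) : l2 F -> l2 (fun r => F (tt, r)).
Proof. apply (l2_inj (@pair unit X tt)); congruence. Qed.

Lemma ip_unit (F H : unit * X -> R) : l2 F -> l2 H ->
  ip (fun r => F (tt, r)) (fun r => H (tt, r)) = ip F H.
Proof.
  intros HF HH; apply (sm_inj (@pair unit X tt) (fun q => F q * H q)).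
  - congruence.
  - intros [[] r] Hn; exfalso; now apply (Hn r).
  - now apply l2_mul.
Qed.

Lemma l2_walk f : l2 f -> l2 (walk f).
Proof. intros H; apply (l2_of_unit (lift walk (fun q => f (snd q)))), l2_lift_walk, l2_unit, H. Qed.

Lemma l2_walk_inv f : l2 f -> l2 (walk_inv f).
Proof. intros H; apply (l2_of_unit (lift walk_inv (fun q => f (snd q)))), l2_lift_walk_inv, l2_unit, H. Qed.

Lemma ip_walk f g : l2 f -> l2 g -> ip (walk f) g = ip f (walk_inv g).
Proof.
  intros Hf Hg.
  pose proof (ip_lift_walk (fun q : unit * X => f (snd q)) (fun q => g (snd q)) (l2_unit f Hf) (l2_unit g Hg)) as H.
  rewrite <- !ip_unit in H by auto using l2_unit, l2_lift_walk, l2_lift_walk_inv; exact H.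
Qed.

Lemma ip_walk_walk f g : l2 f -> l2 g -> ip (walk f) (walk g) = ip f g.
Proof. intros; rewrite ip_walk, walk_inv_l; auto using l2_walk. Qed.

(** * Invariant kernels *)

Local Notation E := (list Z * X -> R).

(** The operator [A = V + V^-1]. It acts on the second variable while shifts and slices act on the
    first, hence they commute. *)
Definition walk_sum (f : E) : E := fun q => 1 * lift walk f q + 1 * lift walk_inv f q.

Lemma lift_walk_lin a b (f g : E) :
  lift walk (fun p => a * f p + b * g p) = fun p => a * lift walk f p + b * lift walk g p.
Proof. extensionality q; unfold lift; now rewrite (walk_lin a b (fun r => f (fst q, r)) (fun r => g (fst q, r))). Qed.

Lemma lift_walk_inv_lin a b (f g : E) :
  lift walk_inv (fun p => a * f p + b * g p) = fun p => a * lift walk_inv f p + b * lift walk_inv g p.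
Proof. extensionality q; unfold lift; now rewrite (walk_inv_lin a b (fun r => f (fst q, r)) (fun r => g (fst q, r))). Qed.

Lemma lift_walk_inv_r (f : E) : lift walk (lift walk_inv f) = f.
Proof.
  extensionality q; destruct q as [y r]; unfold lift; simpl.
  change (fun r0 => walk_inv (fun r1 => f (y, r1)) r0) with (walk_inv (fun r1 => f (y, r1))); now rewrite walk_inv_r.
Qed.

Lemma lift_walk_inv_l (f : E) : lift walk_inv (lift walk f) = f.
Proof.
  extensionality q; destruct q as [y r]; unfold lift; simpl.
  change (fun r0 => walk (fun r1 => f (y, r1)) r0) with (walk (fun r1 => f (y, r1))); now rewrite walk_inv_l.
Qed.

Lemma lift_walk_slice j m (f : E) : lift walk (slice j m f) = slice j m (lift walk f).
Proof.
  extensionality q; destruct q as [y r]; unfold lift, slice; simpl.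
  destruct Z.eqb; [reflexivity|now rewrite walk_zero].
Qed.

Lemma lift_walk_inv_slice j m (f : E) : lift walk_inv (slice j m f) = slice j m (lift walk_inv f).
Proof.
  extensionality q; destruct q as [y r]; unfold lift, slice; simpl.
  destruct Z.eqb; [reflexivity|now rewrite walk_inv_zero].
Qed.

Lemma lift_supp (L : (X -> R) -> X -> R) (f : E) : L (fun _ => 0) = (fun _ => 0) ->
  supp d f -> supp d (lift L f).
Proof.
  intros HL Hf x r Hx; unfold lift; simpl.
  replace (fun r0 => f (x, r0)) with (fun _ : X => 0); [now rewrite HL|].
  extensionality t; symmetry; now apply Hf.
Qed.

Lemma walk_sum_lin a b f g : walk_sum (fun p => a * f p + b * g p) = fun p => a * walk_sum f p + b * walk_sum g p.
Proof. unfold walk_sum; rewrite lift_walk_lin, lift_walk_inv_lin; extensionality p; ring. Qed.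

Lemma walk_sum_l2 f : l2 f -> l2 (walk_sum f).
Proof. intros; apply l2_lin; auto using l2_lift_walk, l2_lift_walk_inv. Qed.

Lemma walk_sum_sym f g : l2 f -> l2 g -> ip (walk_sum f) g = ip f (walk_sum g).
Proof.
  intros Hf Hg; unfold walk_sum.
  rewrite ip_lin_l, ip_lin_r by auto using l2_lift_walk, l2_lift_walk_inv.
  rewrite ip_lift_walk, (ip_sym (lift walk_inv f)), <- (ip_lift_walk g f), (ip_sym (lift walk g)) by auto; ring.
Qed.

Lemma walk_sum_shift j m f : walk_sum (shift j m f) = shift j m (walk_sum f).
Proof. reflexivity. Qed.

Lemma walk_sum_slice j m f : walk_sum (slice j m f) = slice j m (walk_sum f).
Proof.
  unfold walk_sum; rewrite lift_walk_slice, lift_walk_inv_slice.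
  extensionality p; unfold slice; destruct Z.eqb; ring.
Qed.

Lemma walk_sum_supp f : supp d f -> supp d (walk_sum f).
Proof.
  intros H x r Hx; unfold walk_sum.
  rewrite (lift_supp walk f walk_zero H x r Hx), (lift_supp walk_inv f walk_inv_zero H x r Hx); ring.
Qed.

Lemma div2_lt k : (k < n)%nat -> (Nat.div2 k < d)%nat.
Proof. unfold n; intros H; pose proof (Nat.div2_odd k); destruct (Nat.odd k); simpl in *; lia. Qed.

Section Invariant.

Context (F : X * X -> R).
Hypothesis F_l2 : l2 F.
Hypothesis F_supp : forall x k r, length x <> d -> F ((x, k), r) = 0.
(** Invariance under [W (x) W], with one factor carried to the other side as an inverse. *)
Hypothesis F_inv : forall p r, walk (fun p => F (p, r)) p = walk_inv (fun r => F (p, r)) r.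

(** Splitting off the internal index of the first variable leaves functions on the lattice with
    parameter space [X], the setting of the elimination with [I = X]. *)
Let f (k : nat) : E := fun q => F ((fst q, k), snd q).
Let s : E := fun q => / INR d * nsum (fun m => f m q) n.
Let sg : E := fun q => lift walk s q - lift walk_inv s q.

Lemma f_l2 k : l2 (f k).
Proof.
  apply (l2_inj (fun q : list Z * X => ((fst q, k), snd q)) F); auto.
  intros [x r] [y t]; simpl; congruence.
Qed.

Lemma f_supp k : supp d (f k).
Proof. intros x r Hx; unfold f; simpl; now apply F_supp. Qed.

Lemma nsum_l2 {J} (g : nat -> J -> R) m : (forall k, l2 (g k)) -> l2 (fun q => nsum (fun k => g k q) m).
Proof.
  intros H; induction m as [|m IH]; simpl; [apply l2_zero|apply l2_add; auto].
Qed.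

Lemma s_l2 : l2 s.
Proof.
  unfold s; replace (fun q => / INR d * nsum (fun m => f m q) n)
    with (fun q => / INR d * nsum (fun m => f m q) n + 0 * nsum (fun m => f m q) n)
    by (extensionality q; ring).
  apply l2_lin; apply nsum_l2, f_l2.
Qed.

Lemma s_supp : supp d s.
Proof.
  intros x r Hx; unfold s.
  rewrite (nsum_ext _ (fun _ => 0)), nsum_const; [ring|]; intros; now apply f_supp.
Qed.

(** This is [F_inv] at component [k]: the coin turns [f k] into [s - f k], and the translation
    becomes a shift. *)
Lemma f_eq k : (k < n)%nat ->
  lift walk_inv (f k) = fun q => 1 * shift (Nat.div2 k) (dir k) s q + -1 * shift (Nat.div2 k) (dir k) (f k) q.
Proof.
  intros Hk; extensionality q; destruct q as [x r].
  pose proof (F_inv (x, k) r) as H; unfold lift; simpl fst; simpl snd.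
  unfold f at 1; simpl fst; simpl snd; rewrite <- H.
  unfold walk, trans, coin, shift, s; simpl fst; simpl snd.
  destruct (Nat.ltb_spec k n); [|lia]. unfold f; simpl fst; simpl snd; ring.
Qed.

(** Follows from [f_eq] by undoing the shift and applying [V^-1], that is [walk] in the second
    variable. *)
Lemma f_eq' k : (k < n)%nat ->
  forall q, lift walk (f k) q + shift (Nat.div2 k) (- dir k) (f k) q = lift walk s q.
Proof.
  intros Hk q.
  assert (H : lift walk (shift (Nat.div2 k) (- dir k) (lift walk_inv (f k))) =
              shift (Nat.div2 k) (- dir k) (f k)).
  { change (lift walk (shift (Nat.div2 k) (- dir k) (lift walk_inv (f k))))
      with (shift (Nat.div2 k) (- dir k) (lift walk (lift walk_inv (f k)))); now rewrite lift_walk_inv_r. }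
  rewrite <- H, f_eq by auto.
  replace (shift (Nat.div2 k) (- dir k) (fun q0 =>
      1 * shift (Nat.div2 k) (dir k) s q0 + -1 * shift (Nat.div2 k) (dir k) (f k) q0))
    with (fun q => 1 * s q + -1 * f k q).
  - rewrite lift_walk_lin; ring.
  - extensionality p; destruct p as [x r]; unfold shift; simpl; now rewrite upd_inv'.
Qed.

(** [A + T_j] splits as [(V + T) + (V^-1 + T^-1)] with [T] the shift by [dir k]; [f_eq] evaluates
    the first half on [f k] and [f_eq'] the second. *)
Lemma hop_f k : (k < n)%nat ->
  hop walk_sum (Nat.div2 k) (f k) = fun q => 1 * shift (Nat.div2 k) (dir k) s q + 1 * lift walk s q.
Proof.
  intros Hk; extensionality q; rewrite <- (f_eq' k Hk q).
  unfold hop, walk_sum; rewrite (f_eq k Hk).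
  unfold dir; destruct (Nat.even k); simpl Z.opp; ring.
Qed.

Let g (j : nat) : E := fun q => 1 * (1 * f (2 * j) q + 1 * f (2 * j + 1) q) + -1 * s q.

Lemma div2_2j j : Nat.div2 (2 * j) = j.
Proof. apply Nat.div2_double. Qed.

Lemma div2_2j1 j : Nat.div2 (2 * j + 1) = j.
Proof. rewrite Nat.add_1_r; apply Nat.div2_succ_double. Qed.

Lemma dir_2j j : dir (2 * j) = (-1)%Z.
Proof. unfold dir; now rewrite Nat.even_mul. Qed.

Lemma dir_2j1 j : dir (2 * j + 1) = 1%Z.
Proof. unfold dir; now rewrite Nat.even_add, Nat.even_mul. Qed.

(** By [hop_f] the two opposite components add up to [(T_j + 2 V^-1) s]; subtracting
    [(V + V^-1 + T_j) s] removes [T_j] and leaves [(V^-1 - V) s], the same for every [j]. *)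
Lemma hop_g j : (j < d)%nat -> hop walk_sum j (g j) = sg.
Proof.
  intros Hj.
  pose proof (hop_f (2 * j) ltac:(unfold n; lia)) as H0; rewrite div2_2j, dir_2j in H0.
  pose proof (hop_f (2 * j + 1) ltac:(unfold n; lia)) as H1; rewrite div2_2j1, dir_2j1 in H1.
  unfold g.
  rewrite (hop_lin walk_sum walk_sum_lin j 1 (-1) (fun q => 1 * f (2 * j) q + 1 * f (2 * j + 1) q) s).
  rewrite (hop_lin walk_sum walk_sum_lin j 1 1), H0, H1.
  extensionality q; unfold hop, walk_sum, sg; ring.
Qed.

Lemma sg_zero : forall q, sg q = 0.
Proof.
  apply (common_image_zero d walk_sum walk_sum_lin walk_sum_l2 walk_sum_sym walk_sum_shift walk_sum_slice walk_sum_supp g); auto.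
  - intros x r Hx; unfold sg.
    rewrite (lift_supp walk s walk_zero s_supp x r Hx), (lift_supp walk_inv s walk_inv_zero s_supp x r Hx); ring.
  - unfold sg; replace (fun q => lift walk s q - lift walk_inv s q)
      with (fun q => 1 * lift walk s q + -1 * lift walk_inv s q) by (extensionality q; ring).
    apply l2_lin; [apply l2_lift_walk|apply l2_lift_walk_inv]; apply s_l2.
  - apply hop_g.
  (* The pairs exhaust the [2 d] components, whose sum is [d s]; the [d] subtracted copies of [s]
     cancel it. *)
  - intros q; unfold g; rewrite nsum_lin, nsum_const.
    rewrite (nsum_ext _ (fun j => f (2 * j) q + f (2 * j + 1) q)) by (intros; ring).
    rewrite (nsum_pair (fun k => f k q)); fold n; unfold s.
    field; pose proof INRd_pos; lra.
Qed.

(** By [hop_f], applying [hop] to [(V^-1 - V) f_k] gives [(T + V^-1) (V^-1 - V) s], with [T] the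
    shift by [dir k]. This is zero by [sg_zero], and [hop] is injective. *)
Lemma invariant_kernel k x r : (k < n)%nat ->
  walk (fun r => F ((x, k), r)) r = walk_inv (fun r => F ((x, k), r)) r.
Proof.
  intros Hk.
  assert (Hs : lift walk s = lift walk_inv s).
  { extensionality q; pose proof (sg_zero q) as H; unfold sg in H; lra. }
  set (h := fun q => 1 * lift walk (f k) q + -1 * lift walk_inv (f k) q).
  assert (Hh : h (x, r) = 0).
  { apply (hop_inj d walk_sum walk_sum_l2 walk_sum_sym walk_sum_slice (Nat.div2 k)).
    - now apply div2_lt.
    - intros y t Hy; unfold h.
      rewrite (lift_supp walk _ walk_zero (f_supp k) y t Hy), (lift_supp walk_inv _ walk_inv_zero (f_supp k) y t Hy); ring.
    - apply l2_lin; [apply l2_lift_walk|apply l2_lift_walk_inv]; apply f_l2.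
    - intros q; unfold h; rewrite (hop_lin walk_sum walk_sum_lin).
      (* [lift walk] commutes with its own inverse, and with shifts because they act on the other
         variable. *)
      assert (HW : hop walk_sum (Nat.div2 k) (lift walk (f k)) = lift walk (hop walk_sum (Nat.div2 k) (f k))).
      { replace (hop walk_sum (Nat.div2 k) (f k)) with (fun q => 1 * (1 * lift walk (f k) q + 1 * lift walk_inv (f k) q)
          + 1 * (1 * shift (Nat.div2 k) 1 (f k) q + 1 * shift (Nat.div2 k) (-1) (f k) q))
          by (extensionality p; unfold hop, walk_sum; ring).
        rewrite (lift_walk_lin 1 1 (fun q => 1 * lift walk (f k) q + 1 * lift walk_inv (f k) q)), !lift_walk_lin.
        extensionality p; unfold hop, walk_sum; rewrite lift_walk_inv_r, lift_walk_inv_l.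
        change (lift walk (shift (Nat.div2 k) 1 (f k))) with (shift (Nat.div2 k) 1 (lift walk (f k))).
        change (lift walk (shift (Nat.div2 k) (-1) (f k))) with (shift (Nat.div2 k) (-1) (lift walk (f k))).
        ring. }
      assert (HWi : hop walk_sum (Nat.div2 k) (lift walk_inv (f k)) = lift walk_inv (hop walk_sum (Nat.div2 k) (f k))).
      { replace (hop walk_sum (Nat.div2 k) (f k)) with (fun q => 1 * (1 * lift walk (f k) q + 1 * lift walk_inv (f k) q)
          + 1 * (1 * shift (Nat.div2 k) 1 (f k) q + 1 * shift (Nat.div2 k) (-1) (f k) q))
          by (extensionality p; unfold hop, walk_sum; ring).
        rewrite (lift_walk_inv_lin 1 1 (fun q => 1 * lift walk (f k) q + 1 * lift walk_inv (f k) q)), !lift_walk_inv_lin.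
        extensionality p; unfold hop, walk_sum; rewrite lift_walk_inv_r, lift_walk_inv_l.
        change (lift walk_inv (shift (Nat.div2 k) 1 (f k))) with (shift (Nat.div2 k) 1 (lift walk_inv (f k))).
        change (lift walk_inv (shift (Nat.div2 k) (-1) (f k))) with (shift (Nat.div2 k) (-1) (lift walk_inv (f k))).
        ring. }
      rewrite HW, HWi, (hop_f k Hk), lift_walk_lin, lift_walk_inv_lin, lift_walk_inv_l, Hs, lift_walk_inv_r.
      change (lift walk (shift (Nat.div2 k) (dir k) s)) with (shift (Nat.div2 k) (dir k) (lift walk s)).
      rewrite Hs.
      change (lift walk_inv (shift (Nat.div2 k) (dir k) s)) with (shift (Nat.div2 k) (dir k) (lift walk_inv s)).
      ring. }
  unfold h, lift, f in Hh; simpl in Hh; lra.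
Qed.

End Invariant.

End Walk.

(** * Time averages of the walk *)

Lemma lsum_list_prod {I J} (a : I -> R) (b : J -> R) l l' :
  lsum (fun q => a (fst q) * b (snd q)) (list_prod l l') = lsum a l * lsum b l'.
Proof.
  induction l as [|i l IH]; [unfold lsum; simpl; ring|].
  simpl list_prod; rewrite lsum_app, IH, lsum_map, lsum_cons; simpl.
  replace (fun j => a i * b j) with (fun j => a i * b j + 0 * b j) by (extensionality j; ring).
  rewrite lsum_lin; ring.
Qed.

(** The list is enclosed in the product of its two projections, where the sum factors. *)
Lemma tensor_bound {I J} (f : I -> R) (g : J -> R) : l2 f -> l2 g ->
  forall l, NoDup l ->
    lsum (fun q : I * J => (f (fst q) * g (snd q)) * (f (fst q) * g (snd q))) l <= ip f f * ip g g.
Proof.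
  intros Hf Hg l Hl.
  set (l1 := nodup cdec (map fst l)); set (l2' := nodup cdec (map snd l)).
  apply Rle_trans with
    (lsum (fun q : I * J => (f (fst q) * f (fst q)) * (g (snd q) * g (snd q))) (list_prod l1 l2')).
  - replace (fun q : I * J => (f (fst q) * f (fst q)) * (g (snd q) * g (snd q)))
      with (fun q : I * J => (f (fst q) * g (snd q)) * (f (fst q) * g (snd q)))
      by (extensionality q; ring).
    apply lsum_incl; auto; [intros; apply Rle_0_sqr|].
    intros [i j] H; apply in_prod; apply nodup_In; [apply (in_map fst _ _ H)|apply (in_map snd _ _ H)].
  - rewrite (lsum_list_prod (fun i => f i * f i) (fun j => g j * g j)).
    apply Rmult_le_compat.
    + apply lsum_nonneg; intros; apply Rle_0_sqr.
    + apply lsum_nonneg; intros; apply Rle_0_sqr.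
    + apply sm_ge_lsum; auto; [intros; apply Rle_0_sqr|apply NoDup_nodup].
    + apply sm_ge_lsum; auto; [intros; apply Rle_0_sqr|apply NoDup_nodup].
Qed.

Lemma l2_scal {J} a (f : J -> R) : l2 f -> l2 (fun j => a * f j).
Proof.
  intros H; replace (fun j => a * f j) with (fun j => a * f j + 0 * f j) by (extensionality j; ring).
  now apply l2_lin.
Qed.

Lemma ip_scal_l {J} a (f g : J -> R) : l2 f -> l2 g -> ip (fun j => a * f j) g = a * ip f g.
Proof.
  intros Hf Hg; replace (fun j => a * f j) with (fun j => a * f j + 0 * f j) by (extensionality j; ring).
  rewrite ip_lin_l; auto; ring.
Qed.

Lemma ip_scal_r {J} a (f g : J -> R) : l2 f -> l2 g -> ip f (fun j => a * g j) = a * ip f g.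
Proof. intros; rewrite ip_sym, ip_scal_l, ip_sym; auto. Qed.

Lemma bl_nsum M (HM : banach_limit M) (v : nat -> nat -> R) k : (forall m, bdd (fun n => v n m)) ->
  M (fun n => nsum (v n) k) = nsum (fun m => M (fun n => v n m)) k /\ bdd (fun n => nsum (v n) k).
Proof.
  intros H; induction k as [|k [IH1 IH2]]; simpl.
  - split; [now apply bl_const|apply bdd_const].
  - split.
    + rewrite (bl_add M HM) by auto; now rewrite IH1.
    + destruct (bdd_lin 1 1 _ _ IH2 (H k)) as [K HK]; exists K; intros m.
      specialize (HK m); now rewrite !Rmult_1_l in HK.
Qed.

Section Ergodic.

Context (d : nat).
Hypothesis hd : (0 < d)%nat.

Local Notation X := (list Z * nat)%type.
Local Notation W := (walk d).
Local Notation Wi := (walk_inv d).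

(** A value of the coin is a finite combination of values of the function, so linearity of [M]
    suffices. *)
Lemma coin_bl M (HM : banach_limit M) (v : nat -> X -> R) p : (forall p, bdd (fun m => v m p)) ->
  coin d (fun p => M (fun m => v m p)) p = M (fun m => coin d (v m) p).
Proof.
  intros Hv; unfold coin; destruct Nat.ltb; auto.
  destruct (bl_nsum M HM (fun m k => v m (fst p, k)) (2 * d) (fun k => Hv _)) as [E B].
  replace (fun m => / INR d * nsum (fun k => v m (fst p, k)) (2 * d) - v m p)
    with (fun m => / INR d * nsum (fun k => v m (fst p, k)) (2 * d) + -1 * v m p)
    by (extensionality m; ring).
  rewrite (bl_lin M HM _ _ (fun m => nsum (fun k => v m (fst p, k)) (2 * d))) by auto.
  rewrite E; ring.
Qed.

Lemma walk_bl M (HM : banach_limit M) (v : nat -> X -> R) p : (forall p, bdd (fun m => v m p)) ->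
  W (fun p => M (fun m => v m p)) p = M (fun m => W (v m) p).
Proof. intros Hv; exact (coin_bl M HM v _ Hv). Qed.

Lemma walk_inv_bl M (HM : banach_limit M) (v : nat -> X -> R) p : (forall p, bdd (fun m => v m p)) ->
  Wi (fun p => M (fun m => v m p)) p = M (fun m => Wi (v m) p).
Proof. intros Hv; apply (coin_bl M HM (fun m => trans_inv (v m))); intros; apply Hv. Qed.

Lemma walk_scal a f : W (fun p => a * f p) = fun p => a * W f p.
Proof.
  replace (fun p => a * f p) with (fun p => a * f p + 0 * f p) by (extensionality p; ring).
  rewrite walk_lin; extensionality p; ring.
Qed.

Lemma walk_inv_scal a f : Wi (fun p => a * f p) = fun p => a * Wi f p.
Proof.
  replace (fun p => a * f p) with (fun p => a * f p + 0 * f p) by (extensionality p; ring).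
  rewrite walk_inv_lin; extensionality p; ring.
Qed.

Definition supported (f : X -> R) : Prop :=
  forall x k, (length x <> d \/ (2 * d <= k)%nat) -> f (x, k) = 0.

Lemma walk_supported f : supported f -> supported (W f).
Proof.
  intros H x k Hx; unfold walk, trans, coin; simpl fst; simpl snd.
  destruct (Nat.ltb_spec k (2 * d)) as [Hk|Hk].
  - destruct Hx as [Hx|Hx]; [|lia].
    rewrite (nsum_ext _ (fun _ => 0)), nsum_const, H; [ring|left; now rewrite upd_length|].
    intros m _; apply H; left; now rewrite upd_length.
  - apply H; auto.
Qed.

(** The orbit of [f] under [e W]; with [e = -1] the eigenvalue [-1] of [W] becomes the eigenvalue
    [1] of [e W]. *)
Definition tw (e : R) (f : X -> R) (m : nat) : X -> R := Nat.iter m (fun g p => e * W g p) f.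

Lemma tw_pow e f m p : tw e f m p = e ^ m * Nat.iter m W f p.
Proof.
  revert p; induction m as [|m IH]; intros p; simpl; [ring|].
  replace (tw e f m) with (fun p => e ^ m * Nat.iter m W f p) by (extensionality q; now rewrite IH).
  rewrite walk_scal; ring.
Qed.

Lemma iter_l2 f m : l2 f -> l2 (Nat.iter m W f).
Proof. intros; induction m; simpl; auto using l2_walk. Qed.

Lemma iter_norm f m : l2 f -> ip (Nat.iter m W f) (Nat.iter m W f) = ip f f.
Proof.
  intros H; induction m as [|m IH]; simpl; [reflexivity|].
  rewrite ip_walk_walk by auto using iter_l2; exact IH.
Qed.

Lemma iter_supported f m : supported f -> supported (Nat.iter m W f).
Proof. intros; induction m; simpl; auto using walk_supported. Qed.

Lemma iter_bdd f p : l2 f -> bdd (fun m => Nat.iter m W f p).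
Proof.
  intros H; apply (l2_unif_bdd (fun m => Nat.iter m W f) (ip f f)).
  - intros; now apply iter_l2.
  - intros; rewrite iter_norm by auto; lra.
Qed.

Section Twisted.

Context (e : R).
Hypothesis He : e * e = 1.

Lemma tw_l2 f m : l2 f -> l2 (tw e f m).
Proof. intros; induction m; simpl; auto using l2_scal, l2_walk. Qed.

Lemma tw_norm f m : l2 f -> ip (tw e f m) (tw e f m) = ip f f.
Proof.
  intros H; induction m as [|m IH]; simpl; [reflexivity|].
  rewrite ip_scal_l, ip_scal_r, ip_walk_walk by auto using l2_scal, l2_walk, tw_l2.
  fold (tw e f m); rewrite IH, <- Rmult_assoc, He; ring.
Qed.

Lemma tw_ip f m g : l2 f -> l2 g -> (forall p, W g p = e * g p) -> ip (tw e f m) g = ip f g.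
Proof.
  intros Hf Hg Hgf; induction m as [|m IH]; simpl; [reflexivity|].
  fold (tw e f m).
  replace g with (fun p => e * W g p) at 1
    by (extensionality p; rewrite Hgf, <- Rmult_assoc, He; ring).
  rewrite ip_scal_l, ip_scal_r, ip_walk_walk by auto using l2_scal, l2_walk, tw_l2.
  rewrite IH, <- Rmult_assoc, He; ring.
Qed.

Lemma tw_bdd f p : l2 f -> bdd (fun m => tw e f m p).
Proof.
  intros H; apply (l2_unif_bdd (fun m => tw e f m) (ip f f)).
  - intros; now apply tw_l2.
  - intros; rewrite tw_norm by auto; lra.
Qed.

(** A mean ergodic projection: by [twmean_eig] and [twmean_ip] it is the orthogonal projection of
    [f] onto the eigenspace of [e], whichever Banach limit [M] is used. *)
Definition twmean (M : (nat -> R) -> R) (f : X -> R) : X -> R := fun p => M (fun m => tw e f m p).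

Lemma twmean_l2 M f : banach_limit M -> l2 f -> l2 (twmean M f).
Proof.
  intros HM Hf; apply (bl_l2 M HM (tw e f) (ip f f)).
  - intros; now apply tw_l2.
  - intros; rewrite tw_norm by auto; lra.
Qed.

Lemma twmean_eig M f p : banach_limit M -> l2 f -> W (twmean M f) p = e * twmean M f p.
Proof.
  intros HM Hf; unfold twmean at 1; rewrite (walk_bl M HM) by (intros; now apply tw_bdd).
  unfold twmean; rewrite <- (bl_shift M HM (fun m => tw e f m p)) by now apply tw_bdd.
  rewrite <- (bl_scal M HM e (fun m => tw e f (S m) p)) by (apply (bdd_comp (fun m => tw e f m p) S); now apply tw_bdd).
  f_equal; extensionality m; simpl; fold (tw e f m).
  rewrite <- Rmult_assoc, He; ring.
Qed.

Lemma twmean_ip M f g : banach_limit M -> l2 f -> l2 g -> (forall p, W g p = e * g p) ->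
  ip (twmean M f) g = ip f g.
Proof.
  intros HM Hf Hg Hgf; unfold twmean; rewrite (bl_ip M HM (tw e f) g (ip f f)); auto.
  - rewrite <- (bl_const M HM (ip f g)); f_equal; extensionality m; now apply tw_ip.
  - intros; now apply tw_l2.
  - intros; rewrite tw_norm by auto; lra.
Qed.

Lemma twmean_supported M f : banach_limit M -> supported f -> supported (twmean M f).
Proof.
  intros HM Hf x k Hx; unfold twmean; rewrite <- (bl_const M HM 0); f_equal.
  extensionality m; rewrite tw_pow, (iter_supported f m Hf x k Hx); ring.
Qed.

End Twisted.

Definition eig_orth (e : R) (f : X -> R) : Prop :=
  forall g, l2 g -> (forall p, W g p = e * g p) -> ip f g = 0.

(** The mean is an eigenfunction, so its squared norm equals its pairing with [f], which is zero. *)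
Lemma twmean_orth e M f p : e * e = 1 -> banach_limit M -> l2 f -> eig_orth e f -> twmean e M f p = 0.
Proof.
  intros He HM Hf Ho; apply ip_def; [now apply twmean_l2|].
  rewrite twmean_ip by (auto using twmean_l2; intros; now apply twmean_eig).
  apply Ho; [now apply twmean_l2|intros; now apply twmean_eig].
Qed.

Lemma eig_orth_iter e f m : e * e = 1 -> l2 f -> eig_orth e f -> eig_orth e (Nat.iter m W f).
Proof.
  intros He Hf Ho; induction m as [|m IH]; simpl; auto; intros g Hg Hgf.
  replace g with (fun p => e * W g p)
    by (extensionality p; rewrite Hgf, <- Rmult_assoc, He; ring).
  rewrite ip_scal_r, ip_walk_walk, IH by auto using l2_walk, iter_l2; ring.
Qed.

(* The mean of [W^m f (x) W^m f] is an invariant kernel, so its slices lie in the kernel of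
   [W^2 - 1]; as [f] is orthogonal to that kernel, the slices vanish. *)
Lemma mean_square_zero M f p : banach_limit M -> l2 f -> supported f ->
  eig_orth 1 f -> eig_orth (-1) f -> M (fun m => Nat.iter m W f p * Nat.iter m W f p) = 0.
Proof.
  intros HM Hf Hs Ho1 Ho2.
  set (u := fun m => Nat.iter m W f).
  assert (Hu : forall m, l2 (u m)) by (intros; now apply iter_l2).
  assert (Hb : forall q, bdd (fun m => u m q)) by (intros; now apply iter_bdd).
  set (F := fun q : X * X => M (fun m => u m (fst q) * u m (snd q))).
  assert (HF : l2 F).
  { apply (bl_l2 M HM (fun m (q : X * X) => u m (fst q) * u m (snd q)) (ip f f * ip f f)).
    - intros m; apply l2_bound with (ip (u m) (u m) * ip (u m) (u m)).
      now apply (tensor_bound (u m) (u m)).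
    - intros m; apply sm_le_bound; [intros; apply Rle_0_sqr|].
      intros l Hl; rewrite <- (iter_norm f m Hf).
      exact (tensor_bound (u m) (u m) (Hu m) (Hu m) l Hl). }
  assert (HFs : forall x k r, length x <> d \/ (2 * d <= k)%nat -> F ((x, k), r) = 0).
  { intros x k r Hx; unfold F; simpl; rewrite <- (bl_const M HM 0); f_equal.
    extensionality m; unfold u; rewrite (iter_supported f m Hs x k Hx); ring. }
  assert (HFi : forall q r, W (fun q => F (q, r)) q = Wi (fun r => F (q, r)) r).
  { intros q r; unfold F; simpl.
    replace (fun q => M (fun m => u m q * u m r)) with (fun q => M (fun m => u m r * u m q)).
    2: { extensionality t; f_equal; extensionality m; ring. }
    rewrite (walk_bl M HM (fun m q => u m r * u m q)) by (intros; now apply bdd_mul).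
    rewrite (walk_inv_bl M HM (fun m r => u m q * u m r)) by (intros; now apply bdd_mul).
    replace (fun m => Wi (fun r => u m q * u m r) r) with (fun m => u m q * Wi (u m) r).
    2: { extensionality m; now rewrite walk_inv_scal. }
    (* Advancing time by one turns [u m q * Wi (u m) r] into [u (S m) q * u m r], which is also the
       left side. *)
    rewrite <- (bl_shift M HM (fun m => u m q * Wi (u m) r)).
    - f_equal; extensionality m; rewrite walk_scal; simpl; rewrite walk_inv_l by auto; unfold u; simpl; ring.
    - apply bdd_mul; auto.
      apply (l2_unif_bdd (fun m => Wi (u m)) (ip f f)).
      + intros; now apply l2_walk_inv.
      + intros m; rewrite <- ip_walk, walk_inv_r by auto using l2_walk_inv.
        unfold u; rewrite iter_norm by auto; lra. }
  set (g := fun r => F (p, r)).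
  assert (Hg : l2 g) by (apply (l2_inj (pair p) F); [congruence|auto]).
  assert (Hgi : forall r, W g r = Wi g r).
  { intros r; unfold g; destruct p as [x k].
    destruct (Nat.lt_ge_cases k (2 * d)) as [Hk|Hk].
    - apply (invariant_kernel d hd F); auto.
    - replace (fun r => F (x, k, r)) with (fun _ : X => 0)
        by (extensionality t; symmetry; apply HFs; auto).
      now rewrite walk_zero, walk_inv_zero. }
  assert (HWW : W (W g) = g).
  { replace (W g) with (Wi g) by (extensionality r; now rewrite Hgi). now apply walk_inv_r. }
  assert (Hog : forall m, ip (u m) g = 0).
  { intros m.
    (* As [W^2 g = g], the two halves are eigenfunctions for [1] and [-1], hence orthogonal to every
       iterate of [f]. *)
    replace g with (fun r => / 2 * (1 * g r + 1 * W g r) + / 2 * (1 * g r + -1 * W g r))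
      by (extensionality r; field).
    rewrite (ip_lin_r (/ 2) (/ 2)) by auto using l2_lin, l2_walk.
    unfold u; rewrite (eig_orth_iter 1 f m ltac:(lra) Hf Ho1 (fun r => 1 * g r + 1 * W g r)).
    - rewrite (eig_orth_iter (-1) f m ltac:(lra) Hf Ho2 (fun r => 1 * g r + -1 * W g r)); [ring| |].
      + apply l2_lin; auto using l2_walk.
      + intros r; rewrite walk_lin, HWW; ring.
    - apply l2_lin; auto using l2_walk.
    - intros r; rewrite walk_lin, HWW; ring. }
  (* The pairing [<g, g>] is the Banach limit of [u m p * <u m, g>], every term of which is zero. *)
  assert (E : ip g g = 0).
  { unfold g at 1, F; simpl.
    rewrite (bl_ip M HM (fun m r => u m p * u m r) g (ip f f * ip f f)); auto.
    - rewrite <- (bl_const M HM 0); f_equal; extensionality m.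
      rewrite ip_scal_l, Hog by auto; ring.
    - intros; now apply l2_scal.
    - intros m; rewrite ip_scal_l, ip_scal_r by auto using l2_scal.
      assert (E1 : ip (u m) (u m) = ip f f) by (apply iter_norm; auto).
      assert (E2 : u m p * u m p <= ip f f).
      { rewrite <- E1. pose proof (sm_ge_lsum (fun q => u m q * u m q) (p :: nil)) as H.
        unfold lsum in H; simpl in H; rewrite Rplus_0_r in H; apply H; auto.
        - intros; apply Rle_0_sqr.
        - apply Hu.
        - constructor; [auto|constructor]. }
      rewrite E1; pose proof (ip_pos f Hf); nra. }
  exact (ip_def g p Hg E).
Qed.

(** Write [W^m f = hp + (-1)^m hm + W^m c] with [c] orthogonal to both eigenspaces. In the square,
    every Banach limit kills the oscillating term, the cross terms with [c] and the square of
    [W^m c]; only [hp^2 + hm^2] survives. *)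
Theorem time_average (f : X -> R) : l2 f -> supported f ->
  exists hp hm : X -> R,
    l2 hp /\ supported hp /\ (forall p, W hp p = 1 * hp p) /\
    eig_orth 1 (fun p => 1 * f p + -1 * hp p) /\
    l2 hm /\ supported hm /\ (forall p, W hm p = -1 * hm p) /\
    eig_orth (-1) (fun p => 1 * f p + -1 * hm p) /\
    forall p, Un_cv (av (fun m => Nat.iter m W f p * Nat.iter m W f p)) (hp p * hp p + hm p * hm p).
Proof.
  intros Hf Hs.
  (* One Banach limit is fixed to build the projections; convergence is tested later against all of
     them. *)
  destruct (banach_limit_ex (fun N => N) (fun N => le_n N)) as [M0 [HM0 _]].
  set (hp := twmean 1 M0 f); set (hm := twmean (-1) M0 f).
  assert (E1 : 1 * 1 = 1) by ring; assert (E2 : -1 * -1 = 1) by ring.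
  assert (Hhp : l2 hp) by now apply twmean_l2.
  assert (Hhm : l2 hm) by now apply twmean_l2.
  assert (Hep : forall p, W hp p = 1 * hp p) by (intros; now apply twmean_eig).
  assert (Hem : forall p, W hm p = -1 * hm p) by (intros; now apply twmean_eig).
  assert (Hop : eig_orth 1 (fun p => 1 * f p + -1 * hp p)).
  { intros g Hg Hgf; rewrite ip_lin_l by auto; unfold hp; rewrite twmean_ip by auto; ring. }
  assert (Hom : eig_orth (-1) (fun p => 1 * f p + -1 * hm p)).
  { intros g Hg Hgf; rewrite ip_lin_l by auto; unfold hm; rewrite twmean_ip by auto; ring. }
  assert (Hsp : supported hp) by now apply twmean_supported.
  assert (Hsm : supported hm) by now apply twmean_supported.
  exists hp, hm; do 8 (split; [assumption|]); intros p.
  set (c := fun p => 1 * (1 * f p + -1 * hp p) + -1 * hm p).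
  assert (Hc : l2 c) by (unfold c; apply l2_lin; [apply l2_lin|]; auto).
  assert (Hcs : supported c).
  { intros x k Hx; unfold c; rewrite (Hs x k Hx), (Hsp x k Hx), (Hsm x k Hx); ring. }
  (* Eigenfunctions for opposite eigenvalues are orthogonal, since [W] preserves pairings. *)
  assert (Hpm : forall g h a b, l2 g -> l2 h -> (forall p, W g p = a * g p) -> (forall p, W h p = b * h p) ->
     a * b = -1 -> ip g h = 0).
  { intros g h a b Hg Hh Hga Hhb Hab.
    assert (E : ip (W g) (W h) = a * b * ip g h).
    { replace (W g) with (fun p => a * g p) by (extensionality q; auto).
      replace (W h) with (fun p => b * h p) by (extensionality q; auto).
      rewrite ip_scal_l, ip_scal_r by auto using l2_scal; ring. }
    rewrite ip_walk_walk in E by auto; rewrite Hab in E; lra. }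
  assert (Hcp : eig_orth 1 c).
  { intros g Hg Hgf; unfold c; rewrite ip_lin_l by auto using l2_lin.
    rewrite (Hop g Hg Hgf), (Hpm hm g (-1) 1) by (auto; ring); ring. }
  assert (Hcm : eig_orth (-1) c).
  { intros g Hg Hgf.
    replace c with (fun p => 1 * (1 * f p + -1 * hm p) + -1 * hp p)
      by (extensionality q; unfold c; ring).
    rewrite ip_lin_l by auto using l2_lin.
    rewrite (Hom g Hg Hgf), (Hpm hp g 1 (-1)) by (auto; ring); ring. }
  assert (Hdec : forall m q, Nat.iter m W f q = hp q + (-1) ^ m * hm q + Nat.iter m W c q).
  { induction m as [|m IH]; intros q; [simpl; unfold c; ring|].
    simpl Nat.iter.
    replace (Nat.iter m W f) with (fun q => 1 * (1 * hp q + (-1) ^ m * hm q) + 1 * Nat.iter m W c q)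
      by (extensionality t; rewrite IH; ring).
    rewrite (walk_lin d 1 1 (fun q => 1 * hp q + (-1) ^ m * hm q)), walk_lin, Hep, Hem; simpl; ring. }
  assert (Hs1 : bdd (fun m => (-1) ^ m)).
  { exists 1; intros m; rewrite pow_1_abs; lra. }
  assert (Hb := iter_bdd c p Hc).
  apply av_cv_of_banach; [apply bdd_mul; now apply iter_bdd|].
  intros M HM.
  (* A shift by one changes the sign of this sequence. *)
  assert (Z1 : M (fun m => (-1) ^ m) = 0).
  { pose proof (bl_shift M HM _ Hs1) as H; cbn [pow] in H.
    rewrite (bl_scal M HM (-1) (fun m => (-1) ^ m)) in H by auto; lra. }
  assert (Z2 : M (fun m => Nat.iter m W c p) = 0).
  { rewrite <- (twmean_orth 1 M c p E1 HM Hc Hcp); unfold twmean; f_equal.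
    extensionality m; rewrite tw_pow, pow1; ring. }
  assert (Z3 : M (fun m => (-1) ^ m * Nat.iter m W c p) = 0).
  { rewrite <- (twmean_orth (-1) M c p E2 HM Hc Hcm); unfold twmean; f_equal.
    extensionality m; now rewrite tw_pow. }
  assert (Z4 := mean_square_zero M c p HM Hc Hcs Hcp Hcm).
  replace (fun m => Nat.iter m W f p * Nat.iter m W f p) with
    (fun m => 1 * (1 * (hp p * hp p + hm p * hm p) + 2 * hp p * hm p * (-1) ^ m)
            + 1 * (2 * hm p * ((-1) ^ m * Nat.iter m W c p)
            + 1 * (1 * (Nat.iter m W c p * Nat.iter m W c p) + 2 * hp p * Nat.iter m W c p))).
  - rewrite (bl_lin M HM 1 1 (fun m => 1 * (hp p * hp p + hm p * hm p) + 2 * hp p * hm p * (-1) ^ m)).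
    + rewrite (bl_lin M HM 1 (2 * hp p * hm p) (fun m => hp p * hp p + hm p * hm p) (fun m => (-1) ^ m)),
        Z1, (bl_const M HM)
        by auto using bdd_const.
      rewrite (bl_lin M HM (2 * hm p) 1 (fun m => (-1) ^ m * Nat.iter m W c p)
         (fun m => 1 * (Nat.iter m W c p * Nat.iter m W c p) + 2 * hp p * Nat.iter m W c p)), Z3
        by auto using bdd_mul, bdd_lin.
      rewrite (bl_lin M HM 1 (2 * hp p) (fun m => Nat.iter m W c p * Nat.iter m W c p)
         (fun m => Nat.iter m W c p)), Z4, Z2
        by auto using bdd_mul.
      ring.
    + apply (bdd_lin 1 _ (fun m => hp p * hp p + hm p * hm p)); auto using bdd_const.
    + apply (bdd_lin _ 1 (fun m => (-1) ^ m * Nat.iter m W c p)); auto using bdd_mul.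
      apply (bdd_lin 1 _ (fun m => Nat.iter m W c p * Nat.iter m W c p)); auto using bdd_mul.
  - extensionality m; rewrite Hdec.
    assert (Hm : (-1) ^ m * (-1) ^ m = 1).
    { rewrite <- Rpow_mult_distr, E2; apply pow1. }
    replace (hm p * hm p) with ((-1) ^ m * (-1) ^ m * (hm p * hm p)) by (rewrite Hm; ring).
    ring.
Qed.

End Ergodic.

(** * Real and imaginary parts of states *)

Definition rpart (f : state) : list Z * nat -> R := fun p => re (f (fst p) (snd p)).
Definition ipart (f : state) : list Z * nat -> R := fun p => im (f (fst p) (snd p)).

Lemma Cx_ext a b : re a = re b -> im a = im b -> a = b.
Proof. destruct a, b; simpl; intros; subst; reflexivity. Qed.

Lemma re_Clsum {J} (f : J -> Cx) l : re (Clsum (map f l)) = lsum (fun j => re (f j)) l.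
Proof.
  induction l as [|a l IH]; [reflexivity|].
  rewrite lsum_cons, <- IH; reflexivity.
Qed.

Lemma im_Clsum {J} (f : J -> Cx) l : im (Clsum (map f l)) = lsum (fun j => im (f j)) l.
Proof.
  induction l as [|a l IH]; [reflexivity|].
  rewrite lsum_cons, <- IH; reflexivity.
Qed.

Lemma lsum_seq f m : lsum f (seq 0 m) = nsum f m.
Proof.
  induction m as [|m IH]; [reflexivity|].
  rewrite seq_S, lsum_app, IH, lsum_cons; unfold lsum; simpl; ring.
Qed.

Lemma lsum_flat_map {I J} (g : I -> list J) (f : J -> R) l :
  lsum f (flat_map g l) = lsum (fun i => lsum f (g i)) l.
Proof.
  induction l as [|a l IH]; [reflexivity|].
  simpl; rewrite lsum_app, IH, lsum_cons; reflexivity.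
Qed.

Lemma nsum_delta (h : nat -> R) k m : (k < m)%nat ->
  nsum (fun i => if Nat.eqb k i then h i else 0) m = h k.
Proof.
  intros H; induction m as [|m IH]; [lia|]; simpl.
  destruct (Nat.eqb_spec k m) as [->|Hn].
  - rewrite (nsum_ext _ (fun _ => 0)), nsum_const; [ring|].
    intros i Hi; destruct (Nat.eqb_spec m i); [lia|reflexivity].
  - rewrite IH by lia; ring.
Qed.

Lemma Zl_add_zero g s x : (forall i, (s <= i)%nat -> g i = 0%Z) ->
  Zl_add x (map g (seq s (length x))) = x.
Proof.
  revert s; induction x as [|a x IH]; intros s H; simpl; auto.
  rewrite (H s), IH; [f_equal; lia| |lia]; intros; apply H; lia.
Qed.

Lemma Zl_add_upd g s j c x : (forall i, (s <= i)%nat -> g i = if Nat.eqb i (s + j) then c else 0%Z) ->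
  Zl_add x (map g (seq s (length x))) = upd j c x.
Proof.
  revert s j; induction x as [|a x IH]; intros s j H; [destruct j; reflexivity|].
  cbn [length seq map Zl_add]; rewrite (H s) by lia; destruct j as [|j]; simpl upd.
  - rewrite Nat.add_0_r, Nat.eqb_refl, Zl_add_zero; auto.
    intros i Hi; rewrite H by lia; destruct (Nat.eqb_spec i (s + 0)); [lia|auto].
  - destruct (Nat.eqb_spec s (s + S j)); [lia|]; rewrite (IH (S s) j); [f_equal; lia|].
    intros i Hi; rewrite H by lia; replace (s + S j)%nat with (S s + j)%nat by lia; reflexivity.
Qed.

Lemma Zl_sub_unit d j x : length x = d -> Zl_sub x (unit_vec d j) = upd j (-1) x.
Proof.
  intros <-; unfold Zl_sub, Zl_opp, unit_vec; rewrite map_map; apply Zl_add_upd.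
  intros i _; simpl; destruct Nat.eqb; reflexivity.
Qed.

Lemma Zl_sub_opp_unit d j x : length x = d -> Zl_sub x (Zl_opp (unit_vec d j)) = upd j 1 x.
Proof.
  intros <-; unfold Zl_sub, Zl_opp, unit_vec; rewrite !map_map; apply Zl_add_upd.
  intros i _; simpl; destruct Nat.eqb; reflexivity.
Qed.

Section Bridge.

Context (d : nat).
Hypothesis hd : (0 < d)%nat.

Local Notation X := (list Z * nat)%type.

Definition validb (p : X) : bool := andb (Nat.eqb (length (fst p)) d) (Nat.ltb (snd p) (2 * d)).

Lemma validb_true x k : validb (x, k) = true -> length x = d /\ (k < 2 * d)%nat.
Proof.
  unfold validb; simpl fst; simpl snd; intros H; apply andb_prop in H; destruct H as [H1 H2].
  apply Nat.eqb_eq in H1; apply Nat.ltb_lt in H2; auto.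
Qed.

Lemma validb_false x k : validb (x, k) = false -> length x <> d \/ (2 * d <= k)%nat.
Proof.
  unfold validb; simpl fst; simpl snd.
  destruct (Nat.eqb_spec (length x) d), (Nat.ltb_spec k (2 * d)); auto; discriminate.
Qed.

(* The entries of the Grover matrix are real, so [part] is either [re] or [im]. *)
Lemma grover_part (part : Cx -> R) (f : state) x k :
  (forall l : list (list Z * nat), forall g, part (Clsum (map g l)) = lsum (fun j => part (g j)) l) ->
  (forall l : list nat, forall g, part (Clsum (map g l)) = lsum (fun j => part (g j)) l) ->
  (forall a z, part (Cmul (CR a) z) = a * part z) -> part Czero = 0 ->
  length x = d -> (k < 2 * d)%nat ->
  part (U_grover d f x k) = walk d (fun p => part (f (fst p) (snd p))) (x, k).
Proof.
  intros Hl1 Hl2 Hm H0 Hx Hk.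
  assert (HG : forall y, part (mat_apply d (Grover (2 * d)) (f y) k) =
                coin d (fun p => part (f (fst p) (snd p))) (y, k)).
  { intros y; unfold mat_apply, coin; simpl fst; simpl snd.
    rewrite Hl2, lsum_seq; destruct (Nat.ltb_spec k (2 * d)); [|lia].
    rewrite (nsum_ext _ (fun m => / INR d * part (f y m) + -1 * (if Nat.eqb k m then part (f y m) else 0))).
    - rewrite nsum_lin, (nsum_delta (fun m => part (f y m))) by auto; ring.
    - intros m Hm'; unfold Grover; rewrite Hm, mult_INR; simpl (INR 2).
      assert (INR d <> 0) by (apply not_0_INR; lia).
      destruct Nat.eqb; field; auto. }
  unfold U_grover, U_walk; rewrite Hx, Nat.eqb_refl.
  destruct (Nat.ltb_spec k (2 * d)) as [_|]; [|lia]; cbn [andb].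
  rewrite Hl1; unfold S_std; rewrite lsum_flat_map, lsum_seq.
  set (h := fun m => coin d (fun p => part (f (fst p) (snd p))) (upd (Nat.div2 m) (dir m) x, k)).
  transitivity (nsum (fun j => (if Nat.eqb k (2 * j) then h (2 * j)%nat else 0)
                              + (if Nat.eqb k (2 * j + 1) then h (2 * j + 1)%nat else 0)) d).
  - apply nsum_ext; intros j Hj; rewrite !lsum_cons; unfold lsum; simpl map; simpl Rlsum; rewrite Rplus_0_r.
    cbn [fst snd]; f_equal.
    + destruct Nat.eqb; auto; unfold h; rewrite div2_2j, dir_2j, HG, Zl_sub_unit; auto.
    + replace (j + (j + 0) + 1)%nat with (2 * j + 1)%nat by lia.
      destruct Nat.eqb; auto; unfold h; rewrite div2_2j1, dir_2j1, HG, Zl_sub_opp_unit; auto.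
  - rewrite (nsum_pair (fun m => if Nat.eqb k m then h m else 0)), nsum_delta by auto; reflexivity.
Qed.

Lemma U_grover_outside f x k : length x <> d \/ (2 * d <= k)%nat -> U_grover d f x k = Czero.
Proof.
  intros H; unfold U_grover, U_walk.
  destruct (Nat.eqb_spec (length x) d), (Nat.ltb_spec k (2 * d)); auto; destruct H; lia.
Qed.

Definition state_supp (f : state) : Prop :=
  forall x k, (length x <> d \/ (2 * d <= k)%nat) -> f x k = Czero.

Lemma rpart_supported f : state_supp f -> supported d (rpart f).
Proof. intros H x k Hx; unfold rpart; simpl; now rewrite H. Qed.

Lemma ipart_supported f : state_supp f -> supported d (ipart f).
Proof. intros H x k Hx; unfold ipart; simpl; now rewrite H. Qed.

Lemma rpart_U f : state_supp f -> rpart (U_grover d f) = walk d (rpart f).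
Proof.
  intros H; extensionality p; destruct p as [x k].
  destruct (validb (x, k)) eqn:E.
  - apply validb_true in E; destruct E; apply (grover_part re); auto using @re_Clsum.
    intros; simpl; ring.
  - apply validb_false in E; rewrite walk_supported by auto using rpart_supported.
    unfold rpart; simpl; now rewrite U_grover_outside.
Qed.

Lemma ipart_U f : state_supp f -> ipart (U_grover d f) = walk d (ipart f).
Proof.
  intros H; extensionality p; destruct p as [x k].
  destruct (validb (x, k)) eqn:E.
  - apply validb_true in E; destruct E; apply (grover_part im); auto using @im_Clsum.
    intros; simpl; ring.
  - apply validb_false in E; rewrite walk_supported by auto using ipart_supported.
    unfold ipart; simpl; now rewrite U_grover_outside.
Qed.

Lemma iter_U_supp f m : state_supp f -> state_supp (Nat.iter m (U_grover d) f).
Proof. intros H; destruct m; simpl; auto; intros x k Hx; now apply U_grover_outside. Qed.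

Lemma rpart_iter f m : state_supp f -> rpart (Nat.iter m (U_grover d) f) = Nat.iter m (walk d) (rpart f).
Proof.
  intros H; induction m as [|m IH]; simpl; auto.
  rewrite rpart_U by now apply iter_U_supp.
  now rewrite IH.
Qed.

Lemma ipart_iter f m : state_supp f -> ipart (Nat.iter m (U_grover d) f) = Nat.iter m (walk d) (ipart f).
Proof.
  intros H; induction m as [|m IH]; simpl; auto.
  rewrite ipart_U by now apply iter_U_supp.
  now rewrite IH.
Qed.

(** * Sums over boxes *)

Definition boxlist (r : nat) : list X := list_prod (box d r) (seq 0 (2 * d)).

Lemma lsum_list_prod_iter {I J} (f : I * J -> R) l l' :
  lsum f (list_prod l l') = lsum (fun i => lsum (fun j => f (i, j)) l') l.
Proof.
  induction l as [|i l IH]; [reflexivity|].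
  simpl list_prod; rewrite lsum_app, IH, lsum_map; reflexivity.
Qed.

Lemma box_norm2_eq r f :
  box_norm2 d r f = lsum (fun p => 1 * (rpart f p * rpart f p) + 1 * (ipart f p * ipart f p)) (boxlist r).
Proof.
  unfold boxlist; rewrite lsum_list_prod_iter; apply lsum_ext_in; intros x _.
  apply lsum_ext_in; intros k _; unfold Cnorm2, rpart, ipart; simpl; ring.
Qed.

Lemma inner_re r g h : re (inner_partial d r g h) =
  lsum (fun p => 1 * (rpart g p * rpart h p) + 1 * (ipart g p * ipart h p)) (boxlist r).
Proof.
  unfold inner_partial, boxlist; rewrite re_Clsum, lsum_list_prod_iter; apply lsum_ext_in; intros x _.
  rewrite re_Clsum; apply lsum_ext_in; intros k _; unfold rpart, ipart; simpl; ring.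
Qed.

Lemma inner_im r g h : im (inner_partial d r g h) =
  lsum (fun p => 1 * (rpart g p * ipart h p) + -1 * (ipart g p * rpart h p)) (boxlist r).
Proof.
  unfold inner_partial, boxlist; rewrite im_Clsum, lsum_list_prod_iter; apply lsum_ext_in; intros x _.
  rewrite im_Clsum; apply lsum_ext_in; intros k _; unfold rpart, ipart; simpl; ring.
Qed.

Lemma in_zrange z r : In z (zrange r) <-> (Z.abs z <= Z.of_nat r)%Z.
Proof.
  unfold zrange; rewrite in_map_iff; split.
  - intros [i [<- Hi]]; apply in_seq in Hi; lia.
  - intros H; exists (Z.to_nat (z + Z.of_nat r)); split; [lia|apply in_seq; lia].
Qed.

Lemma in_box c r x : In x (box c r) <-> length x = c /\ forall z, In z x -> (Z.abs z <= Z.of_nat r)%Z.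
Proof.
  revert x; induction c as [|c IH]; intros x; simpl.
  - split.
    + intros [<-|[]]; split; [reflexivity|intros z []].
    + intros [H _]; left; destruct x; [reflexivity|discriminate].
  - rewrite in_flat_map; split.
    + intros [z [Hz Hx]]; apply in_map_iff in Hx; destruct Hx as [y [<- Hy]].
      apply IH in Hy; destruct Hy as [Hy1 Hy2]; apply in_zrange in Hz.
      split; [simpl; lia|intros t [<-|Ht]; auto].
    + intros [H1 H2]; destruct x as [|z x]; [discriminate|]; exists z; split.
      * apply in_zrange, H2; now left.
      * apply in_map, IH; split; [simpl in H1; lia|intros; apply H2; now right].
Qed.

Lemma NoDup_list_prod {I J} (l : list I) (l' : list J) : NoDup l -> NoDup l' -> NoDup (list_prod l l').
Proof.
  intros Hl Hl'; induction Hl as [|i l Hi Hl IH]; simpl; [constructor|].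
  apply NoDup_app; auto.
  - apply NoDup_map_inj; auto; congruence.
  - intros [a b] Ha Hb; apply in_map_iff in Ha; destruct Ha as [j [E _]]; injection E as -> ->.
    apply in_prod_iff in Hb; tauto.
Qed.

Lemma box_NoDup c r : NoDup (box c r).
Proof.
  induction c as [|c IH]; simpl; [constructor; [intros []|constructor]|].
  assert (E : forall l, flat_map (fun z => map (cons z) (box c r)) l =
                        map (fun p => fst p :: snd p) (list_prod l (box c r))).
  { induction l as [|z l IHl]; simpl; auto; rewrite IHl, map_app, map_map; reflexivity. }
  rewrite E; apply NoDup_map_inj.
  - intros [a x] [b y]; simpl; congruence.
  - apply NoDup_list_prod; auto; apply NoDup_map_inj; [intros; lia|apply seq_NoDup].
Qed.

Lemma boxlist_NoDup r : NoDup (boxlist r).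
Proof. apply NoDup_list_prod; [apply box_NoDup|apply seq_NoDup]. Qed.

(** Boxes are cofinal among finite sets of valid points, which links the box sums in [in_H] and
    [ortho] to unordered sums. *)
Lemma boxlist_exhausts (l : list X) :
  exists r0, forall r p, (r0 <= r)%nat -> In p l -> validb p = true -> In p (boxlist r).
Proof.
  induction l as [|[x k] l [r0 IH]]; [exists 0%nat; intros r p _ []|].
  assert (Hx : exists r1, forall z, In z x -> (Z.abs z <= Z.of_nat r1)%Z).
  { clear; induction x as [|a x [r1 IH]]; [exists 0%nat; intros z []|].
    exists (Nat.max r1 (Z.abs_nat a)); intros z [<-|Hz]; [lia|specialize (IH z Hz); lia]. }
  destruct Hx as [r1 Hr1]; exists (Nat.max r0 r1); intros r p Hr [<-|Hp] Hv.
  - apply validb_true in Hv; apply in_prod.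
    + apply in_box; split; [tauto|]; intros z Hz; specialize (Hr1 z Hz); lia.
    + apply in_seq; lia.
  - apply IH; auto; lia.
Qed.

Lemma lsum_filter {J} (f : J -> R) (b : J -> bool) l : (forall j, In j l -> b j = false -> f j = 0) ->
  lsum f (filter b l) = lsum f l.
Proof.
  intros H; induction l as [|a l IH]; [reflexivity|].
  simpl; rewrite lsum_cons, <- IH by (intros; apply H; simpl; auto).
  destruct (b a) eqn:E; [apply lsum_cons|rewrite (H a); simpl; auto; ring].
Qed.

Lemma boxlist_cv (f : X -> R) : supported d f -> summ f ->
  Un_cv (fun r => lsum f (boxlist r)) (sm f).
Proof.
  intros Hs Hf eps He; destruct (summ_has_sum f Hf eps He) as [l0 Hl0].
  destruct (boxlist_exhausts l0) as [r0 Hr0]; exists r0; intros r Hr; unfold Rdist.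
  pose (out := fun p => if in_dec cdec p (boxlist r) then false else true).
  (* The box is completed by the points of [l0] that it misses; these are not valid, so [f] is zero
     there. *)
  specialize (Hl0 (boxlist r ++ filter out (nodup cdec l0))).
  rewrite lsum_app, (lsum_zero f (filter _ _)), Rplus_0_r in Hl0.
  - apply Hl0.
    + apply NoDup_app; [apply boxlist_NoDup|apply NoDup_filter, NoDup_nodup|].
      intros p Hp Hq; apply filter_In in Hq; destruct Hq as [_ Hq]; unfold out in Hq.
      destruct in_dec; [discriminate|contradiction].
    + intros p Hp; apply in_or_app.
      destruct (in_dec cdec p (boxlist r)) as [|Hn] eqn:E; auto; right.
      apply filter_In; split; [now apply nodup_In|unfold out; now rewrite E].
  - intros [x k] Hp; apply filter_In in Hp; destruct Hp as [Hp Hq]; unfold out in Hq.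
    destruct in_dec as [|Hn]; [discriminate|].
    destruct (validb (x, k)) eqn:E.
    + exfalso; apply Hn, Hr0; auto; now apply nodup_In in Hp.
    + apply Hs; now apply validb_false.
Qed.

Lemma summ_nonneg_bound {J} (f : J -> R) M : (forall j, 0 <= f j) ->
  (forall l, NoDup l -> lsum f l <= M) -> summ f.
Proof.
  intros H HM; exists M; intros l Hl; rewrite (lsum_ext_in _ f); auto.
  intros j _; now apply Rabs_pos_eq.
Qed.

Lemma in_H_parts f : in_H d f <-> state_supp f /\ l2 (rpart f) /\ l2 (ipart f).
Proof.
  split.
  - intros [Hs [M HM]].
    assert (H : summ (fun p => 1 * (rpart f p * rpart f p) + 1 * (ipart f p * ipart f p))).
    { apply summ_nonneg_bound with M.
      - intros p; pose proof (Rle_0_sqr (rpart f p)); pose proof (Rle_0_sqr (ipart f p)).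
        unfold Rsqr in *; lra.
      - intros l Hl; destruct (boxlist_exhausts l) as [r0 Hr0].
        eapply Rle_trans; [|apply (HM r0)]; rewrite box_norm2_eq.
        rewrite <- (lsum_filter _ validb l).
        + apply lsum_incl.
          * intros p; pose proof (Rle_0_sqr (rpart f p)); pose proof (Rle_0_sqr (ipart f p)).
            unfold Rsqr in *; lra.
          * now apply NoDup_filter.
          * intros p Hp; apply filter_In in Hp; apply (Hr0 r0); tauto || lia.
        + intros [x k] _ Hv; apply validb_false in Hv.
          rewrite rpart_supported, ipart_supported by auto; ring. }
    split; [exact Hs|]; split; apply summ_le with (2 := H); intros p;
      pose proof (Rle_0_sqr (rpart f p)); pose proof (Rle_0_sqr (ipart f p));
      unfold Rsqr in *; rewrite Rabs_pos_eq; lra.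
  - intros [Hs [Hr Hi]]; split; [exact Hs|].
    destruct (summ_lin 1 1 _ _ Hr Hi) as [M HM]; exists M; intros r.
    rewrite box_norm2_eq; eapply Rle_trans; [|apply (HM _ (boxlist_NoDup r))].
    apply lsum_le; intros p _; apply Rle_abs.
Qed.

Lemma ortho_of_parts g h : state_supp h ->
  l2 (rpart g) -> l2 (ipart g) -> l2 (rpart h) -> l2 (ipart h) ->
  ip (rpart g) (rpart h) = 0 -> ip (ipart g) (ipart h) = 0 ->
  ip (rpart g) (ipart h) = 0 -> ip (ipart g) (rpart h) = 0 -> ortho d g h.
Proof.
  intros Hs Hgr Hgi Hhr Hhi E1 E2 E3 E4.
  assert (Hcv : forall a (u v u' v' : X -> R), l2 u -> l2 v -> l2 u' -> l2 v' ->
    supported d v -> supported d v' -> ip u v = 0 -> ip u' v' = 0 ->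
    Un_cv (fun r => lsum (fun p => 1 * (u p * v p) + a * (u' p * v' p)) (boxlist r)) 0).
  { intros a u v u' v' Hu Hv Hu' Hv' Hvs Hvs' E E'.
    replace 0 with (sm (fun p => 1 * (u p * v p) + a * (u' p * v' p))).
    - apply boxlist_cv.
      + intros x k Hx; rewrite Hvs, Hvs' by auto; ring.
      + apply summ_lin; now apply l2_mul.
    - rewrite sm_lin by now apply l2_mul.
      fold (ip u v) (ip u' v'); rewrite E, E'; ring. }
  split.
  - replace (fun r => re (inner_partial d r g h)) with
      (fun r => lsum (fun p => 1 * (rpart g p * rpart h p) + 1 * (ipart g p * ipart h p)) (boxlist r))
      by (extensionality r; now rewrite inner_re).
    apply Hcv; auto using rpart_supported, ipart_supported.
  - replace (fun r => im (inner_partial d r g h)) with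
      (fun r => lsum (fun p => 1 * (rpart g p * ipart h p) + -1 * (ipart g p * rpart h p)) (boxlist r))
      by (extensionality r; now rewrite inner_im).
    apply Hcv; auto using rpart_supported, ipart_supported.
Qed.

Lemma l2_finite {J} (f : J -> R) (l0 : list J) : (forall j, ~ In j l0 -> f j = 0) -> l2 f.
Proof.
  intros H; apply l2_bound with (lsum (fun j => f j * f j) l0); intros l Hl.
  pose (b := fun j => if in_dec cdec j l0 then true else false).
  rewrite <- (lsum_filter _ b l).
  - apply lsum_incl; [intros; apply Rle_0_sqr|now apply NoDup_filter|].
    intros j Hj; apply filter_In in Hj; destruct Hj as [_ Hj]; unfold b in Hj.
    now destruct in_dec.
  - intros j _ Hj; unfold b in Hj; destruct in_dec; [discriminate|rewrite H; auto; ring].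
Qed.

(** * Eigenvectors *)

Lemma eig_parts lam f : state_supp f -> (forall x k, U_grover d f x k = Cmul lam (f x k)) ->
  (forall p, walk d (rpart f) p = re lam * rpart f p - im lam * ipart f p) /\
  (forall p, walk d (ipart f) p = re lam * ipart f p + im lam * rpart f p).
Proof.
  intros Hs H; split; intros [x k].
  - rewrite <- rpart_U by auto; unfold rpart at 1; simpl fst; simpl snd; rewrite H; reflexivity.
  - rewrite <- ipart_U by auto; unfold ipart at 1; simpl fst; simpl snd; rewrite H; reflexivity.
Qed.

Lemma eig_of_parts e f : state_supp f -> (forall p, walk d (rpart f) p = e * rpart f p) ->
  (forall p, walk d (ipart f) p = e * ipart f p) ->
  forall x k, U_grover d f x k = Cmul (mkCx e 0) (f x k).
Proof.
  intros Hs Hr Hi x k; apply Cx_ext; simpl.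
  - change (re (U_grover d f x k)) with (rpart (U_grover d f) (x, k)).
    rewrite rpart_U, Hr by auto; unfold rpart; simpl; ring.
  - change (im (U_grover d f x k)) with (ipart (U_grover d f) (x, k)).
    rewrite ipart_U, Hi by auto; unfold ipart; simpl; ring.
Qed.

(* For an eigenfunction [g + i h], the kernel [g (x) g + h (x) h] is invariant. *)
Lemma eigenvalue_pm1 lam : eigenvalue d (U_grover d) lam -> lam = Cone \/ lam = Cmone.
Proof.
  intros [f [Hf [[x0 [k0 Hne]] Heig]]].
  apply in_H_parts in Hf; destruct Hf as [Hs [Hg Hh]].
  destruct (eig_parts lam f Hs Heig) as [Eg Eh].
  assert (Hgs := rpart_supported f Hs); assert (Hhs := ipart_supported f Hs).
  assert (Hne' : rpart f (x0, k0) <> 0 \/ ipart f (x0, k0) <> 0).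
  { apply NNPP; intros Hn; apply Hne; apply Cx_ext; apply NNPP; intros Hn'; apply Hn; auto. }
  set (g := rpart f) in *; set (h := ipart f) in *; set (p0 := (x0, k0)) in *.
  set (a := re lam) in *; set (b := im lam) in *.
  assert (Eg' : walk d g = fun p => a * g p + - b * h p) by (extensionality p; rewrite Eg; ring).
  assert (Eh' : walk d h = fun p => a * h p + b * g p) by (extensionality p; rewrite Eh; ring).
  assert (Hpos : 0 < ip g g + ip h h).
  { pose proof (ip_pos g Hg); pose proof (ip_pos h Hh).
    destruct (Rle_lt_or_eq_dec 0 (ip g g + ip h h) ltac:(lra)) as [|E]; auto; exfalso.
    destruct Hne' as [Hn|Hn]; apply Hn; apply ip_def; auto; lra. }
  assert (Hunit : a * a + b * b = 1).
  { pose proof (ip_walk_walk d hd g g Hg Hg) as E1; pose proof (ip_walk_walk d hd h h Hh Hh) as E2.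
    rewrite Eg', ip_lin_l, !ip_lin_r in E1 by auto using l2_lin.
    rewrite Eh', ip_lin_l, !ip_lin_r in E2 by auto using l2_lin.
    rewrite (ip_sym h g) in *.
    apply Rmult_eq_reg_r with (ip g g + ip h h); lra. }
  (* Since [a^2 + b^2 = 1], the inverse walk acts on [g + i h] by the conjugate eigenvalue. *)
  assert (Ig : walk_inv d g = fun p => a * g p + b * h p).
  { replace g with (fun p => a * walk d g p + b * walk d h p) at 1.
    - rewrite walk_inv_lin, !walk_inv_l; auto.
    - extensionality p; rewrite Eg, Eh; rewrite <- (Rmult_1_l (g p)) at 3; rewrite <- Hunit; ring. }
  assert (Ih : walk_inv d h = fun p => a * h p + - b * g p).
  { replace h with (fun p => a * walk d h p + - b * walk d g p) at 1.
    - rewrite walk_inv_lin, !walk_inv_l; auto.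
    - extensionality p; rewrite Eg, Eh; rewrite <- (Rmult_1_l (h p)) at 3; rewrite <- Hunit; ring. }
  set (F := fun q : X * X => 1 * (g (fst q) * g (snd q)) + 1 * (h (fst q) * h (snd q))).
  assert (HF : l2 F).
  { apply (l2_lin 1 1 (fun q : X * X => g (fst q) * g (snd q)) (fun q => h (fst q) * h (snd q)));
      [apply l2_bound with (ip g g * ip g g)|apply l2_bound with (ip h h * ip h h)].
    - exact (tensor_bound g g Hg Hg).
    - exact (tensor_bound h h Hh Hh). }
  assert (HFs : forall x k r, length x <> d -> F ((x, k), r) = 0).
  { intros x k r Hx; unfold F; simpl; rewrite Hgs, Hhs by auto; ring. }
  assert (HWr : forall p r, walk d (fun r => F (p, r)) r = g p * walk d g r + h p * walk d h r).
  { intros p r; unfold F; simpl.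
    replace (fun r => 1 * (g p * g r) + 1 * (h p * h r)) with (fun r => g p * g r + h p * h r)
      by (extensionality t; ring).
    now rewrite walk_lin. }
  assert (HWir : forall p r, walk_inv d (fun r => F (p, r)) r = g p * walk_inv d g r + h p * walk_inv d h r).
  { intros p r; unfold F; simpl.
    replace (fun r => 1 * (g p * g r) + 1 * (h p * h r)) with (fun r => g p * g r + h p * h r)
      by (extensionality t; ring).
    now rewrite walk_inv_lin. }
  assert (HWl : forall p r, walk d (fun p => F (p, r)) p = g r * walk d g p + h r * walk d h p).
  { intros p r; rewrite <- HWr; f_equal; extensionality t; unfold F; simpl; ring. }
  assert (Hinv : forall p r, walk d (fun p => F (p, r)) p = walk_inv d (fun r => F (p, r)) r).
  { intros p r; rewrite HWl, HWir, Eg', Eh', Ig, Ih; ring. }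
  destruct (Req_dec b 0) as [Hb|Hb].
  - assert (Ha : (a - 1) * (a + 1) = 0) by (rewrite Hb in Hunit; lra).
    apply Rmult_integral in Ha; destruct Ha as [Ha|Ha]; [left|right]; apply Cx_ext; simpl;
      fold a b; lra.
  - exfalso.
    (* Comparing [walk] and [walk_inv] on a slice of [F] leaves
       [2 b (h p * g r - g p * h r) = 0]. *)
    assert (Hcross : forall p r, h p * g r = g p * h r).
    { intros [x k] r; destruct (Nat.lt_ge_cases k (2 * d)) as [Hk|Hk].
      - pose proof (invariant_kernel d hd F HF HFs Hinv k x r Hk) as E.
        rewrite HWr, HWir, Eg', Eh', Ig, Ih in E.
        apply Rmult_eq_reg_l with (2 * b); lra.
      - rewrite (Hgs x k), (Hhs x k) by auto; ring. }
    (* Thus [g] and [h] are proportional; applying [walk] to this relation and evaluating at [p0]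
       gives [b (g^2 + h^2) = 0] there. *)
    assert (E : h p0 * walk d g p0 = g p0 * walk d h p0).
    { assert (E : (fun r => h p0 * g r + 0 * g r) = (fun r => g p0 * h r + 0 * h r))
        by (extensionality r; rewrite Hcross; ring).
      apply (f_equal (walk d)) in E; rewrite !walk_lin in E.
      apply (f_equal (fun u => u p0)) in E; cbv beta in E; lra. }
    rewrite Eg, Eh in E.
    assert (E' : b * (g p0 * g p0 + h p0 * h p0) = 0) by lra.
    apply Rmult_integral in E'; destruct E' as [|E']; [contradiction|].
    pose proof (Rle_0_sqr (g p0)); pose proof (Rle_0_sqr (h p0)); unfold Rsqr in *.
    destruct Hne' as [Hn|Hn]; apply Hn; nra.
Qed.

Fixpoint wt (lam : R) (x : list Z) : R :=
  match x with
  | nil => 1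
  | a :: x' => (if Z.eqb a 0 then 1 else if Z.eqb a 1 then lam else 0) * wt lam x'
  end.

(* Supported on the cube [{0,1}^d], where [wt lam x = lam ^ |x|]; the component in
   direction [+u_j] (resp. [-u_j]) lives on the face [x_j = 1] (resp. [x_j = 0]). *)
Definition cube_vec (lam : R) (p : X) : R :=
  if validb p then
    if Z.eqb (coord (Nat.div2 (snd p)) (fst p)) (if Nat.even (snd p) then 1 else 0)
    then wt lam (fst p) else 0
  else 0.

Lemma wt_coord lam j x : (j < length x)%nat -> coord j x <> 0%Z -> coord j x <> 1%Z -> wt lam x = 0.
Proof.
  unfold coord; revert j; induction x as [|a x IH]; intros [|j] H H0 H1; simpl in *; try lia.
  - destruct (Z.eqb_spec a 0), (Z.eqb_spec a 1); try contradiction; ring.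
  - rewrite (IH j) by (auto; lia); ring.
Qed.

Lemma wt_upd lam j x : (j < length x)%nat -> coord j x = 0%Z -> wt lam (upd j 1 x) = lam * wt lam x.
Proof.
  unfold coord; revert j; induction x as [|a x IH]; intros [|j] H H0; simpl in *; try lia.
  - subst; simpl; ring.
  - rewrite (IH j) by (auto; lia); ring.
Qed.

(** In each direction one of the two components carries the full weight and the other is zero, as
    [x_j] is [1] or [0]; off the cube all terms vanish together with [wt]. *)
Lemma cube_vec_sum lam x : length x = d -> / INR d * nsum (fun m => cube_vec lam (x, m)) (2 * d) = wt lam x.
Proof.
  intros Hx; rewrite <- nsum_pair.
  rewrite (nsum_ext _ (fun _ => wt lam x)), nsum_const.
  - field; apply not_0_INR; lia.
  - intros j Hj; unfold cube_vec, validb; cbn [fst snd].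
    rewrite Hx, Nat.eqb_refl.
    destruct (Nat.ltb_spec (2 * j) (2 * d)), (Nat.ltb_spec (2 * j + 1) (2 * d)); try lia.
    cbn [andb]; rewrite div2_2j, div2_2j1.
    replace (Nat.even (2 * j)) with true by (rewrite Nat.even_mul; reflexivity).
    replace (Nat.even (2 * j + 1)) with false by (rewrite Nat.even_add, Nat.even_mul; reflexivity).
    destruct (Z.eqb_spec (coord j x) 1), (Z.eqb_spec (coord j x) 0); try lia; try ring.
    rewrite (wt_coord lam j x) by (auto; lia); ring.
Qed.

Lemma cube_vec_supported lam : supported d (cube_vec lam).
Proof.
  intros x k H; unfold cube_vec; destruct (validb (x, k)) eqn:E; auto.
  apply validb_true in E; lia.
Qed.

(** The coin replaces a component by [wt] minus itself, which moves it to the opposite face of the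
    cube; the translation moves it back along an edge. The weight changes by a factor [lam] or
    [1/lam] along the edge, and these agree because [lam^2 = 1]. *)
Lemma cube_vec_eig lam p : lam * lam = 1 -> walk d (cube_vec lam) p = lam * cube_vec lam p.
Proof.
  intros Hlam; destruct p as [x k]; destruct (validb (x, k)) eqn:E.
  2: { apply validb_false in E.
       rewrite walk_supported, cube_vec_supported by auto using cube_vec_supported; ring. }
  apply validb_true in E; destruct E as [Hx Hk].
  assert (Hj := div2_lt d hd k Hk).
  unfold walk, trans, coin; cbn [fst snd]; destruct (Nat.ltb_spec k (2 * d)) as [_|]; [|lia].
  rewrite cube_vec_sum by now rewrite upd_length.
  set (j := Nat.div2 k) in *.
  unfold cube_vec, validb; cbn [fst snd]; rewrite upd_length, Hx, Nat.eqb_refl.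
  destruct (Nat.ltb_spec k (2 * d)) as [_|]; [|lia]; cbn [andb]; fold j.
  rewrite coord_upd by lia; unfold dir; destruct (Nat.even k).
  - destruct (Z.eqb_spec (coord j x) 1) as [E1|E1].
    + destruct (Z.eqb_spec (coord j x + -1) 1); [lia|].
      pose proof (wt_upd lam j (upd j (-1) x)) as H; rewrite upd_length, coord_upd, upd_upd, upd_0 in H by lia.
      rewrite H by lia; rewrite <- Rmult_assoc, Hlam; ring.
    + destruct (Z.eqb_spec (coord j x + -1) 1); [ring|].
      rewrite (wt_coord lam j (upd j (-1) x)); [ring|rewrite upd_length; lia|rewrite coord_upd; lia|rewrite coord_upd; lia].
  - destruct (Z.eqb_spec (coord j x) 0) as [E1|E1].
    + destruct (Z.eqb_spec (coord j x + 1) 0); [lia|].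
      rewrite wt_upd by lia; ring.
    + destruct (Z.eqb_spec (coord j x + 1) 0); [ring|].
      rewrite (wt_coord lam j (upd j 1 x)); [ring|rewrite upd_length; lia|rewrite coord_upd; lia|rewrite coord_upd; lia].
Qed.

Lemma cube_vec_l2 lam : l2 (cube_vec lam).
Proof.
  apply (l2_finite _ (boxlist 1)); intros [x k] Hn.
  destruct (validb (x, k)) eqn:E; [|apply cube_vec_supported; now apply validb_false].
  apply validb_true in E; destruct E as [Hx Hk].
  assert (H : wt lam x = 0).
  { apply NNPP; intros Hw; apply Hn, in_prod; [|apply in_seq; lia].
    apply in_box; split; auto; intros z Hz; apply (In_nth _ _ 0%Z) in Hz.
    destruct Hz as [i [Hi Ez]]; apply NNPP; intros Hz; apply Hw, (wt_coord lam i); auto;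
      unfold coord; rewrite Ez; lia. }
  unfold cube_vec; destruct (validb (x, k)); auto; destruct Z.eqb; auto.
Qed.

Lemma nth_zero_pt c j : nth j (zero_pt c) 0%Z = 0%Z.
Proof. unfold zero_pt; revert j; induction c as [|c IH]; intros [|j]; simpl; auto. Qed.

(** Component [1] belongs to a direction [-u_j], whose face [x_j = 0] contains the origin; component
    [0] would vanish there. *)
Lemma cube_vec_origin lam : cube_vec lam (zero_pt d, 1%nat) = 1.
Proof.
  assert (Hw : forall c, wt lam (zero_pt c) = 1).
  { intros c; induction c as [|c IH]; simpl; [reflexivity|].
    unfold zero_pt in IH; rewrite IH; ring. }
  unfold cube_vec, validb; cbn [fst snd]; unfold coord; rewrite nth_zero_pt.
  unfold zero_pt at 1; rewrite repeat_length, Nat.eqb_refl.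
  destruct (Nat.ltb_spec 1 (2 * d)); [|lia]; simpl; apply Hw.
Qed.

Lemma eigenvalue_cube lam : lam * lam = 1 -> eigenvalue d (U_grover d) (mkCx lam 0).
Proof.
  intros Hlam; exists (fun x k => CR (cube_vec lam (x, k))).
  assert (Hs : state_supp (fun x k => CR (cube_vec lam (x, k)))).
  { intros x k Hx; now rewrite cube_vec_supported. }
  assert (Er : rpart (fun x k => CR (cube_vec lam (x, k))) = cube_vec lam)
    by (extensionality p; destruct p; reflexivity).
  assert (Ei : ipart (fun x k => CR (cube_vec lam (x, k))) = fun _ => 0)
    by (extensionality p; destruct p; reflexivity).
  split; [|split].
  - apply in_H_parts; rewrite Er, Ei; auto using cube_vec_l2, l2_zero.
  - exists (zero_pt d), 1%nat; rewrite cube_vec_origin; intros E; injection E; lra.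
  - apply eig_of_parts; auto.
    + intros p; rewrite Er; now apply cube_vec_eig.
    + intros p; rewrite Ei, walk_zero; ring.
Qed.

(** * Spectral projections and time averages *)

(** Walk and eigenvalue are real, so real and imaginary parts can be projected separately; complex
    orthogonality reduces to four real pairings. *)
Lemma is_eig_proj_of_parts e (g : state) (hr hi : X -> R) : state_supp g ->
  l2 (rpart g) -> l2 (ipart g) -> l2 hr -> l2 hi -> supported d hr -> supported d hi ->
  (forall p, walk d hr p = e * hr p) -> (forall p, walk d hi p = e * hi p) ->
  eig_orth d e (fun p => 1 * rpart g p + -1 * hr p) ->
  eig_orth d e (fun p => 1 * ipart g p + -1 * hi p) ->
  is_eig_proj d (U_grover d) (mkCx e 0) g (fun x k => mkCx (hr (x, k)) (hi (x, k))).
Proof.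
  intros Hs Hgr Hgi Hhr Hhi Hhrs Hhis Er Ei Or Oi.
  set (h := fun x k => mkCx (hr (x, k)) (hi (x, k))).
  assert (Hr : rpart h = hr) by (extensionality p; destruct p; reflexivity).
  assert (Hi : ipart h = hi) by (extensionality p; destruct p; reflexivity).
  assert (Hhs : state_supp h).
  { intros x k Hx; unfold h; rewrite Hhrs, Hhis by auto; reflexivity. }
  split; [|split].
  - apply in_H_parts; now rewrite Hr, Hi.
  - apply eig_of_parts; auto; now rewrite ?Hr, ?Hi.
  - intros v Hv Hveig; apply in_H_parts in Hv; destruct Hv as [Hvs [Hvr Hvi]].
    destruct (eig_parts _ v Hvs Hveig) as [Evr Evi]; simpl in Evr, Evi.
    assert (Evr' : forall p, walk d (rpart v) p = e * rpart v p) by (intros p; rewrite Evr; ring).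
    assert (Evi' : forall p, walk d (ipart v) p = e * ipart v p) by (intros p; rewrite Evi; ring).
    assert (Dr : rpart (fun x k => Csub (g x k) (h x k)) = fun p => 1 * rpart g p + -1 * hr p).
    { extensionality p; destruct p; unfold rpart; simpl; ring. }
    assert (Di : ipart (fun x k => Csub (g x k) (h x k)) = fun p => 1 * ipart g p + -1 * hi p).
    { extensionality p; destruct p; unfold ipart; simpl; ring. }
    apply ortho_of_parts; rewrite ?Dr, ?Di; auto using l2_lin.
Qed.

Lemma delta0_supp phi : state_supp (delta0_tensor d phi).
Proof.
  intros x k H; unfold delta0_tensor.
  destruct (list_eq_dec Z.eq_dec x (zero_pt d)) as [->|]; auto.
  unfold zero_pt in H; rewrite repeat_length in H.
  destruct (Nat.ltb_spec k (2 * d)); [lia|reflexivity].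
Qed.

Lemma delta0_l2 phi : l2 (rpart (delta0_tensor d phi)) /\ l2 (ipart (delta0_tensor d phi)).
Proof.
  assert (H : forall x k, ~ In (x, k) (map (pair (zero_pt d)) (seq 0 (2 * d))) ->
     delta0_tensor d phi x k = Czero).
  { intros x k Hn; unfold delta0_tensor.
    destruct (list_eq_dec Z.eq_dec x (zero_pt d)) as [->|]; auto.
    destruct (Nat.ltb_spec k (2 * d)); auto.
    exfalso; apply Hn, in_map, in_seq; lia. }
  split; apply l2_finite with (map (pair (zero_pt d)) (seq 0 (2 * d))); intros [x k] Hn;
    unfold rpart, ipart; simpl fst; simpl snd; now rewrite H.
Qed.

Lemma Un_cv_nsum (u : nat -> nat -> R) (c : nat -> R) m :
  (forall k, Un_cv (u k) (c k)) -> Un_cv (fun N => nsum (fun k => u k N) m) (nsum c m).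
Proof.
  intros H; induction m as [|m IH]; simpl; [|now apply CV_plus].
  intros eps He; exists 0%nat; intros; unfold Rdist; rewrite Rminus_diag, Rabs_R0; lra.
Qed.

Lemma av_nsum (u : nat -> nat -> R) m N :
  av (fun n => nsum (fun k => u k n) m) N = nsum (fun k => av (u k) N) m.
Proof.
  induction m as [|m IH]; simpl; [apply av_const|].
  rewrite <- IH.
  replace (fun n => nsum (fun k => u k n) m + u m n)
    with (fun n => 1 * nsum (fun k => u k n) m + 1 * u m n) by (extensionality n; ring).
  rewrite av_lin; ring.
Qed.

Lemma vnorm2_nsum v : vnorm2 d v = nsum (fun k => Cnorm2 (v k)) (2 * d).
Proof. unfold vnorm2; apply (lsum_seq (fun k => Cnorm2 (v k))). Qed.

Lemma cesaro_limit phi x : exists hp hm : state,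
  is_eig_proj d (U_grover d) Cone (delta0_tensor d phi) hp /\
  is_eig_proj d (U_grover d) Cmone (delta0_tensor d phi) hm /\
  Un_cv (cesaro d (U_grover d) phi x) (vnorm2 d (hp x) + vnorm2 d (hm x)).
Proof.
  assert (Hs := delta0_supp phi); destruct (delta0_l2 phi) as [Hr Hi].
  destruct (time_average d hd _ Hr (rpart_supported _ Hs))
    as [pr [mr [Lpr [Spr [Epr [Opr [Lmr [Smr [Emr [Omr Cr]]]]]]]]]].
  destruct (time_average d hd _ Hi (ipart_supported _ Hs))
    as [pi [mi [Lpi [Spi [Epi [Opi [Lmi [Smi [Emi [Omi Ci]]]]]]]]]].
  exists (fun x k => mkCx (pr (x, k)) (pi (x, k))), (fun x k => mkCx (mr (x, k)) (mi (x, k))).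
  split; [now apply is_eig_proj_of_parts|split; [now apply is_eig_proj_of_parts|]].
  rewrite !vnorm2_nsum.
  set (u := fun k n => 1 * (Nat.iter n (walk d) (rpart (delta0_tensor d phi)) (x, k)
                           * Nat.iter n (walk d) (rpart (delta0_tensor d phi)) (x, k))
                     + 1 * (Nat.iter n (walk d) (ipart (delta0_tensor d phi)) (x, k)
                           * Nat.iter n (walk d) (ipart (delta0_tensor d phi)) (x, k))).
  replace (cesaro d (U_grover d) phi x) with (fun N => nsum (fun k => av (u k) N) (2 * d)).
  - replace (nsum (fun k => Cnorm2 (mkCx (pr (x, k)) (pi (x, k)))) (2 * d) +
             nsum (fun k => Cnorm2 (mkCx (mr (x, k)) (mi (x, k)))) (2 * d))
      with (nsum (fun k => (pr (x, k) * pr (x, k) + mr (x, k) * mr (x, k))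
                         + (pi (x, k) * pi (x, k) + mi (x, k) * mi (x, k))) (2 * d)).
    + apply Un_cv_nsum; intros k.
      replace (av (u k)) with (fun N =>
        av (fun n => Nat.iter n (walk d) (rpart (delta0_tensor d phi)) (x, k)
                           * Nat.iter n (walk d) (rpart (delta0_tensor d phi)) (x, k)) N +
        av (fun n => Nat.iter n (walk d) (ipart (delta0_tensor d phi)) (x, k)
                           * Nat.iter n (walk d) (ipart (delta0_tensor d phi)) (x, k)) N)
        by (extensionality N; unfold u; rewrite av_lin; ring).
      apply CV_plus; auto.
    + rewrite (nsum_ext _ (fun k => 1 * Cnorm2 (mkCx (pr (x, k)) (pi (x, k)))
                                  + 1 * Cnorm2 (mkCx (mr (x, k)) (mi (x, k))))).
      * rewrite nsum_lin; ring.
      * intros k _; unfold Cnorm2; simpl; ring.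
  - extensionality N; rewrite <- av_nsum; unfold cesaro, av, lsum; do 3 f_equal.
    extensionality n; unfold p_n; rewrite vnorm2_nsum; apply nsum_ext; intros k _.
    unfold u, Cnorm2; rewrite <- rpart_iter, <- ipart_iter by auto.
    unfold rpart, ipart; simpl; ring.
Qed.

(** If [u] stayed below [c/2] from [N] on, every Banach limit of it would be at most [c/2] by shift
    invariance, whereas one built along late averages is at least [3 c / 4]. *)
Lemma frequently_ge u c : bdd u -> 0 < c -> Un_cv (av u) c ->
  forall N, exists n, (N <= n)%nat /\ c / 2 <= u n.
Proof.
  intros Hu Hc Hcv N; apply NNPP; intros Hn.
  destruct (Hcv (c / 4) ltac:(lra)) as [N0 HN0].
  (* Starting at [N0] keeps every observed average within [c/4] of [c]. *)
  destruct (banach_limit_ex (fun m => (N0 + m)%nat) (fun m => Nat.le_add_l m N0)) as [M [HM HM']].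
  assert (H1 : 3 * c / 4 <= M u).
  { apply (HM' u); auto; intros m; specialize (HN0 (N0 + m)%nat ltac:(lia)).
    unfold Rdist in HN0; apply Rabs_def2 in HN0; lra. }
  assert (H2 : M (fun n => u (N + n)%nat) = M u).
  { clear - Hu HM; induction N as [|N IH]; [reflexivity|].
    rewrite <- IH, <- (bl_shift M HM (fun n => u (N + n)%nat)) by now apply bdd_comp.
    f_equal; extensionality n; f_equal; lia. }
  assert (H3 : M (fun n => u (N + n)%nat) <= c / 2).
  { rewrite <- (bl_const M HM (c / 2)); apply bl_le; auto using bdd_const.
    - now apply bdd_comp.
    - intros n; apply Rnot_lt_le; intros Hlt; apply Hn; exists (N + n)%nat; split; [lia|lra]. }
  lra.
Qed.

(** The initial state is the basis vector of component [1] at the origin, whose pairing with the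
    cube eigenfunction is [1]. Its projection onto the eigenspace of [1] is therefore not zero, and
    any point where that projection does not vanish serves as [x]; the real part alone already gives
    the lower bound. *)
Lemma localized : exists (phi : nat -> Cx) (x : list Z), length x = d /\
  exists eps : R, 0 < eps /\
    forall N : nat, exists n : nat, (N <= n)%nat /\ eps <= p_n d (U_grover d) n phi x.
Proof.
  set (phi := fun k => if Nat.eqb k 1 then Cone else Czero).
  assert (Hs := delta0_supp phi); destruct (delta0_l2 phi) as [Hr _].
  destruct (time_average d hd _ Hr (rpart_supported _ Hs))
    as [hp [hm [Lp [Sp [_ [Op [_ [_ [_ [_ Hcv]]]]]]]]]].
  set (f := rpart (delta0_tensor d phi)) in *.
  set (p0 := (zero_pt d, 1%nat)).
  assert (Hf : f = fun p => if in_dec cdec p (p0 :: nil) then 1 else 0).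
  { extensionality p; destruct p as [x k]; unfold f, rpart, delta0_tensor, phi; cbn [fst snd].
    destruct (in_dec cdec (x, k) (p0 :: nil)) as [[E|[]]|Hn].
    - unfold p0 in E; injection E as <- <-.
      destruct (list_eq_dec Z.eq_dec (zero_pt d) (zero_pt d)); [|contradiction].
      destruct (Nat.ltb_spec 1 (2 * d)); [reflexivity|lia].
    - destruct (list_eq_dec Z.eq_dec x (zero_pt d)) as [->|]; [|reflexivity].
      destruct (Nat.ltb k (2 * d)); [|reflexivity]; cbn [andb].
      destruct (Nat.eqb_spec k 1) as [->|]; [|reflexivity].
      exfalso; apply Hn; now left. }
  assert (Hfe : ip f (cube_vec 1) = 1).
  { rewrite ip_sym, Hf.
    rewrite (ip_trunc (cube_vec 1) (fun _ => 1)) by (constructor; [intros []|constructor]).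
    rewrite lsum_cons; unfold p0; rewrite cube_vec_origin; unfold lsum; simpl; ring. }
  assert (Hne : exists p, hp p <> 0).
  { apply NNPP; intros Hn.
    pose proof (Op (cube_vec 1) (cube_vec_l2 1) (fun p => cube_vec_eig 1 p ltac:(ring))) as H.
    rewrite ip_lin_l, Hfe in H by auto using cube_vec_l2.
    replace hp with (fun _ : X => 0) in H.
    - unfold ip in H; replace (fun j : X => 0 * cube_vec 1 j) with (fun _ : X => 0) in H
        by (extensionality j; ring).
      rewrite sm_zero in H; lra.
    - extensionality p; apply NNPP; intros Hp; apply Hn; exists p; auto. }
  destruct Hne as [[x k] Hne].
  assert (Hv : length x = d /\ (k < 2 * d)%nat).
  { apply validb_true; destruct (validb (x, k)) eqn:E; auto.
    exfalso; apply Hne, Sp; now apply validb_false. }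
  destruct Hv as [Hx Hk].
  set (c := hp (x, k) * hp (x, k) + hm (x, k) * hm (x, k)).
  assert (Hc : 0 < c).
  { pose proof (Rsqr_pos_lt _ Hne); pose proof (Rle_0_sqr (hm (x, k))); unfold Rsqr in *; unfold c; lra. }
  exists phi, x; split; auto; exists (c / 2); split; [lra|]; intros N.
  assert (Hb := iter_bdd d hd f (x, k) Hr).
  destruct (frequently_ge _ c (bdd_mul _ _ Hb Hb) Hc (Hcv (x, k)) N) as [n [Hn Hge]].
  exists n; split; auto; eapply Rle_trans; [exact Hge|].
  unfold f; rewrite <- rpart_iter by auto; unfold p_n; rewrite vnorm2_nsum.
  set (v := Nat.iter n (U_grover d) (delta0_tensor d phi) x).
  assert (Hterm : forall m, (k < m)%nat -> Cnorm2 (v k) <= nsum (fun i => Cnorm2 (v i)) m).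
  { assert (Hnn : forall i, 0 <= Cnorm2 (v i)).
    { intros i; unfold Cnorm2; pose proof (Rle_0_sqr (re (v i))); pose proof (Rle_0_sqr (im (v i))).
      unfold Rsqr in *; lra. }
    intros m; induction m as [|m IH]; [lia|]; intros Hm; simpl.
    destruct (Nat.eq_dec k m) as [->|].
    - assert (0 <= nsum (fun i => Cnorm2 (v i)) m); [|lra].
      clear - Hnn; induction m as [|m IH]; simpl; [lra|specialize (Hnn m); lra].
    - specialize (IH ltac:(lia)); specialize (Hnn m); lra. }
  eapply Rle_trans; [|apply (Hterm (2 * d)%nat Hk)].
  unfold rpart, Cnorm2; cbn [fst snd]; fold v.
  pose proof (Rle_0_sqr (im (v k))); unfold Rsqr in *; lra.
Qed.

End Bridge.

Theorem mainTheorem2 (d : nat) (hd : (2 <= d)%nat) :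
  eigenvalue d (U_grover d) Cone /\
  eigenvalue d (U_grover d) Cmone /\
  (forall lam : Cx, eigenvalue d (U_grover d) lam -> lam = Cone \/ lam = Cmone) /\
  (forall (phi : nat -> Cx) (x : list Z), length x = d ->
     exists hp hm : state,
       is_eig_proj d (U_grover d) Cone (delta0_tensor d phi) hp /\
       is_eig_proj d (U_grover d) Cmone (delta0_tensor d phi) hm /\
       Un_cv (cesaro d (U_grover d) phi x) (vnorm2 d (hp x) + vnorm2 d (hm x))) /\
  (exists (phi_o : nat -> Cx) (x_o : list Z), length x_o = d /\
     exists eps : R, 0 < eps /\
       forall N : nat, exists n : nat, (N <= n)%nat /\ eps <= p_n d (U_grover d) n phi_o x_o).
Proof.
  assert (hd0 : (0 < d)%nat) by lia.
  split; [|split; [|split; [|split]]].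
  - apply eigenvalue_cube; auto; ring.
  - apply eigenvalue_cube; auto; ring.
  - now apply eigenvalue_pm1.
  - intros phi x _; now apply cesaro_limit.
  - now apply localized.
Qed.
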